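(* Let $f$ be a transcendental entire function, let $K(f)=\{z\in\mathbb{C} : (f^n(z))_{n\in\mathbb{N}}\text{ is bounded}\}$ and let $J(f)$ be its Julia set. (a) Either $K(f)\cap J(f)$ is connected, or else every neighbourhood of every point of $J(f)$ meets uncountably many components of $K(f)\cap J(f)$. (b) If $f$ is strongly polynomial-like, then either $K(f)$ is connected, or else every neighbourhood of every point of $J(f)$ meets uncountably many components of $K(f)$.
   Context: $f^n$ denotes the $n$th iterate of $f$. The Fatou set $F(f)$ is the set of $z\in\mathbb{C}$ such that $\{f^n\}$ is normal on some neighbourhood of $z$, and $J(f)=\mathbb{C}\setminus F(f)$. A polynomial-like mapping $(f;V,W)$ consists of bounded simply connected domains $V,W$ with smooth boundaries such that $\overline V\subset W$, and $f:V\to W$ is a proper analytic map of degree $d\ge 2$. A transcendental entire function $f$ is strongly polynomial-like if there exist sequences $(V_n),(W_n)$ of bounded simply connected domains with smooth boundaries such that $V_n\subset V_{n+1}$, $W_n\subset W_{n+1}$ for all $n\in\mathbb{N}$, $\bigcup_n V_n=\bigcup_n W_n=\mathbb{C}$, and each $(f;V_n,W_n)$ is a polynomial-like mapping. *)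

(* Defs.v *)
(* The complex plane is modelled as
   R[i] (real_closed's `complex R`) for an arbitrary R : realType, equipped
   with the standard (modulus) topology / normed structure that
   MathComp-Analysis gives to every numClosedFieldType. *)
From HB Require Import structures.
From mathcomp Require Import all_boot all_order all_algebra.
From mathcomp Require Import all_classical all_reals all_analysis.
From mathcomp Require Import complex.
Import Order.TTheory GRing.Theory Num.Theory.
Import numFieldNormedType.Exports.

Set Implicit Arguments.
Unset Strict Implicit.
Unset Printing Implicit Defensive.

Local Open Scope ring_scope.
Local Open Scope classical_set_scope.

Definition Cplx (R : rcfType) : numClosedFieldType := R[i].
HB.instance Definition _ (R : rcfType) :=
  PseudoPointedMetric.copy (Cplx R) (Cplx R)^o.
HB.instance Definition _ (R : rcfType) :=
  GRing.ComAlgebra.copy (Cplx R) (Cplx R)^o.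
HB.instance Definition _ (R : rcfType) := Vector.copy (Cplx R) (Cplx R)^o.
HB.instance Definition _ (R : rcfType) :=
  NormedModule.copy (Cplx R) (Cplx R)^o.

Section Defs.
Variable R : realType.
Local Notation C := (Cplx R).

Definition cr (r : R) : C := Complex r 0.

Definition holomorphic_on (f : C -> C) (U : set C) :=
  forall z, U z -> derivable f z 1.

Definition entire (f : C -> C) := holomorphic_on f setT.

Definition transcendental_entire (f : C -> C) :=
  entire f /\ ~ (exists p : {poly C}, forall z, f z = p.[z]).

Definition cderiv (j : nat) (f : C -> C) : C -> C :=
  iter j (fun g : C -> C => g^`()) f.

Definition loc_unif_cvg (G : nat -> C -> C) (g : C -> C) (U : set C) :=
  forall K : set C, compact K -> K `<=` U ->
  forall e : R, 0 < e -> exists N : nat, forall k, (N <= k)%N ->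
    forall z, K z -> `|G k z - g z| < cr e.

Definition loc_unif_to_infty (G : nat -> C -> C) (U : set C) :=
  forall K : set C, compact K -> K `<=` U ->
  forall M : R, exists N : nat, forall k, (N <= k)%N ->
    forall z, K z -> cr M < `|G k z|.

Definition normal_on (F : nat -> C -> C) (U : set C) :=
  forall s : nat -> nat, exists phi : nat -> nat,
    (forall k, (phi k < phi k.+1)%N) /\
    ((exists g : C -> C, loc_unif_cvg (fun k => F (s (phi k))) g U) \/
     loc_unif_to_infty (fun k => F (s (phi k))) U).

Definition Fatou (f : C -> C) : set C :=
  [set z | exists U : set C, [/\ open U, U z & normal_on (fun n => iter n f) U]].

Definition Julia (f : C -> C) : set C := ~` Fatou f.

Definition Kset (f : C -> C) : set C :=
  [set z | exists M : R, forall n, `|iter n f z| <= cr M].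

Definition components_meeting (A N : set C) : set (set C) :=
  [set Cc | exists2 x, A x & Cc = connected_component A x /\ Cc `&` N !=set0].

Definition uncountably_many_components_near (A J : set C) :=
  forall w, J w -> forall N : set C, nbhs w N ->
    ~ countable (components_meeting A N).

Definition unit_itv : set R := [set t | 0 <= t <= 1].
Definition unit_sq : set (R * R) := [set p | unit_itv p.1 /\ unit_itv p.2].

Definition domain (V : set C) := [/\ open V, connected V & V !=set0].

Definition simply_connected (V : set C) :=
  domain V /\
  forall g : R -> C, {within unit_itv, continuous g} -> g 0 = g 1 ->
    (forall t, unit_itv t -> V (g t)) ->
    exists H : R * R -> C, [/\ {within unit_sq, continuous H},
      (forall p, unit_sq p -> V (H p)),
      (forall s, unit_itv s -> H (s, 0) = g s /\ H (s, 1) = g 0) &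
      (forall t, unit_itv t -> H (0, t) = g 0 /\ H (1, t) = g 0)].

Definition smooth_real (u : R -> R) :=
  forall n t, derivable (iter n (fun v : R -> R => v^`()) u) t 1.

Definition smooth_boundary (V : set C) :=
  exists x y : R -> R, [/\ smooth_real x /\ smooth_real y,
    (forall t, x (t + 1) = x t /\ y (t + 1) = y t),
    (forall t, x^`() t != 0 \/ y^`() t != 0),
    (forall s t, 0 <= s < 1 -> 0 <= t < 1 ->
        Complex (x s) (y s) = Complex (x t) (y t) -> s = t) &
    closure V `\` V = [set Complex (x t) (y t) | t in [set t | 0 <= t < 1]]].

Definition local_degree (f : C -> C) (z : C) (k : nat) :=
  [/\ (0 < k)%N, (forall j, (0 < j < k)%N -> cderiv j f z = 0) &
      cderiv k f z != 0].

Definition has_degree (f : C -> C) (V W : set C) (d : nat) :=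
  forall w, W w -> exists s : seq C,
    [/\ uniq s, (forall z, z \in s <-> (V z /\ f z = w)) &
     exists m : C -> nat, (forall z, z \in s -> local_degree f z (m z)) /\
       (\sum_(z <- s) m z)%N = d].

Definition proper_map (f : C -> C) (V W : set C) :=
  forall K : set C, compact K -> K `<=` W -> compact (V `&` f @^-1` K).

Definition nice_domain (V : set C) :=
  [/\ bounded_set V, simply_connected V & smooth_boundary V].

Definition polynomial_like (f : C -> C) (V W : set C) :=
  [/\ nice_domain V /\ nice_domain W, closure V `<=` W,
      holomorphic_on f V /\ (forall z, V z -> W (f z)),
      proper_map f V W &
      exists d : nat, (2 <= d)%N /\ has_degree f V W d].

Definition strongly_polynomial_like (f : C -> C) :=
  transcendental_entire f /\
  exists Vs Ws : nat -> set C,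
    [/\ (forall n, Vs n `<=` Vs n.+1), (forall n, Ws n `<=` Ws n.+1),
        \bigcup_n Vs n = setT, \bigcup_n Ws n = setT &
        forall n, polynomial_like f (Vs n) (Ws n)].

End Defs.

(* Main.v *)
(* If E (either K(f) meet J(f), or K(f)) is disconnected, write E as a union of
   separated sets A and B. Suppose both contain points of J(f); such points are not
   isolated in J(f), so each side has two small disjoint discs centred in J(f) in which
   every point of E lies on that side. By Montel's theorem some iterate of any disc
   centred in J(f) covers one of the two discs on each side, at the same time. Hence every
   sequence of sides is the itinerary of a point of J(f) with bounded orbit, in any
   neighbourhood of any point of J(f). As E is forward invariant and iterates map
   components into components, points with distinct itineraries lie in distinct
   components. In (b), if A does not meet J(f), a compact part of it would be open.

   Montel's theorem is proved with an Ahlfors-Schwarz lemma for an explicit metric on the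
   plane minus two points, which bounds |F'| by a multiple of 1 + |F|^2. The only complex
   analysis this needs is that the derivative of an entire function is entire (Goursat's
   theorem and the Cauchy formula on a square): maximum principles and curvature are
   handled through second order Taylor expansions. *)

Require Import Defs.
From HB Require Import structures.
From mathcomp Require Import all_boot all_order all_algebra.
From mathcomp Require Import all_classical all_reals all_analysis.
From mathcomp Require Import complex.
From mathcomp Require Import ring lra.
Import Order.TTheory GRing.Theory Num.Theory.
Import numFieldNormedType.Exports.
Local Open Scope ring_scope.
Local Open Scope classical_set_scope.

Set Implicit Arguments.
Unset Strict Implicit.

(** * The modulus and complex differentiability *)

(** Two itineraries can be told apart only if both orbits stand on opposite sides at one and the
    same time, so a single iterate has to cover a disc on either side. Along a sequence of iterates
    without normal subsequence, all but finitely many cover one of two given bounded, separated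
    sets, and the late terms do so for the pairs of both sides at once. These four discs and a
    starting disc form a transition system with one time per disc; its finiteness bounds the orbits,
    and equal prefixes take equal times.

    The values omitted by an iterate depend on that iterate, and normality must hold on a
    neighbourhood fixed before the subsequence. Hence the Montel part is uniform throughout:
    constants depend on a bound and a separation of the omitted values, and radii on these constants
    alone. The spherical derivative is the common quantity, as it treats finite limits and
    divergence to infinity alike.

    Non-isolation in J(f) is proved for a point of bounded orbit, by carrying bounds around a circle
    near which the iterates omit two points of J(f). *)

HB.lock Definition md (R : realType) (z : Cplx R) : R :=
  Num.sqrt (complex.Re z ^+ 2 + complex.Im z ^+ 2).
Arguments md {R} z.

Section Modulus.
Variable R : realType.
Local Notation C := (Cplx R).
Local Notation re := (@complex.Re R).
Local Notation im := (@complex.Im R).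

Definition cj (z : C) : C := Complex (re z) (- im z).

(** The norm of [Cplx R] is itself complex-valued. Passing to the real-valued [md] moves all
    estimates into [R], within reach of [lra] and [nra]. *)
Lemma norm_md (z : C) : `|z| = cr (md z).
Proof. by rewrite md.unlock; exact: normc_def. Qed.

Lemma cr_le (x y : R) : (cr x <= cr y) = (x <= y).
Proof. exact: lecR. Qed.

Lemma cr_lt (x y : R) : (cr x < cr y) = (x < y).
Proof. exact: ltcR. Qed.

Lemma crD (x y : R) : cr (x + y) = cr x + cr y.
Proof. by rewrite /cr /=; apply/eqP; rewrite eq_complex /= addr0 !eqxx. Qed.

Lemma crN (x : R) : cr (- x) = - cr x.
Proof. by apply/eqP; rewrite eq_complex /= oppr0 !eqxx. Qed.

Lemma crM (x y : R) : cr (x * y) = cr x * cr y.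
Proof.
by apply/eqP; rewrite eq_complex /= !mulr0 !mul0r subr0 addr0 !eqxx.
Qed.

Lemma cr_inj : injective (@cr R).
Proof. by move=> x y []. Qed.

Lemma cr0 : cr 0 = 0 :> C. Proof. by []. Qed.
Lemma cr1 : cr 1 = 1 :> C. Proof. by []. Qed.

Lemma cr_gt0 (x : R) : (0 < cr x) = (0 < x).
Proof. by rewrite -cr0 cr_lt. Qed.

Lemma pos_cr (e : C) : 0 < e -> exists2 d : R, 0 < d & e = cr d.
Proof.
case: e => a b; rewrite ltcE /= => /andP[/eqP -> a0].
by exists a.
Qed.

Implicit Types x y z : C.

Lemma mdM x y : md (x * y) = md x * md y.
Proof. by apply: cr_inj; rewrite crM -!norm_md normrM. Qed.

Lemma ler_mdD x y : md (x + y) <= md x + md y.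
Proof. by rewrite -cr_le crD -!norm_md ler_normD. Qed.

Lemma mdN x : md (- x) = md x.
Proof. by apply: cr_inj; rewrite -!norm_md normrN. Qed.

Lemma mdB x y : md (x - y) = md (y - x).
Proof. by rewrite -mdN opprB. Qed.

Lemma md0 : md (0 : C) = 0.
Proof. by apply: cr_inj; rewrite -!norm_md normr0. Qed.

Lemma md1 : md (1 : C) = 1.
Proof. by apply: cr_inj; rewrite -!norm_md normr1. Qed.

Lemma md_ge0 x : 0 <= md x.
Proof. by rewrite md.unlock; exact: sqrtr_ge0. Qed.

Lemma md_eq0 x : (md x == 0) = (x == 0).
Proof.
apply/eqP/eqP => [h|->]; last exact: md0.
by apply/eqP; rewrite -normr_eq0 norm_md h.
Qed.

Lemma md_gt0 x : (0 < md x) = (x != 0).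
Proof. by rewrite lt_neqAle md_ge0 andbT eq_sym md_eq0. Qed.

Lemma mdX x n : md (x ^+ n) = md x ^+ n.
Proof. by elim: n => [|n IH]; rewrite ?expr0 ?md1 // !exprS mdM IH. Qed.

Lemma mdV x : md x^-1 = (md x)^-1.
Proof.
have [->|x0] := eqVneq x 0; first by rewrite invr0 md0 invr0.
have m0 : md x != 0 by rewrite md_eq0.
by apply: (mulfI m0); rewrite -mdM !divff // md1.
Qed.

Lemma md_cr (x : R) : md (cr x) = `|x|.
Proof. by rewrite md.unlock /= expr0n /= addr0 sqrtr_sqr. Qed.

Lemma sqr_md z : md z ^+ 2 = re z ^+ 2 + im z ^+ 2.
Proof. by rewrite md.unlock sqr_sqrtr // addr_ge0 // sqr_ge0. Qed.

Lemma ler_re_md z : `|re z| <= md z.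
Proof.
rewrite -(@ler_pXn2r _ 2) ?nnegrE ?md_ge0 // sqr_md real_normK ?num_real //.
by rewrite -subr_ge0; have := sqr_ge0 (im z); lra.
Qed.

Lemma ler_im_md z : `|im z| <= md z.
Proof.
rewrite -(@ler_pXn2r _ 2) ?nnegrE ?md_ge0 // sqr_md real_normK ?num_real //.
by rewrite -subr_ge0; have := sqr_ge0 (re z); lra.
Qed.

Lemma md_le_reim z : md z <= `|re z| + `|im z|.
Proof.
rewrite -(@ler_pXn2r _ 2) ?nnegrE ?md_ge0 ?addr_ge0 // sqr_md.
rewrite sqrrD !real_normK ?num_real //.
have : 0 <= `|re z| * `|im z| by rewrite mulr_ge0.
by rewrite mulr2n; lra.
Qed.

Lemma reD (x y : C) : re (x + y) = re x + re y. Proof. by case: x; case: y. Qed.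
Lemma imD (x y : C) : im (x + y) = im x + im y. Proof. by case: x; case: y. Qed.
Lemma reN (x : C) : re (- x) = - re x. Proof. by case: x. Qed.
Lemma imN (x : C) : im (- x) = - im x. Proof. by case: x. Qed.
Lemma reM (x y : C) : re (x * y) = re x * re y - im x * im y.
Proof. by case: x; case: y. Qed.
Lemma imM (x y : C) : im (x * y) = re x * im y + im x * re y.
Proof. by case: x => a b; case: y => c d /=. Qed.
Definition reimE := (reD, imD, reN, imN, reM, imM).

Lemma cplx_eq (x y : C) : re x = re y -> im x = im y -> x = y.
Proof. by case: x => a b; case: y => c d /= -> ->. Qed.

Lemma md_cj z : md (cj z) = md z.
Proof. by rewrite md.unlock /= sqrrN. Qed.

Lemma mulcj z : z * cj z = cr (md z ^+ 2).
Proof. by apply: cplx_eq; rewrite reimE /= ?sqr_md; ring. Qed.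

Lemma ler_mdB x y : md x - md y <= md (x - y).
Proof. by rewrite lerBlDr; have := ler_mdD (x - y) y; rewrite subrK. Qed.

Lemma md_dist x y : `|md x - md y| <= md (x - y).
Proof. by rewrite ler_norml ler_mdB andbT lerNl opprB mdB ler_mdB. Qed.

Lemma md_tri x y z : md (x - z) <= md (x - y) + md (y - z).
Proof. by have := ler_mdD (x - y) (y - z); rewrite subrKA. Qed.

Lemma crV (x : R) : cr x^-1 = (cr x)^-1.
Proof.
have [->|x0] := eqVneq x 0; first by rewrite invr0 cr0 invr0.
have m0 : cr x != 0 by rewrite -md_eq0 md_cr normr_eq0.
by apply: (mulfI m0); rewrite -crM !divff.
Qed.

(** The derivative without a quotient: [h = 0] is allowed and errors combine by the triangle
    inequality. [cder] is the complex version. *)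
Definition rder (f : R -> R) (x : R) l := forall e, 0 < e -> exists2 d, 0 < d &
  forall h, `|h| < d -> `|f (x + h) - f x - l * h| <= e * `|h|.

Definition cder (f : C -> C) (x l : C) := forall e, 0 < e -> exists2 d, 0 < d &
  forall h, md h < d -> md (f (x + h) - f x - l * h) <= e * md h.

Lemma rder_is_derive f (x : R) l : rder f x l <-> is_derive x 1 f l.
Proof.
split => [H|[D <-] e e0].
- have L : (fun h : R => h^-1 *: ((f \o shift x) (h *: 1) - f x)) @ 0^' --> l.
    apply/cvgrPdist_le => e e0; have [d d0 dP] := H e e0.
    apply/nbhs_ballP; exists d => //= h /=; rewrite /ball /= sub0r normrN => hd h0.
    rewrite [h *: 1]mulr1 /= [h + x]addrC [_ *: _]mulrC.
    have -> : l - (f (x + h) - f x) / h = - ((f (x + h) - f x - l * h) / h).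
      by field.
    by rewrite normrN normrM normfV ler_pdivrMr ?normr_gt0 // dP.
  by split; [apply/cvg_ex; exists l | exact: cvg_lim].
- have /cvgrPdist_le/(_ e e0) := D.
  move=> /nbhs_ballP [d /= d0 dP]; exists d => // h hd.
  have [->|h0] := eqVneq h 0; first by rewrite addr0 subrr mulr0 subr0 normr0 mulr0.
  have := dP h; rewrite /ball /= sub0r normrN => /(_ hd h0).
  rewrite [h *: 1]mulr1 /= [h + x]addrC [_ *: _]mulrC -/(derive f x 1).
  set L := 'D_1 f x.
  have -> : L - (f (x + h) - f x) / h = - ((f (x + h) - f x - L * h) / h).
    by field.
  by rewrite normrN normrM normfV ler_pdivrMr ?normr_gt0.
Qed.

Lemma cder_is_derive (f : C -> C) z l : cder f z l <-> is_derive z 1 f l.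
Proof.
split => [H|[D <-]].
- suff L : (fun h : C => h^-1 *: ((f \o shift z) (h *: 1) - f z)) @ 0^' --> l.
    by split; [apply/cvg_ex; exists l | exact: cvg_lim].
  apply/cvgrPdist_le => e' e0'.
  have [e e0 ->] := pos_cr e0'; have [d d0 dP] := H e e0.
  apply/nbhs_ballP; exists (cr d); rewrite /= ?cr_gt0 // => h /=.
  rewrite /ball /= sub0r normrN norm_md cr_lt => hd h0.
  rewrite [h *: 1]mulr1 /= [h + z]addrC [_ *: _]mulrC.
  have -> : l - (f (z + h) - f z) / h = - ((f (z + h) - f z - l * h) / h).
    by field.
  by rewrite norm_md cr_le mdN mdM mdV ler_pdivrMr ?md_gt0 // dP.
- move=> e e0.
  have e0' : 0 < cr e by rewrite cr_gt0.
  have /cvgrPdist_le/(_ _ e0') := D.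
  move=> /nbhs_ballP [d' /= d0' dP]; have [d d0 dE] := pos_cr d0'.
  exists d => // h hd.
  have [->|h0] := eqVneq h 0; first by rewrite addr0 subrr mulr0 subr0 md0 mulr0.
  have := dP h; rewrite /ball /= sub0r normrN norm_md dE cr_lt => /(_ hd h0).
  rewrite [h *: 1]mulr1 /= [h + z]addrC [_ *: _]mulrC -/(derive f z 1).
  set L := 'D_1 f z.
  have -> : L - (f (z + h) - f z) / h = - ((f (z + h) - f z - L * h) / h).
    by field.
  by rewrite norm_md cr_le mdN mdM mdV ler_pdivrMr ?md_gt0.
Qed.

Lemma derivable_cder (f : C -> C) z : derivable f z 1 <-> exists l, cder f z l.
Proof.
split => [/derivableP /cder_is_derive D|[l /cder_is_derive []//]].
by exists ('D_1 f z).
Qed.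

End Modulus.

(** * Topology of the plane in terms of the real modulus *)

Section Topology.
Variable R : realType.
Local Notation C := (Cplx R).
Local Notation re := (@complex.Re R).
Local Notation im := (@complex.Im R).

Lemma nbhs_md (z : C) (N : set C) :
  nbhs z N <-> exists2 d : R, 0 < d & forall w, md (w - z) < d -> N w.
Proof.
split.
- move/nbhs_ballP => [d' /= d0' dP]; have [d d0 dE] := pos_cr d0'.
  exists d => // w wd; apply: dP.
  by rewrite /ball /= norm_md dE cr_lt mdB.
- move=> [d d0 dP]; apply/nbhs_ballP; exists (cr d); rewrite /= ?cr_gt0 //.
  by move=> w; rewrite /ball /= norm_md cr_lt mdB; apply: dP.
Qed.

Lemma open_md (U : set C) : open U <->
  forall z, U z -> exists2 d : R, 0 < d & forall w, md (w - z) < d -> U w.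
Proof.
rewrite openE; split => H z /H; first by rewrite /interior => /nbhs_md.
by rewrite /interior => h; apply/nbhs_md.
Qed.

Lemma open_disc (a : C) (r : R) : open [set z | md (z - a) < r].
Proof.
apply/open_md => z /= zr; exists (r - md (z - a)); first by rewrite subr_gt0.
move=> w /= wz; apply: le_lt_trans (md_tri w z a) _.
by rewrite -ltrBrDr.
Qed.

Lemma closed_cball (a : C) (r : R) : closed [set z | md (z - a) <= r].
Proof.
rewrite -openC; apply/open_md => z /= /negP; rewrite -ltNge => zr.
exists (md (z - a) - r); first by rewrite subr_gt0.
move=> w wz; apply/negP; rewrite -ltNge.
by have := md_tri z w a; rewrite (mdB z w); lra.
Qed.

Lemma continuous_Complex :
  continuous (fun p : R * R => Complex p.1 p.2 : C).
Proof.
move=> [x y] N /nbhs_md [d d0 dP].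
have d20 : 0 < d / 2 by rewrite divr_gt0.
exists (ball x (d / 2), ball y (d / 2)).
  by split; apply: nbhsx_ballx.
move=> [x' y'] [/= xx yy]; apply: dP.
apply: le_lt_trans (md_le_reim _) _; rewrite !reimE /=.
by move: xx yy; rewrite /ball /= distrC (distrC y); lra.
Qed.

Lemma compact_cball (a : C) (r : R) : compact [set z | md (z - a) <= r].
Proof.
pose B : set C := (fun p : R * R => Complex p.1 p.2 : C) @`
  (`[re a - r, re a + r] `*` `[im a - r, im a + r]).
apply: (@subclosed_compact C _ B (@closed_cball a r)).
  apply: continuous_compact; last by apply: compact_setX; apply: segment_compact.
  by apply: continuous_subspaceT; apply: continuous_Complex.
move=> z /= h; exists (re z, im z); last exact: (@cplx_eq R (Complex (re z) (im z)) z).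
have := ler_re_md (z - a); have := ler_im_md (z - a).
rewrite !reimE !ler_norml => /andP[? ?] /andP[? ?].
by split; rewrite /= in_itv /=; apply/andP; split; lra.
Qed.

Definition cont_in (A : set C) (u : C -> R) := forall z, A z ->
  forall e, 0 < e -> exists2 d, 0 < d &
    forall w, A w -> md (w - z) < d -> `|u w - u z| < e.

Lemma compact_max (A : set C) (u : C -> R) : A !=set0 -> compact A ->
  cont_in A u -> exists2 c, A c & forall t, A t -> u t <= u c.
Proof.
move=> A0 cA cu; have := @compact_EVT_max C R u A A0 cA.
case => [|c /set_mem Ac H]; last first.
  by exists c => // t At; apply: H; apply: mem_set.
apply/subspace_continuousP => z Az.
move=> N /nbhs_ballP [e /= e0 eN]; have [d d0 dP] := cu z Az e e0.
have H : nbhs z [set w | A w -> N (u w)].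
  apply/nbhs_md; exists d => // w wd Aw; apply: eN.
  by rewrite /ball /= distrC; apply: dP.
exact: H.
Qed.

Definition ccont_at (g : C -> C) z := forall e : R, 0 < e -> exists2 d : R, 0 < d &
  forall w, md (w - z) < d -> md (g w - g z) < e.

Lemma continuous_ccont (g : C -> C) : (forall z, ccont_at g z) -> continuous g.
Proof.
move=> H z N /nbhs_md [e e0 eN]; have [d d0 dP] := H z e e0.
by apply/nbhs_md; exists d => // w /dP /eN.
Qed.

Lemma compact_bound (A : set C) : compact A -> exists M : R, forall z, A z -> md z <= M.
Proof.
move=> cA; have [[z0 Az0]|/set0P/negP] := pselect (A !=set0); last first.
  by rewrite negbK => /eqP ->; exists 0.
have [] := @compact_max A md _ cA; first by exists z0.
  move=> z Az e e0; exists e => // w Aw; apply: le_lt_trans; exact: md_dist.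
by move=> c Ac H; exists (md c).
Qed.

Lemma compact_seq (A : set C) (x : nat -> C) : compact A -> (forall n, A (x n)) ->
  exists2 z, A z & forall (d : R) N, 0 < d -> exists2 n, (N <= n)%N & md (x n - z) < d.
Proof.
move=> cA Ax; have := cA (x @ \oo) _ _; case.
  by exists 0 => // n _; apply: Ax.
move=> z [Az cl]; exists z => // d N d0.
have : nbhs z [set w | md (w - z) < d] by apply/nbhs_md; exists d.
have h : (x @ \oo) [set w | exists2 n, (N <= n)%N & w = x n].
  by exists N => // n /= Nn; exists n.
by move=> /(cl _ _ h) [w [[n Nn ->] /= wd]]; exists n.
Qed.

End Topology.

(** * Mean value theorem and primitives on the real line *)

Section RealCalc.
Variable R : realType.
Implicit Types f g : R -> R.

Lemma rder_cont f x l : rder f x l -> forall e, 0 < e -> exists2 d, 0 < d &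
  forall y, `|y - x| < d -> `|f y - f x| < e.
Proof.
move=> /(_ 1 ltr01) [d d0 dP] e e0.
have k0 : 0 < e / (2 + `|l|) by rewrite divr_gt0 // ltr_wpDr.
exists (Num.min d (e / (2 + `|l|))); first by rewrite lt_min d0.
move=> y; rewrite lt_min => /andP[yd ye].
have := dP (y - x) yd; rewrite (_ : x + (y - x) = y) ?mul1r => [h|]; last by ring.
have -> : f y - f x = (f y - f x - l * (y - x)) + l * (y - x) by ring.
apply: le_lt_trans (ler_normD _ _) _; rewrite normrM.
have l0 := normr_ge0 l; move: ye; rewrite ltr_pdivlMr; last by lra.
have := normr_ge0 (y - x); nra.
Qed.

Lemma rMVT f df (a b : R) : a <= b -> (forall x, a <= x <= b -> rder f x (df x)) ->
  exists2 c, a <= c <= b & f b - f a = df c * (b - a).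
Proof.
move=> ab H; have [x xab||c] := @MVT_segment R f df a b ab.
- by apply/rder_is_derive; apply: H; move: xab; rewrite in_itv /= => /andP[/ltW-> /ltW->].
- apply: continuous_in_subspaceT => x /set_mem /=; rewrite in_itv /= => xab.
  apply/cvgrPdist_lt => e e0; have [d d0 dP] := rder_cont (H x xab) e0.
  apply/nbhs_ballP; exists d => // y; rewrite /ball /= distrC => yd.
  by rewrite distrC; apply: dP.
by rewrite in_itv /= => cab E; exists c.
Qed.

Lemma rFTC g : continuous g -> exists P, forall t, 0 <= t <= 1 -> rder P t (g t).
Proof.
move=> cg; exists (fun x => \int[lebesgue_measure]_(t in `[(-1 : R), x]) g t).
move=> t /andP[t0 t1]; apply/rder_is_derive.
have [||||D E] := @continuous_FTC1_closed R g (-1) t 2.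
- by lra.
- apply: continuous_compact_integrable; first exact: segment_compact.
  by apply: continuous_subspaceT.
- by lra.
- exact: cg.
by split; [exact: D | rewrite -derive1E; exact: E].
Qed.

End RealCalc.

Section Cder.
Variable R : realType.
Local Notation C := (Cplx R).
Local Notation re := (@complex.Re R).
Local Notation im := (@complex.Im R).
Implicit Types f g : C -> C.

Lemma cder_cst (c z : C) : cder (fun _ => c) z 0.
Proof. by apply/cder_is_derive; exact: is_derive_cst. Qed.

Lemma cder_id (z : C) : cder (fun w => w) z 1.
Proof. by apply/cder_is_derive; exact: is_derive_id. Qed.

Lemma cderD f g z l m : cder f z l -> cder g z m -> cder (fun w => f w + g w) z (l + m).
Proof. by move=> /cder_is_derive ? /cder_is_derive ?; apply/cder_is_derive; exact: is_deriveD. Qed.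

Lemma cderB f g z l m : cder f z l -> cder g z m -> cder (fun w => f w - g w) z (l - m).
Proof. by move=> /cder_is_derive ? /cder_is_derive ?; apply/cder_is_derive; exact: is_deriveB. Qed.

Lemma cderM f g z l m : cder f z l -> cder g z m ->
  cder (fun w => f w * g w) z (l * g z + f z * m).
Proof.
move=> /cder_is_derive ? /cder_is_derive ?; apply/cder_is_derive.
by rewrite [l * g z]mulrC [_ + f z * m]addrC; exact: is_deriveM.
Qed.

Lemma cder_unique f z l m : cder f z l -> cder f z m -> l = m.
Proof. by move=> /cder_is_derive [_ <-] /cder_is_derive [_ <-]. Qed.

Lemma cder_ccont f z l : cder f z l -> ccont_at f z.
Proof.
move=> /(_ 1 ltr01) [d d0 dP] e e0.
have l0 := md_ge0 l.
have k0 : 0 < e / (2 + md l) by rewrite divr_gt0 // ltr_wpDr.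
exists (Num.min d (e / (2 + md l))); first by rewrite lt_min d0.
move=> y; rewrite lt_min => /andP[yd ye].
have := dP (y - z) yd; rewrite (_ : z + (y - z) = y) ?mul1r => [h|]; last by ring.
have -> : f y - f z = (f y - f z - l * (y - z)) + l * (y - z) by ring.
apply: le_lt_trans (ler_mdD _ _) _; rewrite mdM.
move: ye; rewrite ltr_pdivlMr; last by lra.
have := md_ge0 (y - z); nra.
Qed.

Lemma cder_comp f g z l m : cder g z m -> cder f (g z) l ->
  cder (fun w => f (g w)) z (l * m).
Proof.
move=> Hg Hf e e0; have l0 := md_ge0 l; have m0 := md_ge0 m.
have e10 : 0 < e / 2 / (1 + md m) by rewrite !divr_gt0 // ltr_wpDr.
have [d1 d10 P1] := Hf _ e10.
have e20 : 0 < Num.min 1 (e / 2 / (1 + md l)).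
  by rewrite lt_min ltr01 !divr_gt0 // ltr_wpDr.
have [d2 d20 P2] := Hg _ e20.
have [d3 d30 P3] := cder_ccont Hg d10.
exists (Num.min d2 d3); first by rewrite lt_min d20.
move=> h; rewrite lt_min => /andP[h2 h3].
have := P2 h h2; set E := g (z + h) - g z - m * h => EP.
have := P3 (z + h); rewrite [z + h - z](_ : _ = h); last by ring.
move=> /(_ h3) h1; have := P1 _ h1.
rewrite (_ : g z + (g (z + h) - g z) = g (z + h)); last by ring.
set A := f _ - f _ - _ => AP.
have -> : f (g (z + h)) - f (g z) - l * m * h = A + l * E by rewrite /A /E; ring.
apply: le_trans (ler_mdD _ _) _; rewrite mdM.
have E1 : md E <= md h.
  by apply: le_trans EP _; rewrite ler_piMl ?md_ge0 // ge_min lexx.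
have E2 : (1 + md l) * md E <= e / 2 * md h.
  have : md E <= e / 2 / (1 + md l) * md h.
    by apply: le_trans EP _; rewrite ler_wpM2r ?md_ge0 // ge_min lexx orbT.
  by rewrite mulrAC ler_pdivlMr 1?mulrC // ltr_wpDr.
have D1 : md (g (z + h) - g z) <= (1 + md m) * md h.
  have -> : g (z + h) - g z = E + m * h by rewrite /E; ring.
  by apply: le_trans (ler_mdD _ _) _; rewrite mdM; lra.
have A1 : md A <= e / 2 * md h.
  apply: le_trans AP _; rewrite mulrAC ler_pdivrMr ?ltr_wpDr //.
  have e20' : 0 < e / 2 by lra.
  by move: D1; nra.
have := md_ge0 E; lra.
Qed.

Lemma cder_inv (z : C) : z != 0 -> cder (fun w => w^-1) z (- z ^- 2).
Proof.
move=> z0 e e0; have m0 : 0 < md z by rewrite md_gt0.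
exists (Num.min (md z / 2) (e * md z ^+ 3 / 2)).
  by rewrite lt_min !divr_gt0 // mulr_gt0 // exprn_gt0.
move=> h; rewrite lt_min => /andP[h1 h2].
have zh : md z / 2 <= md (z + h).
  by have := ler_mdD (z + h) (- h); rewrite mdN addrK; lra.
have zh0 : z + h != 0 by rewrite -md_gt0; apply: lt_le_trans zh; rewrite divr_gt0.
have -> : (z + h)^-1 - z^-1 - - z ^- 2 * h = h / (z ^+ 2 * (z + h)) * h.
  by field; rewrite zh0 z0.
rewrite mdM ler_wpM2r ?md_ge0 // mdM mdV mdM mdX ler_pdivrMr; last first.
  by rewrite mulr_gt0 ?exprn_gt0 // md_gt0.
have : 0 < e * md z ^+ 2 by rewrite mulr_gt0 // exprn_gt0.
move: h2; rewrite exprS; nra.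
Qed.

Lemma cder_ext f g z l : (forall w, f w = g w) -> cder f z l -> cder g z l.
Proof. by move=> /funext ->. Qed.

Lemma cder_near f g z l (d : R) : 0 < d -> (forall w, md (w - z) < d -> f w = g w) ->
  cder f z l -> cder g z l.
Proof.
move=> d0 fg H e e0; have [d1 d10 P] := H e e0.
exists (Num.min d d1); first by rewrite lt_min d0.
move=> h; rewrite lt_min => /andP[hd h1].
rewrite -!fg ?subrr ?md0 //; first exact: P.
by rewrite (_ : z + h - z = h) //; ring.
Qed.

Lemma cder_shift f a z l : cder f (z + a) l -> cder (fun w => f (w + a)) z l.
Proof.
move=> H e /H [d d0 P]; exists d => // h /P.
by rewrite (_ : z + h + a = z + a + h) //; ring.
Qed.

End Cder.

(** * Line integrals and the Cauchy-Goursat theorem *)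

Definition pder (R : realType) (P : R -> Cplx R) t (l : Cplx R) :=
  forall e : R, 0 < e -> exists2 d : R, 0 < d &
  forall h : R, `|h| < d -> md (P (t + h) - P t - cr h * l) <= e * `|h|.

Definition prim (R : realType) (g P : R -> Cplx R) :=
  forall t, 0 <= t <= 1 -> pder P t (g t).

(** The integral over [0, 1] as the increment of a primitive. [prim_ex] provides one for a
    continuous path and [pintE] shows that the choice is immaterial; without a primitive the value
    is 0. *)
HB.lock Definition pint (R : realType) (g : R -> Cplx R) : Cplx R :=
  let P := xget (fun _ => 0) [set P | prim g P] in P 1 - P 0.

HB.lock Definition lint (R : realType) (g : Cplx R -> Cplx R) (z v : Cplx R) : Cplx R :=
  pint (fun t => g (z + cr t * v) * v).

Section PathIntegral.
Variable R : realType.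
Local Notation C := (Cplx R).
Local Notation re := (@complex.Re R).
Local Notation im := (@complex.Im R).

Implicit Types g P Q : R -> C.
Implicit Types z v w l m : C.

Definition pcont (g : R -> C) := forall t : R, 0 <= t <= 1 -> forall e : R, 0 < e ->
  exists2 d : R, 0 < d & forall s, 0 <= s <= 1 -> `|s - t| < d -> md (g s - g t) < e.

Lemma pder_re P t l w : pder P t l -> rder (fun t => re (w * P t)) t (re (w * l)).
Proof.
move=> H e e0; have w0 := md_ge0 w.
have k0 : 0 < e / (1 + md w) by rewrite divr_gt0 // ltr_wpDr.
have [d d0 dP] := H _ k0; exists d => // h /dP {}dP.
have -> : re (w * P (t + h)) - re (w * P t) - re (w * l) * h =
    re (w * (P (t + h) - P t - cr h * l)) by rewrite !reimE /=; ring.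
apply: le_trans (ler_re_md _) _; rewrite mdM.
have : (1 + md w) * md (P (t + h) - P t - cr h * l) <= e * `|h|.
  have w1 : 0 < 1 + md w by lra.
  by move: dP; rewrite mulrAC ler_pdivlMr // mulrC.
have := md_ge0 (P (t + h) - P t - cr h * l); lra.
Qed.

Lemma prim_re_le g P w c : prim g P -> (forall t, 0 <= t <= 1 -> re (w * g t) <= c) ->
  re (w * (P 1 - P 0)) <= c.
Proof.
move=> H le; have [|t t01] := @rMVT R (fun t => re (w * P t)) (fun t => re (w * g t)) 0 1 ler01.
  by move=> t t01; apply: pder_re (H t t01).
rewrite subr0 mulr1 => E; have -> : re (w * (P 1 - P 0)) = re (w * P 1) - re (w * P 0).
  by rewrite !reimE; ring.
by rewrite E; apply: le.
Qed.

(** The mean value theorem fails for complex-valued [P]. It is applied to the real function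
    [re (cj D * P t)], where [D] is the increment; this gives [|D|^2 <= |D| M]. *)
Lemma prim_md_le g P (M : R) : prim g P -> (forall t, 0 <= t <= 1 -> md (g t) <= M) ->
  md (P 1 - P 0) <= M.
Proof.
move=> H le; set D := P 1 - P 0.
have M0 : 0 <= M by apply: le_trans (md_ge0 (g 0)) (le 0 _); rewrite lexx ler01.
have : re (cj D * D) <= md D * M.
  apply: (prim_re_le H) => t t01; apply: le_trans (ler_norm _) _.
  by apply: le_trans (ler_re_md _) _; rewrite mdM md_cj ler_wpM2l ?md_ge0 // le.
rewrite mulrC mulcj /= expr2; have := md_ge0 D; rewrite le_eqVlt => /predU1P[<-//|D0].
by rewrite ler_pM2l.
Qed.

Lemma pder_lin P Q t l m (c : C) : pder P t l -> pder Q t m ->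
  pder (fun t => P t + c * Q t) t (l + c * m).
Proof.
move=> HP HQ e e0; have c0 := md_ge0 c.
have e20 : 0 < e / 2 by lra.
have k0 : 0 < e / 2 / (1 + md c) by rewrite divr_gt0 // ltr_wpDr.
have [d1 d10 P1] := HP _ e20; have [d2 d20 P2] := HQ _ k0.
exists (Num.min d1 d2); first by rewrite lt_min d10.
move=> h; rewrite lt_min => /andP[/P1 h1 /P2 h2].
have -> : P (t + h) + c * Q (t + h) - (P t + c * Q t) - cr h * (l + c * m) =
  (P (t + h) - P t - cr h * l) + c * (Q (t + h) - Q t - cr h * m) by ring.
apply: le_trans (ler_mdD _ _) _; rewrite mdM.
have : (1 + md c) * md (Q (t + h) - Q t - cr h * m) <= e / 2 * `|h|.
  have c1 : 0 < 1 + md c by lra.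
  by move: h2; rewrite mulrAC ler_pdivlMr // mulrC.
have := md_ge0 (Q (t + h) - Q t - cr h * m); lra.
Qed.

Lemma prim_lin g1 g2 P1 P2 c : prim g1 P1 -> prim g2 P2 ->
  prim (fun t => g1 t + c * g2 t) (fun t => P1 t + c * P2 t).
Proof. by move=> H1 H2 t t01; apply: pder_lin; [apply: H1|apply: H2]. Qed.

Lemma pder_aff P (a k t : R) l : pder P (a + k * t) l ->
  pder (fun t => P (a + k * t)) t (cr k * l).
Proof.
move=> H e e0; have k0 := normr_ge0 k.
have k1 : 0 < e / (1 + `|k|) by rewrite divr_gt0 // ltr_wpDr.
have [d d0 dP] := H _ k1.
exists (d / (1 + `|k|)); first by rewrite divr_gt0 // ltr_wpDr.
move=> h; rewrite ltr_pdivlMr ?ltr_wpDr // => hd.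
have h0 := normr_ge0 h.
have : `|k * h| < d by rewrite normrM; nra.
move=> /dP; rewrite (_ : a + k * t + k * h = a + k * (t + h)); last by ring.
rewrite (_ : cr (k * h) * l = cr h * (cr k * l)); last by rewrite crM; ring.
move=> /le_trans; apply; rewrite normrM mulrAC ler_pdivrMr ?ltr_wpDr //.
have := mulr_ge0 (ltW e0) h0; nra.
Qed.

Lemma pder_cder G (z v l : C) (t : R) : cder G (z + cr t * v) l ->
  pder (fun t => G (z + cr t * v)) t (l * v).
Proof.
move=> H e e0; have v0 := md_ge0 v.
have k1 : 0 < e / (1 + md v) by rewrite divr_gt0 // ltr_wpDr.
have [d d0 dP] := H _ k1.
exists (d / (1 + md v)); first by rewrite divr_gt0 // ltr_wpDr.
move=> h; rewrite ltr_pdivlMr ?ltr_wpDr // => hd.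
have h0 := normr_ge0 h.
have : md (cr h * v) < d by rewrite mdM md_cr; nra.
move=> /dP; rewrite (_ : z + cr t * v + cr h * v = z + cr (t + h) * v); last first.
  by rewrite crD; ring.
rewrite (_ : l * (cr h * v) = cr h * (l * v)); last by ring.
move=> /le_trans; apply; rewrite mdM md_cr mulrAC ler_pdivrMr ?ltr_wpDr //.
have := mulr_ge0 (ltW e0) h0; nra.
Qed.

(** The retraction onto [0, 1]: it extends a path to a continuous function on the line, as [rFTC]
    requires. *)
Let clamp (t : R) : R := Num.max 0 (Num.min t 1).

Lemma clamp01 t : 0 <= clamp t <= 1.
Proof. by rewrite /clamp; case: (leP t 1) => ?; [case: (leP 0 t) => ?|case: (leP (0 : R) 1) => ?]; lra. Qed.

Lemma clamp_id t : 0 <= t <= 1 -> clamp t = t.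
Proof. by rewrite /clamp => ?; case: (leP t 1) => ?; [case: (leP 0 t) => ?|case: (leP (0 : R) 1) => ?]; lra. Qed.

Lemma clamp_dist s t : `|clamp s - clamp t| <= `|s - t|.
Proof.
rewrite /clamp ler_norml.
have h1 := ler_norm (s - t); have h2 := ler_norm (t - s).
rewrite (distrC t) in h2.
by case: (leP s 1) => ?; case: (leP t 1) => ?; case: (leP 0 s) => ?;
  case: (leP 0 t) => ?; case: (leP (0 : R) 1) => ?; apply/andP; split; lra.
Qed.

Lemma prim_ex g : pcont g -> exists P, prim g P.
Proof.
move=> cg.
have cont (u : C -> R) : (forall z w, `|u z - u w| <= md (z - w)) ->
    exists p : R -> R, forall t, 0 <= t <= 1 -> rder p t (u (g t)).
  move=> ul; have [|P HP] := @rFTC R (fun t => u (g (clamp t))).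
    move=> t; apply/cvgrPdist_lt => e e0.
    have [d d0 dP] := cg _ (clamp01 t) e e0.
    apply/nbhs_ballP; exists d => // s; rewrite /ball /= => sd.
    rewrite distrC; apply: le_lt_trans (ul _ _) _; apply: dP (clamp01 s) _.
    by apply: le_lt_trans (clamp_dist _ _) _; rewrite distrC.
  by exists P => t t01; rewrite -{2}(clamp_id t01); apply: HP.
have [|P1 H1] := cont re.
  by move=> z w; rewrite (_ : re z - re w = re (z - w)) ?ler_re_md // !reimE.
have [|P2 H2] := cont im.
  by move=> z w; rewrite (_ : im z - im w = im (z - w)) ?ler_im_md // !reimE.
exists (fun t => Complex (P1 t) (P2 t)) => t t01 e e0.
have e20 : 0 < e / 2 by lra.
have [d1 d10 D1] := H1 t t01 _ e20; have [d2 d20 D2] := H2 t t01 _ e20.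
exists (Num.min d1 d2); first by rewrite lt_min d10.
move=> h; rewrite lt_min => /andP[/D1 h1 /D2 h2].
apply: le_trans (md_le_reim _) _.
move: h1 h2; rewrite !reimE /= !mul0r subr0 addr0 (mulrC h) (mulrC h); lra.
Qed.

Lemma pintE g P : prim g P -> pint g = P 1 - P 0.
Proof.
move=> HP; rewrite pint.unlock; case: xgetP => [Q _ HQ|/(_ P)//].
(* The difference of two primitives has derivative 0, hence increment 0. *)
have := prim_md_le (prim_lin (-1) HQ HP) (M := 0).
rewrite (_ : _ - _ = (Q 1 - Q 0) - (P 1 - P 0)); last by ring.
move=> h; apply/eqP; rewrite -subr_eq0 -md_eq0 eq_le md_ge0 andbT; apply: h => t _.
by rewrite mulN1r subrr md0.
Qed.

End PathIntegral.

Section LineIntegral.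
Variable R : realType.
Local Notation C := (Cplx R).
Implicit Types f g G : C -> C.
Implicit Types z v w : C.

Definition scont (g : C -> C) z v := pcont (fun t => g (z + cr t * v)).

Lemma scontM g z v : scont g z v -> pcont (fun t => g (z + cr t * v) * v).
Proof.
move=> H t t01 e e0; have v0 := md_ge0 v.
have k1 : 0 < e / (1 + md v) by rewrite divr_gt0 // ltr_wpDr.
have [d d0 dP] := H t t01 _ k1; exists d => // s s01 /(dP _ s01).
rewrite -mulrBl mdM ltr_pdivlMr ?ltr_wpDr //.
by apply: le_lt_trans; rewrite mulrDr mulr1 lerDr md_ge0.
Qed.

Lemma scont_cc g z v : (forall t : R, 0 <= t <= 1 -> ccont_at g (z + cr t * v)) -> scont g z v.
Proof.
move=> H t t01 e e0; have v0 := md_ge0 v; have [d d0 dP] := H t t01 e e0.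
exists (d / (1 + md v)); first by rewrite divr_gt0 // ltr_wpDr.
move=> s _; rewrite ltr_pdivlMr ?ltr_wpDr // => sd; apply: dP.
rewrite (_ : _ - _ = cr (s - t) * v); last by rewrite crD crN; ring.
by rewrite mdM md_cr; have := normr_ge0 (s - t); nra.
Qed.

Lemma lint_lin g1 g2 z v c : scont g1 z v -> scont g2 z v ->
  lint (fun w => g1 w + c * g2 w) z v = lint g1 z v + c * lint g2 z v.
Proof.
move=> /scontM/prim_ex [P1 H1] /scontM/prim_ex [P2 H2].
rewrite lint.unlock (pintE H1) (pintE H2) (@pintE R _ (fun t => P1 t + c * P2 t)); first by ring.
move=> t t01; have := prim_lin c H1 H2 t01; by rewrite mulrA -mulrDl.
Qed.

(** A primitive of the path of [g] minus the path of [G] has derivative at most [e * md v]. This is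
    how an integral is compared with that of a function having a primitive. *)
Lemma lint_approx g G G' z v (e : R) : scont g z v ->
  (forall t : R, 0 <= t <= 1 -> cder G (z + cr t * v) (G' (z + cr t * v))) ->
  (forall t : R, 0 <= t <= 1 -> md (g (z + cr t * v) - G' (z + cr t * v)) <= e) ->
  md (lint g z v - (G (z + v) - G z)) <= e * md v.
Proof.
move=> /scontM/prim_ex [P HP] HG He; rewrite lint.unlock (pintE HP).
have HG' : prim (fun t => G' (z + cr t * v) * v) (fun t => G (z + cr t * v)).
  by move=> t t01; apply: pder_cder; apply: HG.
have := prim_md_le (prim_lin (-1) HP HG') (M := e * md v).
rewrite cr1 cr0 !mul1r !mul0r addr0 !mulN1r.
rewrite (_ : _ - _ = P 1 - P 0 - (G (z + v) - G z)); last by ring.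
apply => t t01; rewrite mulN1r -mulrBl mdM ler_wpM2r ?md_ge0 //; exact: He.
Qed.

(** Both parts have an affine reparametrisation of the same [P] as primitive, so the increments
    simply add up. *)
Lemma lint_split g z v (k : R) : 0 <= k <= 1 -> scont g z v ->
  lint g z v = lint g z (cr k * v) + lint g (z + cr k * v) (cr (1 - k) * v).
Proof.
move=> k01 /scontM/prim_ex [P HP]; rewrite lint.unlock (pintE HP).
rewrite (@pintE R _ (fun t => P (0 + k * t))); last first.
  move=> t t01; have := @pder_aff R P 0 k t _ (HP (0 + k * t) _).
  rewrite add0r crM [_ * (cr k * v)](_ : _ = cr k * (g (z + cr k * cr t * v) * v)).
    by apply; nra.
  by rewrite (_ : z + cr t * (cr k * v) = z + cr k * cr t * v); ring.
rewrite (@pintE R _ (fun t => P (k + (1 - k) * t))); last first.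
  move=> t t01; have := @pder_aff R P k (1 - k) t _ (HP (k + (1 - k) * t) _).
  rewrite (_ : z + cr k * v + cr t * (cr (1 - k) * v) = z + cr (k + (1 - k) * t) * v).
    by rewrite (_ : _ * (cr (1 - k) * v) = cr (1 - k) * (g (z + cr (k + (1 - k) * t) * v) * v)) ;
      [apply; nra | ring].
  by rewrite [cr (k + _)]crD crM; ring.
rewrite !mulr0 !mulr1 !addr0 add0r (_ : k + (1 - k) = 1); last by ring.
by ring.
Qed.

End LineIntegral.

(** * Nested subdivision of a square *)

Section Bisect.
Variable R : realType.

Lemma nested_intervals (a l : nat -> R) : (forall n, 0 <= l n) ->
  (forall n, a n <= a n.+1) -> (forall n, a n.+1 + l n.+1 <= a n + l n) ->
  exists x, forall n, a n <= x <= a n + l n.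
Proof.
move=> l0 up down.
have mono m n : (m <= n)%N -> a m <= a n /\ a n + l n <= a m + l m.
  elim: n => [|n IH]; first by rewrite leqn0 => /eqP ->.
  rewrite leq_eqVlt => /predU1P[->//|]; rewrite ltnS => /IH [h1 h2].
  by split; [apply: le_trans h1 _ | apply: le_trans (down n) _].
have bnd m n : a m <= a n + l n.
  case: (leqP m n) => h; first by have [h1 _] := mono _ _ h; have := l0 n; lra.
  by have [_ h2] := mono _ _ (ltnW h); have := l0 m; lra.
have ne : range a !=set0 by exists (a 0%N), 0%N.
exists (sup (range a)) => n; apply/andP; split.
  apply: ub_le_sup; last by exists n.
  by exists (a 0%N + l 0%N) => _ [m _ <-].
by apply: ge_sup => // _ [m _ <-].
Qed.

Lemma halves_lt (d : R) : 0 < d -> exists n, 2^-1 ^+ n < d.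
Proof.
move=> d0; exists (Num.bound d^-1).
have h n : n.+1%:R * 2^-1 ^+ n <= 1 :> R.
  elim: n => [|n IH]; first by rewrite expr0 mulr1.
  rewrite exprSr mulrA ler_pdivrMr // mul1r; apply: le_trans (lerD IH IH).
  by rewrite -mulrDl ler_wpM2r ?exprn_ge0 // -natrD ler_nat addSn ltnS addnS leq_addr.
have := h (Num.bound d^-1); set n := Num.bound _ => hn.
have hb : d^-1 < n%:R by apply: archi_boundP; rewrite invr_ge0 ltW.
have n0 : 0 < n%:R :> R by apply: le_lt_trans hb; rewrite invr_ge0 ltW.
have : 1 < n%:R * d by rewrite -ltr_pdivrMr // mul1r.
have p0 : 0 < 2^-1 ^+ n :> R by rewrite exprn_gt0.
by move: hn; rewrite -natr1; nra.
Qed.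

(** Iterating the step gives squares of side [2^-n]; their corners define nested intervals in either
    coordinate, with common points [s0] and [t0]. *)
Lemma bisect (bad : R -> R -> R -> Prop) : bad 0 0 1 ->
  (forall s t l, 0 < l -> bad s t l -> exists s' t',
     [/\ bad s' t' (l / 2), s <= s', s' + l / 2 <= s + l &
         t <= t' /\ t' + l / 2 <= t + l]) ->
  exists s0 t0, forall d, 0 < d -> exists s t l,
    [/\ bad s t l, 0 < l < d, s <= s0 <= s + l & t <= t0 <= t + l].
Proof.
move=> b0 step.
pose st (p : R * R * R) (q : R * R) := 0 < p.2 -> bad p.1.1 p.1.2 p.2 ->
  [/\ bad q.1 q.2 (p.2 / 2), p.1.1 <= q.1, q.1 + p.2 / 2 <= p.1.1 + p.2 &
      p.1.2 <= q.2 /\ q.2 + p.2 / 2 <= p.1.2 + p.2].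
have /choice [F HF] : forall p, exists q, st p q.
  move=> [[s t] l]; have [[l0 bd]|h] := pselect (0 < l /\ bad s t l).
    by have [s' [t' H]] := step s t l l0 bd; exists (s', t').
  by exists (0, 0) => l0 bd; case: h.
pose x := fix x n : R * R :=
  if n is m.+1 then F (x m, 2^-1 ^+ m) else (0, 0).
have l0 n : 0 < 2^-1 ^+ n :> R by rewrite exprn_gt0.
have bx n : bad (x n).1 (x n).2 (2^-1 ^+ n).
  elim: n => [|n IH] //=; have [/= H _ _ _] := HF (x n, 2^-1 ^+ n) (l0 n) IH.
  by rewrite exprSr.
have S n := HF (x n, 2^-1 ^+ n) (l0 n) (bx n).
have [|||s0 H1] := @nested_intervals (fun n => (x n).1) (fun n => 2^-1 ^+ n).
- by move=> n; apply: ltW.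
- by move=> n /=; have [] := S n.
- by move=> n /=; rewrite exprSr; have [] := S n.
have [|||t0 H2] := @nested_intervals (fun n => (x n).2) (fun n => 2^-1 ^+ n).
- by move=> n; apply: ltW.
- by move=> n /=; have [_ _ _ []] := S n.
- by move=> n /=; rewrite exprSr; have [_ _ _ []] := S n.
exists s0, t0 => d d0; have [n nd] := halves_lt d0.
by exists (x n).1, (x n).2, (2^-1 ^+ n); split; rewrite // l0.
Qed.

End Bisect.

(** * Goursat's theorem for parallelograms *)

HB.lock Definition pgram_int (R : realType) (g : Cplx R -> Cplx R) (z u v : Cplx R) : Cplx R :=
  lint g z u + lint g (z + u) v - lint g (z + v) u - lint g z v.

(** In the frame [(z; u, v)], the parallelogram with corner [(s, t)] and sides [l], [m]: the
    subdivision takes place among real parameters. *)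
HB.lock Definition sub_pgram_int (R : realType) (g : Cplx R -> Cplx R) (z u v : Cplx R)
    (s t l m : R) : Cplx R :=
  pgram_int g (z + cr s * u + cr t * v) (cr l * u) (cr m * v).

Section Goursat.
Variable R : realType.
Local Notation C := (Cplx R).
Local Notation re := (@complex.Re R).
Local Notation im := (@complex.Im R).
Implicit Types (g : C -> C) (z u v : C).

Definition pgram_cont g z u v :=
  [/\ scont g z u, scont g (z + u) v, scont g (z + v) u & scont g z v].

Lemma pgram_int_swap g z u v : pgram_int g z u v = - pgram_int g z v u.
Proof.
have alg (a b c d : C) : a + b - c - d = - (d + c - b - a) by ring.
rewrite pgram_int.unlock; exact: alg.
Qed.

Lemma pgram_int_lin g1 g2 z u v c : pgram_cont g1 z u v -> pgram_cont g2 z u v ->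
  pgram_int (fun w => g1 w + c * g2 w) z u v = pgram_int g1 z u v + c * pgram_int g2 z u v.
Proof.
have alg (a1 a2 b1 b2 c1 c2 d1 d2 : C) :
  a1 + c * a2 + (b1 + c * b2) - (c1 + c * c2) - (d1 + c * d2) =
  a1 + b1 - c1 - d1 + c * (a2 + b2 - c2 - d2) by ring.
by move=> [????] [????]; rewrite pgram_int.unlock !lint_lin //; exact: alg.
Qed.

Definition edges z u v (w : C) := exists2 t : R, 0 <= t <= 1 &
  [\/ w = z + cr t * u, w = z + u + cr t * v, w = z + v + cr t * u | w = z + cr t * v].

Lemma pgram_cont_edges g z u v : (forall w, edges z u v w -> ccont_at g w) -> pgram_cont g z u v.
Proof.
by move=> H; split; apply: scont_cc => t t01; apply: H; exists t => //;
  [apply: Or41 | apply: Or42 | apply: Or43 | apply: Or44].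
Qed.

Lemma md4 (a b c d : C) : md (a + b - c - d) <= md a + md b + md c + md d.
Proof.
apply: le_trans (ler_mdD _ _) _; rewrite mdN lerD2r.
apply: le_trans (ler_mdD _ _) _; rewrite mdN lerD2r; exact: ler_mdD.
Qed.

Lemma pgram_int_approx g G G' z u v (e : R) : pgram_cont g z u v ->
  (forall w, cder G w (G' w)) ->
  (forall w, edges z u v w -> md (g w - G' w) <= e) ->
  md (pgram_int g z u v) <= e * (2 * (md u + md v)).
Proof.
move=> [c1 c2 c3 c4] HG He.
have h1 := @lint_approx R g G G' z u e c1 (fun t _ => HG _)
  (fun t t01 => He _ (ex_intro2 _ _ t t01 (Or41 _ _ _ erefl))).
have h2 := @lint_approx R g G G' (z + u) v e c2 (fun t _ => HG _)
  (fun t t01 => He _ (ex_intro2 _ _ t t01 (Or42 _ _ _ erefl))).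
have h3 := @lint_approx R g G G' (z + v) u e c3 (fun t _ => HG _)
  (fun t t01 => He _ (ex_intro2 _ _ t t01 (Or43 _ _ _ erefl))).
have h4 := @lint_approx R g G G' z v e c4 (fun t _ => HG _)
  (fun t t01 => He _ (ex_intro2 _ _ t t01 (Or44 _ _ _ erefl))).
have alg (a b c d x y w p : C) : a + b - c - d = (a - (x - y)) + (b - (w - x))
    - (c - (w - p)) - (d - (p - y)) by ring.
have -> : pgram_int g z u v =
   (lint g z u - (G (z + u) - G z)) + (lint g (z + u) v - (G (z + u + v) - G (z + u)))
   - (lint g (z + v) u - (G (z + v + u) - G (z + v))) - (lint g z v - (G (z + v) - G z)).
  by rewrite pgram_int.unlock [z + v + u]addrAC; exact: alg.
by apply: le_trans (md4 _ _ _ _) _; lra.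
Qed.

Lemma pgram_int_le g z u v (M : R) : pgram_cont g z u v ->
  (forall w, edges z u v w -> md (g w) <= M) -> md (pgram_int g z u v) <= M * (2 * (md u + md v)).
Proof.
move=> cg H; apply: (@pgram_int_approx g (fun _ => 0) (fun _ => 0)) => // w.
  exact: cder_cst.
by rewrite subr0; apply: H.
Qed.

Lemma lint_add g p u (k l : R) : 0 < k -> 0 < l -> scont g p (cr (k + l) * u) ->
  lint g p (cr (k + l) * u) = lint g p (cr k * u) + lint g (p + cr k * u) (cr l * u).
Proof.
move=> k0 l0 c; have kl : k + l != 0 by lra.
have kl0 : 0 < k + l by lra.
rewrite (@lint_split R g p _ (k / (k + l))) //; last first.
  by apply/andP; split; [apply: divr_ge0; lra | rewrite ler_pdivrMr // mul1r; lra].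
have -> : cr (k / (k + l)) * (cr (k + l) * u) = cr k * u.
  by rewrite mulrA -crM divfK.
rewrite (_ : cr (1 - _) * _ = cr l * u) // mulrA -crM; congr (cr _ * _).
by field.
Qed.

(** The common side, [m] in [alg], is run through once in either direction and cancels. *)
Lemma pgram_int_addu g z u v (k l : R) : 0 < k -> 0 < l ->
  scont g z (cr (k + l) * u) -> scont g (z + v) (cr (k + l) * u) ->
  pgram_int g z (cr (k + l) * u) v = pgram_int g z (cr k * u) v + pgram_int g (z + cr k * u) (cr l * u) v.
Proof.
have alg (a1 a2 b e1 e2 d m : C) :
  a1 + a2 + b - (e1 + e2) - d = (a1 + m - e1 - d) + (a2 + b - e2 - m) by ring.
move=> k0 l0 c1 c2; rewrite pgram_int.unlock !lint_add // crD.
have -> : z + (cr k + cr l) * u = z + cr k * u + cr l * u by ring.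
rewrite [z + v + _]addrAC; exact: alg.
Qed.

Definition pgram z u v (w : C) := exists s t : R,
  [/\ 0 <= s <= 1, 0 <= t <= 1 & w = z + cr s * u + cr t * v].

Lemma sub_pgram_int_addu g z u v (s t k l m : R) : 0 < k -> 0 < l ->
  (forall b, s <= b <= s + k + l -> ccont_at g (z + cr b * u + cr t * v) /\
     ccont_at g (z + cr b * u + cr (t + m) * v)) ->
  sub_pgram_int g z u v s t (k + l) m = sub_pgram_int g z u v s t k m + sub_pgram_int g z u v (s + k) t l m.
Proof.
move=> k0 l0 H; rewrite sub_pgram_int.unlock.
have -> : z + cr (s + k) * u + cr t * v = z + cr s * u + cr t * v + cr k * u.
  by rewrite crD; ring.
rewrite pgram_int_addu //.
- apply: scont_cc => x x01; have [|h _] := H (s + x * (k + l)); first by nra.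
  rewrite (_ : _ + cr x * _ = z + cr (s + x * (k + l)) * u + cr t * v) //.
  by rewrite [cr (s + _)]crD crM; ring.
- apply: scont_cc => x x01; have [|_ h] := H (s + x * (k + l)); first by nra.
  rewrite (_ : _ + cr x * _ = z + cr (s + x * (k + l)) * u + cr (t + m) * v) //.
  by rewrite [cr (s + _)]crD crM [cr (t + _)]crD; ring.
Qed.

Lemma sub_pgram_int_swap g z u v (s t l m : R) : sub_pgram_int g z u v s t l m = - sub_pgram_int g z v u t s m l.
Proof. by rewrite sub_pgram_int.unlock pgram_int_swap [z + _ + _]addrAC. Qed.

(** Exchanging [u] and [v] reverses the orientation and reduces this to [sub_pgram_int_addu]. *)
Lemma sub_pgram_int_addv g z u v (s t k l m : R) : 0 < k -> 0 < l ->
  (forall b, t <= b <= t + k + l -> ccont_at g (z + cr s * u + cr b * v) /\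
     ccont_at g (z + cr (s + m) * u + cr b * v)) ->
  sub_pgram_int g z u v s t m (k + l) = sub_pgram_int g z u v s t m k + sub_pgram_int g z u v s (t + k) m l.
Proof.
move=> k0 l0 H; rewrite sub_pgram_int_swap sub_pgram_int_addu //.
  by rewrite opprD -!sub_pgram_int_swap.
by move=> b /H [h1 h2]; rewrite ![z + cr b * v + _]addrAC.
Qed.

Lemma sub_pgram_int_quarter g z u v (s t h : R) : (forall w, pgram z u v w -> ccont_at g w) ->
  0 <= s -> 0 <= t -> 0 < h -> s + h + h <= 1 -> t + h + h <= 1 ->
  sub_pgram_int g z u v s t (h + h) (h + h) =
    sub_pgram_int g z u v s t h h + sub_pgram_int g z u v s (t + h) h h
     + (sub_pgram_int g z u v (s + h) t h h + sub_pgram_int g z u v (s + h) (t + h) h h).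
Proof.
move=> H s0 t0 h0 sh th.
rewrite sub_pgram_int_addu // ?sub_pgram_int_addv //.
all: by move=> b ?; split; (apply: H; eexists; eexists; split; [ | | reflexivity]; lra).
Qed.

Lemma pgram_edges g z u v (s t l m : R) :
  0 <= s -> 0 <= l -> s + l <= 1 -> 0 <= t -> 0 <= m -> t + m <= 1 -> forall w,
  edges (z + cr s * u + cr t * v) (cr l * u) (cr m * v) w ->
  exists a b : R, [/\ s <= a <= s + l, t <= b <= t + m & w = z + cr a * u + cr b * v].
Proof.
move=> s0 l0 sl t0 m0 tm w [k k01 [] ->].
- by exists (s + k * l), t; split; rewrite ?crD ?crM; [nra|nra|ring].
- by exists (s + l), (t + k * m); split; rewrite ?crD ?crM; [nra|nra|ring].
- by exists (s + k * l), (t + m); split; rewrite ?crD ?crM; [nra|nra|ring].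
- by exists s, (t + k * m); split; rewrite ?crD ?crM; [nra|nra|ring].
Qed.

(** A nonzero integral [q] would persist as at least [l^2 q] on arbitrarily small parallelograms
    near a point [p]. There [g] is affine up to [e |w - p|], and an affine map integrates to 0, so
    that the integral is at most [2 e K^2 l^2]. *)
Theorem goursat g z u v : (forall w, pgram z u v w -> exists l, cder g w l) -> pgram_int g z u v = 0.
Proof.
move=> H; have cg w : pgram z u v w -> ccont_at g w by move=> /H [l /cder_ccont].
apply/eqP; rewrite -md_eq0; apply/negPn/negP => q0.
set q := md (pgram_int g z u v) in q0; have {}q0 : 0 < q by rewrite lt_def q0 md_ge0.
pose bad s t l := [/\ 0 <= s, 0 <= t, s + l <= 1, t + l <= 1 &
  l ^+ 2 * q <= md (sub_pgram_int g z u v s t l l)].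
have [||s0 [t0 HB]] := @bisect R bad.
- split; rewrite ?add0r // expr1n mul1r sub_pgram_int.unlock /q cr0 cr1 !mul0r !addr0 !mul1r //.
- move=> s t l l0 [s0 t0 sl tl bd]; have h0 : 0 < l / 2 by lra.
  have [h hE] : exists h, l / 2 = h by exists (l / 2).
  rewrite hE in h0 *; have lE : l = h + h by rewrite -hE; field.
  have E : sub_pgram_int g z u v s t l l = sub_pgram_int g z u v s t h h + sub_pgram_int g z u v s (t + h) h h
     + sub_pgram_int g z u v (s + h) t h h + sub_pgram_int g z u v (s + h) (t + h) h h.
    have sh1 : s + h + h <= 1 by lra.
    have th1 : t + h + h <= 1 by lra.
    by rewrite lE sub_pgram_int_quarter // addrA.
  have : l ^+ 2 * q <= md (sub_pgram_int g z u v s t h h) + md (sub_pgram_int g z u v s (t + h) h h)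
     + md (sub_pgram_int g z u v (s + h) t h h) + md (sub_pgram_int g z u v (s + h) (t + h) h h).
    apply: le_trans bd _; rewrite E; apply: le_trans (ler_mdD _ _) _; rewrite lerD2r.
    by apply: le_trans (ler_mdD _ _) _; rewrite lerD2r; exact: ler_mdD.
  rewrite (_ : l ^+ 2 * q = 4 * (h ^+ 2 * q)); last by rewrite lE; ring.
  clear E bd => lex.
  have fin s' t' : s <= s' -> s' + h <= s + l -> t <= t' -> t' + h <= t + l ->
      h ^+ 2 * q <= md (sub_pgram_int g z u v s' t' h h) -> exists s' t', [/\ bad s' t' h,
      s <= s', s' + h <= s + l & t <= t' /\ t' + h <= t + l].
    move=> h1 h2 h3 h4 h5; exists s', t'; split=> //; split=> //; clear h5 lex; lra.
  have ss : s + h <= s + l by lra.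
  have tt : t + h <= t + l by lra.
  have sh : s <= s + h by lra.
  have th : t <= t + h by lra.
  have shh : s + h + h <= s + l by lra.
  have thh : t + h + h <= t + l by lra.
  have [k|h1] := lerP (h ^+ 2 * q) (md (sub_pgram_int g z u v s t h h));
    first exact: fin s t (lexx _) ss (lexx _) tt k.
  have [k|h2] := lerP (h ^+ 2 * q) (md (sub_pgram_int g z u v s (t + h) h h));
    first exact: fin s (t + h) (lexx _) ss th thh k.
  have [k|h3] := lerP (h ^+ 2 * q) (md (sub_pgram_int g z u v (s + h) t h h));
    first exact: fin (s + h) t sh shh (lexx _) tt k.
  have [k|h4] := lerP (h ^+ 2 * q) (md (sub_pgram_int g z u v (s + h) (t + h) h h));
    first exact: fin (s + h) (t + h) sh shh th thh k.
  by exfalso; clear -h1 h2 h3 h4 lex; lra.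
have s01 : 0 <= s0 <= 1 /\ 0 <= t0 <= 1.
  have [s [t [l [[? ? ? ? _] /andP[? ?] /andP[? ?] /andP[? ?]]]]] := HB 1 ltr01.
  by split; apply/andP; split; lra.
set p := z + cr s0 * u + cr t0 * v.
have [m Hm] : exists m, cder g p m by apply: H; exists s0, t0; case: s01.
set K := md u + md v; have K0 : 0 <= K by rewrite addr_ge0 // md_ge0.
(* Chosen so that [2 e K^2 <= q / 2 < q]; the summand 1 covers the case [K = 0]. *)
have e0 : 0 < q / (2 * K ^+ 2 + 1) / 2.
  by rewrite !divr_gt0 // ltr_wpDl // mulr_ge0 // sqr_ge0.
have [d d0 dP] := Hm _ e0; set e := q / _ / 2 in e0 dP.
have d10 : 0 < d / (1 + K) by rewrite divr_gt0 // ltr_wpDr.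
have [s [t [l [[? ? ? ? bd] /andP[l0 ld] /andP[? ?] /andP[? ?]]]]] := HB _ d10.
(* A primitive of the tangent map [G'] of [g] at [p]. *)
pose G w := (g p - m * p) * w + m / 2 * (w * w).
pose G' w := g p + m * (w - p).
have HG w : cder G w (G' w).
  have := cderD (cderM (cder_cst (g p - m * p) w) (cder_id w))
    (cderM (cder_cst (m / 2) w) (cderM (cder_id w) (cder_id w))).
  suff -> : G' w = 0 * w + ((g p - m * p) * 1) + (0 * (w * w) + m / 2 * (1 * w + w * 1)) by [].
  by rewrite /G'; field.
have ldK : l * (1 + K) < d by rewrite -ltr_pdivlMr // ltr_wpDr.
have near w : edges (z + cr s * u + cr t * v) (cr l * u) (cr l * v) w ->
    pgram z u v w /\ md (w - p) <= l * K.
  have l0' := ltW l0; move=> ed.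
  have [a [b [/andP[? ?] /andP[? ?] ->]]] : exists a b : R,
      [/\ s <= a <= s + l, t <= b <= t + l & w = z + cr a * u + cr b * v].
    by apply: pgram_edges ed.
  split; first by exists a, b; split => //; apply/andP; split; lra.
  rewrite (_ : _ - p = cr (a - s0) * u + cr (b - t0) * v); last first.
    by rewrite !crD !crN /p; ring.
  apply: le_trans (ler_mdD _ _) _; rewrite !mdM !md_cr mulrDr.
  have ha : `|a - s0| <= l by rewrite ler_norml; apply/andP; split; lra.
  have hb : `|b - t0| <= l by rewrite ler_norml; apply/andP; split; lra.
  by apply: lerD; rewrite ler_wpM2r // md_ge0.
have : md (sub_pgram_int g z u v s t l l) <= e * (l * K) * (2 * (md (cr l * u) + md (cr l * v))).
  rewrite sub_pgram_int.unlock; apply: (pgram_int_approx _ HG).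
    by apply: pgram_cont_edges => w /near [/cg].
  move=> w /near [_ wp]; have wd : md (w - p) < d by apply: le_lt_trans wp _; lra.
  have := dP _ wd; rewrite (_ : p + (w - p) = w); last by ring.
  rewrite (_ : _ - _ - _ = g w - G' w); last by rewrite /G'; ring.
  by move=> /le_trans; apply; rewrite ler_wpM2l // ltW.
rewrite !mdM !md_cr gtr0_norm // -mulrDr -/K => h.
have : l ^+ 2 * q <= l ^+ 2 * (e * (2 * K ^+ 2)).
  by apply: le_trans bd _; apply: le_trans h _; rewrite le_eqVlt; apply/orP; left; apply/eqP; ring.
rewrite ler_pM2l ?exprn_gt0 //.
have K1 : 0 < 2 * K ^+ 2 + 1 by have := sqr_ge0 K; lra.
have : e * (2 * K ^+ 2 + 1) = q / 2 by rewrite /e; field; rewrite gt_eqF.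
lra.
Qed.

End Goursat.

(** * Cauchy integrals over a square, and the derivative of an entire function *)

Section Cauchy.
Variable R : realType.
Local Notation C := (Cplx R).
Local Notation re := (@complex.Re R).
Local Notation im := (@complex.Im R).
Implicit Types f g phi : C -> C.
Implicit Types a b w z : C.

Lemma lint_re_le g z v m (c : R) : scont g z v ->
  (forall t : R, 0 <= t <= 1 -> re (m * (g (z + cr t * v) * v)) <= c) ->
  re (m * lint g z v) <= c.
Proof.
by move=> /scontM/prim_ex [P HP] H; rewrite lint.unlock (pintE HP); apply: prim_re_le HP H.
Qed.

Lemma cmul_cont f g a : ccont_at f a -> ccont_at g a -> ccont_at (fun w => f w * g w) a.
Proof.
move=> cf cg e e0; have f0 := md_ge0 (f a); have g0 := md_ge0 (g a).
have e1 : 0 < Num.min 1 (e / 2 / (1 + md (g a))).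
  by rewrite lt_min ltr01 !divr_gt0 // ltr_wpDr.
have e2 : 0 < e / 2 / (2 + md (f a)) by rewrite !divr_gt0 // ltr_wpDr.
have [d1 d10 D1] := cf _ e1; have [d2 d20 D2] := cg _ e2.
exists (Num.min d1 d2); first by rewrite lt_min d10.
move=> w; rewrite lt_min => /andP[/D1 h1 /D2 h2].
have -> : f w * g w - f a * g a = (f w - f a) * (g w - g a) +
   ((f w - f a) * g a + f a * (g w - g a)) by ring.
apply: le_lt_trans (ler_mdD _ _) _.
have := ler_mdD ((f w - f a) * g a) (f a * (g w - g a)); rewrite !mdM.
move: h1 h2; rewrite lt_min ltr_pdivlMr ?ltr_wpDr // => /andP[h1 h1'].
rewrite ltr_pdivlMr ?ltr_wpDr //.
have := md_ge0 (f w - f a); have := md_ge0 (g w - g a); nra.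
Qed.

Lemma ccont_cst (c : C) a : ccont_at (fun _ => c) a.
Proof. exact: cder_ccont (cder_cst c a). Qed.

Lemma cinv_cont a w : w != a -> ccont_at (fun w => (w - a)^-1) w.
Proof.
move=> wa; have wa0 : w - a != 0 by rewrite subr_eq0.
exact: cder_ccont (cder_comp (cderB (cder_id w) (cder_cst a w)) (cder_inv wa0)).
Qed.

Lemma cexp_cont f a n : ccont_at f a -> ccont_at (fun w => f w ^+ n) a.
Proof.
move=> cf; elim: n => [|n IH].
  by rewrite (_ : (fun w => _) = fun _ => 1); [exact: ccont_cst|apply/funext => w; rewrite expr0].
rewrite (_ : (fun w => _) = fun w => f w * f w ^+ n); first exact: cmul_cont.
by apply/funext => w; rewrite exprS.
Qed.

Lemma md_nat n : md (n%:R : C) = n%:R.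
Proof.
have -> : n%:R = cr n%:R :> C; last by rewrite md_cr ger0_norm.
by elim: n => // n IH; rewrite -!natr1 crD -IH.
Qed.

(** The square with vertices at plus or minus 1 plus or minus i takes the place of a circle: its
    sides are segments, so [lint] suffices. *)
Definition sq_corner : C := Complex (-1) (-1).
Definition sq_right : C := Complex 2 0.
Definition sq_up : C := Complex 0 2.
Local Notation z0 := sq_corner.
Local Notation u := sq_right.
Local Notation v := sq_up.
Local Notation bd := (edges z0 u v).

Lemma pt_square (s t : R) : z0 + cr s * u + cr t * v = Complex (-1 + s * 2) (-1 + t * 2).
Proof. by apply: cplx_eq; rewrite !reimE /=; ring. Qed.

Lemma bd_square w : bd w -> 1 <= md w <= 2.
Proof.
move=> [t t01 H]; apply/andP; split.
- suff : 1 <= `|re w| \/ 1 <= `|im w|.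
    by case=> /le_trans; apply; [exact: ler_re_md|exact: ler_im_md].
  case: H => ->; [right|left|right|left]; rewrite !reimE /=.
  + by rewrite [X in `|X|](_ : _ = -1) ?normrN ?normr1 //; ring.
  + by rewrite [X in `|X|](_ : _ = 1) ?normr1 //; ring.
  + by rewrite [X in `|X|](_ : _ = 1) ?normr1 //; ring.
  + by rewrite [X in `|X|](_ : _ = -1) ?normrN ?normr1 //; ring.
- apply: le_trans (md_le_reim _) _.
  suff : `|re w| <= 1 /\ `|im w| <= 1 by move=> [? ?]; lra.
  rewrite !ler_norml; case: H => ->; rewrite !reimE /=;
   split; apply/andP; split; lra.
Qed.

Lemma bd_dist a w : md a < 1 / 2 -> bd w -> 1 / 2 <= md (w - a) <= 3.
Proof.
move=> a1 /bd_square /andP[w1 w2]; have := ler_mdB w a; have := ler_mdD w (- a).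
by rewrite mdN => ? ?; apply/andP; split; lra.
Qed.

Lemma bd_neq a w : md a < 1 / 2 -> bd w -> w != a.
Proof.
move=> a1 /(bd_dist a1) /andP[h _]; rewrite -subr_eq0 -md_gt0; lra.
Qed.

Definition cauchy_int phi k a := pgram_int (fun w => phi w * (w - a)^-1 ^+ k) z0 u v.

Lemma pgram_cont_cauchy phi k a : (forall w, ccont_at phi w) -> md a < 1 / 2 ->
  pgram_cont (fun w => phi w * (w - a)^-1 ^+ k) z0 u v.
Proof.
move=> cphi a1; apply: pgram_cont_edges => w /(bd_neq a1) wa.
by apply: cmul_cont => //; apply: cexp_cont; apply: cinv_cont.
Qed.

Lemma md_u : md u = 2. Proof. by rewrite (_ : u = cr 2) // md_cr ger0_norm. Qed.

Lemma md_v : md v = 2.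
Proof.
rewrite (_ : v = Complex 0 1 * cr 2); last by apply: cplx_eq; rewrite !reimE /=; ring.
by rewrite mdM md_cr ger0_norm // md.unlock /= expr0n expr1n /= add0r sqrtr1 mul1r.
Qed.

(** Differentiation under the integral sign: the kernel satisfies a second order Taylor bound that
    is uniform on the square, because its boundary stays at distance at least 1/2 from [a] and from
    [a + h]. *)
Lemma cauchy_int_cder phi k a : (forall w, ccont_at phi w) -> (0 < k <= 2)%N -> md a < 1 / 2 ->
  cder (cauchy_int phi k) a (k%:R * cauchy_int phi k.+1 a).
Proof.
move=> cphi k12 a1.
have [M HM] : exists M, forall w, bd w -> md (phi w) <= M.
  have [||c _ Hc] := @compact_max R _ (fun w => md (phi w)) _ (@compact_cball R 0 2).
  - by exists 0 => /=; rewrite subrr md0; lra.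
  - move=> w _ e e0; have [d d0 D] := cphi w e e0; exists d => // w' _ /D.
    by apply: le_lt_trans; exact: md_dist.
  - by exists (md (phi c)) => w /bd_square /andP[_ w2]; apply: Hc; rewrite /= subr0.
have M0 : 0 <= M.
  apply: le_trans (md_ge0 _) (HM z0 _); exists 0; first by rewrite lexx ler01.
  by apply: Or41; rewrite cr0 mul0r addr0.
have [K [K0 est]] : exists K : R, 0 <= K /\ forall x h : C,
    1 / 2 <= md x <= 3 -> 1 / 2 <= md (x - h) -> md h < 1 / 2 ->
    md ((x - h)^-1 ^+ k - x^-1 ^+ k - k%:R * h * x^-1 ^+ k.+1) <= K * md h ^+ 2.
  (* The case [k = 2] dictates 320 = 10 * 4 * 8, from bounds for [3x - 2h], [(x - h)^-2] and [x^-3];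
     for [k = 1] the bound would be 8. *)
  exists 320; split=> [|x h]; first exact: ler0n.
  move=> /andP[x1 x2] xh h1.
  have x0 : x != 0 by rewrite -md_gt0; lra.
  have xh0 : x - h != 0 by rewrite -md_gt0; lra.
  have i1 : md x^-1 <= 2.
    by rewrite mdV -[2]invrK lef_pV2 ?posrE; lra.
  have i2 : md (x - h)^-1 <= 2.
    by rewrite mdV -[2]invrK lef_pV2 ?posrE; lra.
  have j1 := md_ge0 x^-1; have j2 := md_ge0 (x - h)^-1.
  case: k k12 => [//|[|[|//]]] _.
  - rewrite (_ : _ - _ = h ^+ 2 * ((x - h)^-1 * x^-1 ^+ 2)); last first.
      by rewrite !expr1 expr2; field; rewrite x0 xh0.
    rewrite mdM mdX mdM mdX mulrC ler_wpM2r ?sqr_ge0 //.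
    have : md x^-1 ^+ 2 <= 4 by nra.
    have := sqr_ge0 (md x^-1); nra.
  - rewrite (_ : _ - _ = h ^+ 2 * ((3 * x - 2 * h) * ((x - h)^-1 ^+ 2 * x^-1 ^+ 3))); last first.
      by field; rewrite x0 xh0.
    rewrite mdM mdX mulrC ler_wpM2r ?sqr_ge0 // mdM [md (_ * _^-1 ^+ 3)]mdM !mdX.
    have n1 : md (3 * x - 2 * h) <= 10.
      apply: le_trans (ler_mdD _ _) _; rewrite mdN [md (3 * x)]mdM [md (2 * h)]mdM.
      rewrite !md_nat; lra.
    have p1 : md (x - h)^-1 ^+ 2 <= 4 by nra.
    have p2 : md x^-1 ^+ 2 <= 4 by nra.
    have p3 : md x^-1 ^+ 3 <= 8 by rewrite exprS; have := sqr_ge0 (md x^-1); nra.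
    have q3 : 0 <= md x^-1 ^+ 3 by rewrite exprn_ge0.
    have q2 : 0 <= md (x - h)^-1 ^+ 2 by rewrite exprn_ge0.
    have p4 : md (x - h)^-1 ^+ 2 * md x^-1 ^+ 3 <= 32 by nra.
    have q4 : 0 <= md (x - h)^-1 ^+ 2 * md x^-1 ^+ 3 by rewrite mulr_ge0.
    have := md_ge0 (3 * x - 2 * h); nra.
have MK : 0 <= M * K by rewrite mulr_ge0.
have K1 : 0 < M * K * 8 + 1 by lra.
(* The factor 8 is the perimeter [2 * (md u + md v)]. *)
move=> e e0; exists (Num.min (1 / 2 - md a) (e / (M * K * 8 + 1))).
  rewrite lt_min; apply/andP; split; first by rewrite subr_gt0.
  by rewrite divr_gt0.
move=> h; rewrite lt_min => /andP[h1 h2].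
have h0 := md_ge0 h; have a0 := md_ge0 a.
have b1 : md (a + h) < 1 / 2 by apply: le_lt_trans (ler_mdD _ _) _; lra.
have c1 := pgram_cont_cauchy k cphi b1; have c2 := pgram_cont_cauchy k cphi a1.
have c3 := pgram_cont_cauchy k.+1 cphi a1.
have E : cauchy_int phi k (a + h) - cauchy_int phi k a - k%:R * cauchy_int phi k.+1 a * h =
  pgram_int (fun w => phi w * (w - (a + h))^-1 ^+ k + (-1) * (phi w * (w - a)^-1 ^+ k
     + (k%:R * h) * (phi w * (w - a)^-1 ^+ k.+1))) z0 u v.
  rewrite pgram_int_lin // ?pgram_int_lin //; first by rewrite /cauchy_int; ring.
  apply: pgram_cont_edges => w /(bd_neq a1) wa.
  have cc j : ccont_at (fun w => phi w * (w - a)^-1 ^+ j) w.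
    by apply: cmul_cont => //; apply: cexp_cont; apply: cinv_cont.
  rewrite (_ : (fun w => _) = fun w => phi w * (w - a)^-1 ^+ k * (1 + k%:R * h * (w - a)^-1)).
    apply: cmul_cont => //.
    apply: cder_ccont (cderD (cder_cst 1 w) (cderM (cder_cst (k%:R * h) w)
      (cder_comp (cderB (cder_id w) (cder_cst a w)) (cder_inv _)))).
    by rewrite subr_eq0.
  by apply/funext => x; rewrite exprSr; ring.
rewrite E.
apply: (@le_trans _ _ (M * (K * md h ^+ 2) * (2 * (md u + md v)))).
  apply: pgram_int_le => [|w bw].
    apply: pgram_cont_edges => w bw; have wa := bd_neq a1 bw; have wb := bd_neq b1 bw.
    rewrite (_ : (fun w => _) = fun w => phi w * ((w - (a + h))^-1 ^+ k +
       (-1) * ((w - a)^-1 ^+ k * (1 + k%:R * h * (w - a)^-1)))); last first.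
      by apply/funext => x; rewrite exprSr; ring.
    apply: cmul_cont => //.
    have dinv b : w != b -> exists l, cder (fun w => (w - b)^-1 ^+ k) w l.
      move=> wb'; have wb0 : w - b != 0 by rewrite subr_eq0.
      have D := cder_comp (cderB (cder_id w) (cder_cst b w)) (cder_inv wb0).
      elim: (k) => [|j [l IH]].
        by exists 0; apply: cder_ext (cder_cst 1 w) => x; rewrite expr0.
      by eexists; apply: cder_ext (cderM D IH) => x; rewrite exprS.
    have [l1 D1] := dinv _ wb; have [l2 D2] := dinv _ wa.
    have wa0 : w - a != 0 by rewrite subr_eq0.
    have D3 := cder_comp (cderB (cder_id w) (cder_cst a w)) (cder_inv wa0).
    exact: cder_ccont (cderD D1 (cderM (cder_cst (-1) w) (cderM D2
      (cderD (cder_cst 1 w) (cderM (cder_cst (k%:R * h) w) D3))))).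
  rewrite (_ : _ + _ = phi w * ((w - a - h)^-1 ^+ k - (w - a)^-1 ^+ k
     - k%:R * h * (w - a)^-1 ^+ k.+1)); last by rewrite opprD addrA; ring.
  rewrite mdM; apply: ler_pM => //; [exact: md_ge0|exact: md_ge0|exact: HM|].
  have /andP[d1 d2] := bd_dist a1 bw; have /andP[d3 d4] := bd_dist b1 bw.
  apply: est; [by rewrite d1|by rewrite -addrA -opprD|by lra].
rewrite md_u md_v; move: h2; rewrite ltr_pdivlMr // => h2.
have -> : M * (K * md h ^+ 2) * (2 * (2 + 2)) = (md h * (M * K * 8)) * md h by ring.
apply: ler_wpM2r => //; lra.
Qed.

(** The difference quotient. At [a] its value is 0 rather than the derivative, so it may jump there
    but stays bounded nearby. *)
Definition hq f a w := (f w - f a) * (w - a)^-1.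

Lemma hq_cder f a w : w != a -> (exists l, cder f w l) -> exists l, cder (hq f a) w l.
Proof.
move=> wa [l D]; have wa0 : w - a != 0 by rewrite subr_eq0.
eexists; exact: cderM (cderB D (cder_cst (f a) w))
  (cder_comp (cderB (cder_id w) (cder_cst a w)) (cder_inv wa0)).
Qed.

Lemma sub_pgram_int_hq_away f a (s t l m : R) : (forall w, exists l, cder f w l) ->
  0 <= l -> 0 <= m ->
  (forall x y : R, s <= x <= s + l -> t <= y <= t + m -> z0 + cr x * u + cr y * v != a) ->
  sub_pgram_int (hq f a) z0 u v s t l m = 0.
Proof.
move=> ef l0 m0 H; rewrite sub_pgram_int.unlock; apply: goursat => w [x [y [x01 y01 ->]]].
apply: hq_cder => //; rewrite (_ : _ + _ = z0 + cr (s + x * l) * u + cr (t + y * m) * v).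
  by apply: H; nra.
by rewrite !(crD, crM, crN); ring.
Qed.

(* The exceptional point is cut out by a small square, on which [hq f a] is bounded. *)
Lemma pgram_int_hq f a : (forall w, exists l, cder f w l) -> md a < 1 / 2 ->
  pgram_int (hq f a) z0 u v = 0.
Proof.
move=> ef a1; have [l Dl] := ef a.
have [d d0 dP] := Dl 1 ltr01.
have hb w : md (w - a) < d -> md (hq f a w) <= 1 + md l.
  move=> wd; have := dP _ wd; rewrite (_ : a + (w - a) = w); last by ring.
  have [->|wa] := eqVneq w a; first by rewrite /hq !subrr mul0r md0 => _; rewrite addr_ge0 ?md_ge0.
  have wa0 : w - a != 0 by rewrite subr_eq0.
  rewrite mul1r => h; rewrite /hq mdM mdV ler_pdivrMr ?md_gt0 //.
  rewrite (_ : f w - f a = f w - f a - l * (w - a) + l * (w - a)); last by ring.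
  by apply: le_trans (ler_mdD _ _) _; rewrite mdM; lra.
have := ler_re_md a; have := ler_im_md a; rewrite !ler_norml => /andP[i1 i2] /andP[r1 r2].
pose s0 := (re a + 1) / 2; pose t0 := (im a + 1) / 2.
have s01 : 1 / 4 < s0 < 3 / 4 by rewrite /s0; apply/andP; split; lra.
have t01 : 1 / 4 < t0 < 3 / 4 by rewrite /t0; apply/andP; split; lra.
have aE x y : z0 + cr x * u + cr y * v = a -> x = s0 /\ y = t0.
  by rewrite pt_square /s0 /t0 => <- /=; split; field.
have nea x y : x != s0 \/ y != t0 -> z0 + cr x * u + cr y * v != a.
  by move=> H; apply/eqP => /aE [xs yt]; case: H; rewrite ?xs ?yt eqxx.
have cc x y : x != s0 \/ y != t0 -> ccont_at (hq f a) (z0 + cr x * u + cr y * v).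
  by move=> /nea ne; have [n /cder_ccont] := hq_cder ne (ef _).
(* Here [k] is half the side of the small square in parameters. As [u] and [v] have length 2, its
   points are within [4k] of [a] and its perimeter is [16k]. *)
have main k : 0 < k -> k < 1 / 8 -> 4 * k < d ->
    md (pgram_int (hq f a) z0 u v) <= 16 * k * (1 + md l).
  move=> k0 k1 kd.
  have -> : pgram_int (hq f a) z0 u v = sub_pgram_int (hq f a) z0 u v 0 0 1 1.
    by rewrite sub_pgram_int.unlock cr0 cr1 !mul0r !addr0 !mul1r.
  (* Cuts at [s0 - k], [s0 + k], [t0 - k], [t0 + k] split off four rectangles that avoid [a]; on
     each of them Goursat's theorem gives 0. *)
  have -> : sub_pgram_int (hq f a) z0 u v 0 0 1 1 = sub_pgram_int (hq f a) z0 u v (s0 - k) (t0 - k) (k + k) (k + k).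
    rewrite -[X in sub_pgram_int _ _ _ _ 0 0 X 1](_ : (s0 - k) + (1 - (s0 - k)) = 1); last by ring.
    rewrite sub_pgram_int_addu; first last.
    - by move=> b _; split; apply: cc; right; apply/eqP; lra.
    - by lra.
    - by lra.
    rewrite sub_pgram_int_hq_away //; first last.
    - by move=> x y /andP[_ x2] _; apply: nea; left; apply/eqP; lra.
    - by lra.
    rewrite !add0r -[1 - (s0 - k)](_ : (k + k) + (1 - (s0 + k)) = _); last by ring.
    rewrite sub_pgram_int_addu; first last.
    - by move=> b _; split; apply: cc; right; apply/eqP; lra.
    - by lra.
    - by lra.
    rewrite [X in _ + X = _]sub_pgram_int_hq_away //; first last.
    - by move=> x y /andP[x1 _] _; apply: nea; left; apply/eqP; lra.
    - by lra.
    rewrite addr0 -[X in sub_pgram_int _ _ _ _ _ 0 _ X](_ : (t0 - k) + (1 - (t0 - k)) = 1); last by ring.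
    rewrite sub_pgram_int_addv; first last.
    - by move=> b _; split; apply: cc; left; apply/eqP; lra.
    - by lra.
    - by lra.
    rewrite sub_pgram_int_hq_away //; first last.
    - by move=> x y _ /andP[_ y2]; apply: nea; right; apply/eqP; lra.
    - by lra.
    - by lra.
    rewrite !add0r -[1 - (t0 - k)](_ : (k + k) + (1 - (t0 + k)) = _); last by ring.
    rewrite sub_pgram_int_addv; first last.
    - by move=> b _; split; apply: cc; left; apply/eqP; lra.
    - by lra.
    - by lra.
    rewrite [X in _ + X = _]sub_pgram_int_hq_away ?addr0 //; first last.
    - by move=> x y _ /andP[y1 _]; apply: nea; right; apply/eqP; lra.
    - by lra.
    - by lra.
  rewrite sub_pgram_int.unlock.
  have bnd w : edges (z0 + cr (s0 - k) * u + cr (t0 - k) * v) (cr (k + k) * u) (cr (k + k) * v) w ->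
      exists x y, [/\ (x != s0 \/ y != t0), `|x - s0| <= k, `|y - t0| <= k &
      w = z0 + cr x * u + cr y * v].
    move=> [t tt [] ->].
    - exists (s0 - k + t * (k + k)), (t0 - k); split; [right; apply/eqP; lra|..];
       rewrite ?ler_norml; [apply/andP; split; nra|apply/andP; split; nra|].
      by rewrite !(crD, crM, crN); ring.
    - exists (s0 + k), (t0 - k + t * (k + k)); split; [left; apply/eqP; lra|..];
       rewrite ?ler_norml; [apply/andP; split; nra|apply/andP; split; nra|].
      by rewrite !(crD, crM, crN); ring.
    - exists (s0 - k + t * (k + k)), (t0 + k); split; [right; apply/eqP; lra|..];
       rewrite ?ler_norml; [apply/andP; split; nra|apply/andP; split; nra|].
      by rewrite !(crD, crM, crN); ring.
    - exists (s0 - k), (t0 - k + t * (k + k)); split; [left; apply/eqP; lra|..];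
       rewrite ?ler_norml; [apply/andP; split; nra|apply/andP; split; nra|].
      by rewrite !(crD, crM, crN); ring.
  apply: (@le_trans _ _ ((1 + md l) * (2 * (md (cr (k + k) * u) + md (cr (k + k) * v))))).
    apply: pgram_int_le.
      by apply: pgram_cont_edges => w /bnd [x [y [H _ _ ->]]]; apply: cc.
    move=> w /bnd [x [y [_ xs yt ->]]]; apply: hb; apply: le_lt_trans kd.
    rewrite pt_square; apply: le_trans (md_le_reim _) _; rewrite !reimE /=.
    rewrite (_ : _ - re a = 2 * (x - s0)); last by rewrite /s0; field.
    rewrite (_ : _ - im a = 2 * (y - t0)); last by rewrite /t0; field.
    by rewrite !normrM ger0_norm //; lra.
  rewrite !mdM md_u md_v !md_cr ger0_norm; last by lra.
  by rewrite le_eqVlt; apply/orP; left; apply/eqP; ring.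
apply/eqP; rewrite -md_eq0 eq_le md_ge0 andbT leNgt; apply/negP => q0.
have l1 : 0 < 1 + md l by have := md_ge0 l; lra.
(* The last term makes [16 k (1 + |l|)] at most half the modulus of the integral, against [main]. *)
pose k := Num.min (1 / 16) (Num.min (d / 8) (md (pgram_int (hq f a) z0 u v) / (32 * (1 + md l)))).
have k0 : 0 < k by rewrite !lt_min !divr_gt0 //; lra.
have k1 : k <= 1 / 16 by rewrite !ge_min lexx.
have k2 : k <= d / 8 by rewrite !ge_min lexx orbT.
have k3 : k <= md (pgram_int (hq f a) z0 u v) / (32 * (1 + md l)) by rewrite !ge_min lexx !orbT.
move: k3; rewrite ler_pdivlMr; last by lra.
have k4 : k < 1 / 8 by lra.
have k5 : 4 * k < d by lra.
have := main k k0 k4 k5; lra.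
Qed.

End Cauchy.

Section Cauchy2.
Variable R : realType.
Local Notation C := (Cplx R).
Local Notation re := (@complex.Re R).
Local Notation im := (@complex.Im R).
Implicit Types f g phi : C -> C.
Implicit Types a b w z : C.
Local Notation z0 := (sq_corner R).
Local Notation u := (sq_right R).
Local Notation v := (sq_up R).
Local Notation bd := (edges z0 u v).

Definition one_fun w : C := 1.

Lemma ccont_one_fun w : ccont_at one_fun w.
Proof. exact: ccont_cst. Qed.

Lemma cauchy_sq f a : (forall w, exists l, cder f w l) -> md a < 1 / 2 ->
  cauchy_int f 1 a = f a * cauchy_int one_fun 1 a.
Proof.
move=> ef a1; have cf w : ccont_at f w by have [l /cder_ccont] := ef w.
have := pgram_int_hq ef a1.
have -> : hq f a = fun w => f w * (w - a)^-1 ^+ 1 + (- f a) * (one_fun w * (w - a)^-1 ^+ 1).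
  by apply/funext => w; rewrite /hq /one_fun !expr1; ring.
rewrite pgram_int_lin; [|exact: pgram_cont_cauchy cf a1|exact: pgram_cont_cauchy ccont_one_fun a1].
by rewrite -!/(cauchy_int _ _ _) => h; apply/eqP; rewrite -subr_eq0 -mulNr h.
Qed.

Lemma inv_cj w : w^-1 = cj w * cr (md w ^- 2).
Proof.
have [->|w0] := eqVneq w 0; first by rewrite invr0 md0 expr0n /= invr0 cr0 mulr0.
have m0 : md w ^+ 2 != 0 by rewrite expf_eq0 md_eq0.
apply: (mulfI w0); rewrite divff // mulrA mulcj -crM divff //.
Qed.

(** The imaginary part of [dw / w] is the differential of the argument. Each side, run through
    counterclockwise, contributes at least 1 to it (exactly pi / 2), because [2 / (1 + x^2) >= 1] on
    [-1, 1]. The factor [I] turns imaginary parts into real ones, up to sign. *)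
Lemma cauchy_int1_neq0 : cauchy_int one_fun 1 0 != 0.
Proof.
have md0' : md (0 : C) < 1 / 2 by rewrite md0; lra.
have [c1 c2 c3 c4] := pgram_cont_cauchy 1 ccont_one_fun md0'.
set g := fun w : C => one_fun w * (w - 0)^-1 ^+ 1 in c1 c2 c3 c4.
have gE w : g w = cj w * cr (md w ^- 2) by rewrite /g /one_fun mul1r expr1 subr0 inv_cj.
have nb t : 0 <= t <= 1 -> 1 <= 2 / (1 + (-1 + t * 2) ^+ 2) :> R.
  by move=> t01; rewrite ler_pdivlMr; nra.
pose I : C := Complex 0 1.
have e1 : re (I * lint g z0 u) <= -1.
  apply: lint_re_le => // t t01; rewrite gE.
  rewrite (_ : z0 + cr t * u = Complex (-1 + t * 2) (-1)); last by apply: cplx_eq; rewrite !reimE /=; ring.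
  rewrite sqr_md !reimE /=; have := nb t t01; set D := 1 + _.
  by rewrite (_ : _ ^+ 2 + _ ^+ 2 = D); [move=> h; lra|rewrite /D; ring].
have e2 : re (I * lint g (z0 + u) v) <= -1.
  apply: lint_re_le => // t t01; rewrite gE.
  rewrite (_ : z0 + u + cr t * v = Complex 1 (-1 + t * 2)); last by apply: cplx_eq; rewrite !reimE /=; ring.
  rewrite sqr_md !reimE /=; have := nb t t01; set D := 1 + _.
  by rewrite (_ : _ ^+ 2 + _ ^+ 2 = D); [move=> h; lra|rewrite /D; ring].
have e3 : re (- I * lint g (z0 + v) u) <= -1.
  apply: lint_re_le => // t t01; rewrite gE.
  rewrite (_ : z0 + v + cr t * u = Complex (-1 + t * 2) 1); last by apply: cplx_eq; rewrite !reimE /=; ring.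
  rewrite sqr_md !reimE /=; have := nb t t01; set D := 1 + _.
  by rewrite (_ : _ ^+ 2 + _ ^+ 2 = D); [move=> h; lra|rewrite /D; ring].
have e4 : re (- I * lint g z0 v) <= -1.
  apply: lint_re_le => // t t01; rewrite gE.
  rewrite (_ : z0 + cr t * v = Complex (-1) (-1 + t * 2)); last by apply: cplx_eq; rewrite !reimE /=; ring.
  rewrite sqr_md !reimE /=; have := nb t t01; set D := 1 + _.
  by rewrite (_ : _ ^+ 2 + _ ^+ 2 = D); [move=> h; lra|rewrite /D; ring].
apply/eqP => N0; have : re (I * cauchy_int one_fun 1 0) = 0 by rewrite N0 mulr0.
rewrite /cauchy_int pgram_int.unlock -/g; move: e1 e2 e3 e4.
move: (lint g z0 u) (lint g (z0 + u) v) (lint g (z0 + v) u) (lint g z0 v) => A B D E.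
rewrite !reimE /=; lra.
Qed.

(* Near [0], [f] is the quotient of its Cauchy integral over the square by that of the
   constant [1], and both are twice differentiable; that the latter is the constant
   [2 pi i] is not needed, only that it does not vanish at [0]. *)
Lemma second_der0 f f' : (forall w, cder f w (f' w)) -> exists l, cder f' 0 l.
Proof.
move=> ef; have ef' w : exists l, cder f w l by exists (f' w).
have cf w : ccont_at f w by have [l /cder_ccont] := ef' w.
have md0' : md (0 : C) < 1 / 2 by rewrite md0; lra.
have D1 phi a := @cauchy_int_cder R phi 1 a; have D2 phi a := @cauchy_int_cder R phi 2 a.
have [|d d0 dP] := cder_ccont (D1 one_fun 0 ccont_one_fun isT md0') (e := md (cauchy_int one_fun 1 0)).
  by rewrite md_gt0 cauchy_int1_neq0.
pose r := Num.min d (1 / 2).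
have r0 : 0 < r by rewrite lt_min d0; lra.
have nz a : md a < r -> md a < 1 / 2 /\ cauchy_int one_fun 1 a != 0.
  rewrite lt_min => /andP[ad ->]; split=> //; apply/eqP => N0.
  by have := dP a; rewrite subr0 N0 sub0r mdN ltxx => /(_ ad).
(* Obtained by differentiating [cauchy_int f 1 = f * cauchy_int one_fun 1] and solving for [f']. All
   ingredients of [F] are differentiable at 0. *)
pose F a := (1%:R * cauchy_int f 2 a - f a * (1%:R * cauchy_int one_fun 2 a)) * (cauchy_int one_fun 1 a)^-1.
have FE a : md a < r -> F a = f' a.
  move=> /nz [a1 n0].
  have E : 1%:R * cauchy_int f 2 a = f' a * cauchy_int one_fun 1 a + f a * (1%:R * cauchy_int one_fun 2 a).
    apply: cder_unique (D1 f a cf isT a1) _.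
    have L : cder (fun w => f w * cauchy_int one_fun 1 w) a (f' a * cauchy_int one_fun 1 a + f a * (1%:R * cauchy_int one_fun 2 a)).
      exact: cderM (ef a) (D1 one_fun a ccont_one_fun isT a1).
    have s0 : 0 < 1 / 2 - md a by lra.
    apply: (cder_near s0) L => w wa.
    by rewrite (@cauchy_sq f w) //; have := ler_mdD (w - a) a; rewrite subrK; lra.
  by rewrite /F E addrK mulfK.
have [l L] : exists l, cder F 0 l.
  eexists; apply: cderM; last exact: cder_comp (D1 one_fun 0 ccont_one_fun isT md0') (cder_inv (cauchy_int1_neq0)).
  apply: cderB; first by apply: cderM (cder_cst _ _) (D2 f 0 cf isT md0').
  by apply: cderM (ef 0) _; apply: cderM (cder_cst _ _) (D2 one_fun 0 ccont_one_fun isT md0').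
exists l; apply: (cder_near r0) L => w; rewrite subr0; exact: FE.
Qed.

Theorem second_der f f' : (forall w, cder f w (f' w)) -> forall z, exists l, cder f' z l.
Proof.
move=> ef z; have [|l L] := @second_der0 (fun w => f (w + z)) (fun w => f' (w + z)).
  by move=> w; apply: cder_shift.
exists l; have := @cder_shift R (fun w => f' (w + z)) (- z) z l.
rewrite subrr => /(_ L); apply: cder_ext => w.
by rewrite subrK.
Qed.

End Cauchy2.

(** * Second order jets and the Ahlfors-Schwarz lemma *)

Section Jets.
Variable R : realType.
Local Notation C := (Cplx R).
Local Notation re := (@complex.Re R).
Local Notation im := (@complex.Im R).
Implicit Types (u : C -> R) (z h : C) (al be : C) (ka : R).

(* [u (z + h) = u z + Re (al h) + Re (be h^2) + ka |h|^2 + o(|h|^2)]: every real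
   quadratic Taylor polynomial has this form, and [4 ka] is the Laplacian. *)
Definition jet u z al be ka := forall e : R, 0 < e -> exists2 d : R, 0 < d &
  forall h, md h < d ->
    `|u (z + h) - u z - (re (al * h) + re (be * h ^+ 2) + ka * md h ^+ 2)| <= e * md h ^+ 2.

Definition exp2 (p : R -> R) (x a b : R) := forall e : R, 0 < e -> exists2 d : R, 0 < d &
  forall y, `|y| < d -> `|p (x + y) - p x - a * y - b * y ^+ 2 / 2| <= e * y ^+ 2.

Lemma min3 (a b c : R) : 0 < a -> 0 < b -> 0 < c -> exists2 d, 0 < d & [/\ d <= a, d <= b & d <= c].
Proof.
move=> a0 b0 c0; exists (Num.min a (Num.min b c)); first by rewrite !lt_min a0 b0.
by rewrite !ge_min !lexx !orbT.
Qed.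

Lemma small_mul (A e : R) : 0 <= A -> 0 < e -> exists2 d, 0 < d & A * d <= e.
Proof.
move=> A0 e0; have A1 : 0 < 1 + A by lra.
exists (e / (1 + A)); first by rewrite divr_gt0.
by rewrite mulrA ler_pdivrMr // [A * e]mulrC ler_pM2l //; lra.
Qed.

Lemma jetD u1 u2 z a1 b1 k1 a2 b2 k2 : jet u1 z a1 b1 k1 -> jet u2 z a2 b2 k2 ->
  jet (fun w => u1 w + u2 w) z (a1 + a2) (b1 + b2) (k1 + k2).
Proof.
move=> H1 H2 e e0; have e20 : 0 < e / 2 by lra.
have [d1 d10 D1] := H1 _ e20; have [d2 d20 D2] := H2 _ e20.
exists (Num.min d1 d2); first by rewrite lt_min d10.
move=> h; rewrite lt_min => /andP[/D1 {}D1 /D2 {}D2].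
rewrite !mulrDl !reD.
set x1 := u1 _ - _ - _ in D1; set x2 := u2 _ - _ - _ in D2.
rewrite (_ : _ - _ = x1 + x2); last by rewrite /x1 /x2; ring.
by apply: le_trans (ler_normD _ _) _; lra.
Qed.

(** The second order chain rule. The square of [re (al h)] equals
    [(|al|^2 |h|^2 + re (al^2 h^2)) / 2], so the term in [b / 2] is shared by [be] and [ka]. *)
Lemma jet_comp u p z al be ka (a b : R) : jet u z al be ka -> exp2 p (u z) a b ->
  jet (fun w => p (u w)) z (cr a * al) (cr a * be + cr (b / 4) * al ^+ 2)
    (a * ka + b / 4 * md al ^+ 2).
Proof.
move=> Hu Hp e e0.
have al0 := md_ge0 al; have be0 := md_ge0 be.
set K := md be + `|ka| + 1; have K0 : 0 < K by rewrite /K; have := normr_ge0 ka; lra.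
have KK0 : 0 <= (md al + K) ^+ 2 by rewrite sqr_ge0.
(* The error is [th + a * rho + b / 2 * (y ^+ 2 - x ^+ 2)]: [th] is the remainder of [p], [rho] that
   of [u], [y] the increment of [u] and [x] its linear part. Each term receives a third of [e]. *)
have [e1 e10 E1] := small_mul KK0 (divr_gt0 e0 (ltr0Sn R 2)).
have [e2 e20 E2] := small_mul (normr_ge0 a) (divr_gt0 e0 (ltr0Sn R 2)).
have B0 : 0 <= `|b| / 2 * (K * (2 * md al + K)).
  by rewrite !mulr_ge0 // ?invr_ge0 //; lra.
have [e3 e30 E3] := small_mul B0 (divr_gt0 e0 (ltr0Sn R 2)).
have [d1 d10 D1] := Hp _ e10.
have m0 : 0 < Num.min 1 e2 by rewrite lt_min ltr01.
have [d2 d20 D2] := Hu _ m0.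
have [d4 d40 E4] := small_mul (ltW (ltr_wpDl al0 K0)) (divr_gt0 d10 (ltr0Sn R 1)).
have [d5 d50 [d51 d52 d53]] := min3 d20 e30 d40.
have [d d0 [dd1 dd2 _]] := min3 d50 ltr01 ltr01.
exists d => // h hd.
have h0 := md_ge0 h; have h1 : md h <= 1 by lra.
set y := u (z + h) - u z.
have := D2 h (lt_le_trans hd (le_trans dd1 d51)); rewrite -/y.
set rho := y - _ => rhoP.
have hh : 0 <= md h ^+ 2 by rewrite sqr_ge0.
have rho1 : `|rho| <= md h ^+ 2.
  by apply: le_trans rhoP _; rewrite ler_piMl // ge_min lexx.
have rho2 : `|rho| <= e2 * md h ^+ 2.
  by apply: le_trans rhoP _; rewrite ler_wpM2r // ge_min lexx orbT.
set x := re (al * h).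
have xB : `|x| <= md al * md h by rewrite -mdM ler_re_md.
have yx : `|y - x| <= K * md h ^+ 2.
  rewrite (_ : y - x = re (be * h ^+ 2) + (ka * md h ^+ 2 + rho)); last by rewrite /rho; ring.
  apply: le_trans (ler_normD _ _) _.
  have n1 : `|re (be * h ^+ 2)| <= md be * md h ^+ 2.
    by apply: le_trans (ler_re_md _) _; rewrite mdM mdX.
  have n2 := ler_normD (ka * md h ^+ 2) rho.
  rewrite normrM (ger0_norm hh) in n2; rewrite /K; lra.
have hh1 : md h ^+ 2 <= md h by rewrite expr2 ler_piMr.
have yB : `|y| <= (md al + K) * md h.
  rewrite (_ : y = x + (y - x)); last by ring.
  by apply: le_trans (ler_normD _ _) _; nra.
have yd : `|y| < d1.
  have alK : 0 <= md al + K by lra.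
  apply: le_lt_trans yB _; have : (md al + K) * md h <= (md al + K) * d4 by apply: ler_wpM2l => //; lra.
  lra.
have := D1 y yd; rewrite (_ : u z + y = u (z + h)); last by rewrite /y; ring.
set th := _ - _ - _ - _ => thP.
have th1 : `|th| <= e / 3 * md h ^+ 2.
  apply: le_trans thP _.
  have : y ^+ 2 <= (md al + K) ^+ 2 * md h ^+ 2.
    rewrite -exprMn -(real_normK (num_real y)) ler_pXn2r ?nnegrE //.
    by rewrite mulr_ge0 //; lra.
  move=> yy; have : e1 * y ^+ 2 <= e1 * ((md al + K) ^+ 2 * md h ^+ 2) by rewrite ler_pM2l.
  have : ((md al + K) ^+ 2 * e1) * md h ^+ 2 <= e / 3 * md h ^+ 2 by rewrite ler_wpM2r.
  by set A := _ ^+ 2; set B := md h ^+ 2; lra.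
have t2 : `|a * rho| <= e / 3 * md h ^+ 2.
  rewrite normrM; apply: (@le_trans _ _ (`|a| * (e2 * md h ^+ 2))); first by rewrite ler_wpM2l.
  by rewrite mulrA ler_wpM2r.
have t3 : `|b / 2 * (y ^+ 2 - x ^+ 2)| <= e / 3 * md h ^+ 2.
  rewrite (_ : b / 2 * _ = (b / 2) * ((y - x) * (y + x))); last by ring.
  rewrite !normrM [`|2^-1|]ger0_norm ?invr_ge0 //.
  have yx2 : `|y + x| <= (2 * md al + K) * md h.
    by apply: le_trans (ler_normD _ _) _; lra.
  apply: (@le_trans _ _ (`|b| / 2 * ((K * md h ^+ 2) * ((2 * md al + K) * md h)))).
    by rewrite ler_wpM2l ?mulr_ge0 ?invr_ge0 // ler_pM.
  rewrite (_ : _ * _ = (`|b| / 2 * (K * (2 * md al + K)) * md h) * md h ^+ 2); last by ring.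
  rewrite ler_wpM2r //; apply: le_trans E3; rewrite ler_wpM2l //; lra.
rewrite (_ : p (u (z + h)) - p (u z) - _ = th + (a * rho + b / 2 * (y ^+ 2 - x ^+ 2))).
  apply: le_trans (ler_normD _ _) _; have := ler_normD (a * rho) (b / 2 * (y ^+ 2 - x ^+ 2)); lra.
have xx : x ^+ 2 = (md al ^+ 2 * md h ^+ 2 + re (al ^+ 2 * h ^+ 2)) / 2.
  by rewrite /x !sqr_md !expr2 !reimE; field.
have E4' : re (cr a * al * h) = a * x by rewrite /x !reimE /=; ring.
have E5 : re ((cr a * be + cr (b / 4) * al ^+ 2) * h ^+ 2) =
    a * re (be * h ^+ 2) + b / 4 * re (al ^+ 2 * h ^+ 2).
  by move: (h ^+ 2) (al ^+ 2) => h2 a2; rewrite !reimE /=; ring.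
rewrite E4' E5 xx /th /rho /y -/x; by field.
Qed.

(* Summing over [h = t, i t, -t, -i t] cancels the terms in [al] and [be]. *)
Lemma jet_max u z al be ka (d0 : R) : 0 < d0 -> jet u z al be ka ->
  (forall h, md h < d0 -> u (z + h) <= u z) -> ka <= 0.
Proof.
move=> d00 H mx; rewrite leNgt; apply/negP => k0.
have [d d1 dP] := H (ka / 2) (divr_gt0 k0 (ltr0Sn R 1)).
have [t t0 [t1 t2 _]] := min3 (divr_gt0 d00 (ltr0Sn R 1)) (divr_gt0 d1 (ltr0Sn R 1)) ltr01.
have one h : md h = t -> re (al * h) + re (be * h ^+ 2) <= - (ka / 2) * t ^+ 2.
  move=> ht; have := mx h; have := dP h; rewrite ht ler_norml => p1 p2.
  have /p1/andP[q1 _] : t < d by lra.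
  have /p2 q2 : t < d0 by lra.
  lra.
have mt : md (cr t) = t by rewrite md_cr ger0_norm // ltW.
have mi : md (Complex 0 1 * cr t : C) = t.
  by rewrite mdM mt md.unlock /= expr0n expr1n /= add0r sqrtr1 mul1r.
have h1 := one _ mt; have h2 := one _ mi.
have h3 := one (- cr t); have h4 := one (- (Complex 0 1 * cr t)).
rewrite mdN in h3; rewrite mdN in h4; have {}h3 := h3 mt; have {}h4 := h4 mi.
have : 0 < t ^+ 2 by rewrite exprn_gt0.
have : 0 < ka * t ^+ 2 by rewrite mulr_gt0 // exprn_gt0.
move: h1 h2 h3 h4; rewrite !expr2 !reimE /=; lra.
Qed.

(** The mean value theorem, applied to [p] minus its quadratic polynomial along the segment, reduces
    the claim to the first order expansion of [p'] at [x]. *)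
Lemma exp2_der p p' (x b d0 : R) : 0 < d0 -> (forall y, `|y - x| < d0 -> rder p y (p' y)) ->
  rder p' x b -> exp2 p x (p' x) b.
Proof.
move=> d00 H1 H2 e e0; have [d d1 dP] := H2 e e0.
exists (Num.min d0 d); first by rewrite lt_min d00.
move=> y; rewrite lt_min => /andP[y1 y2].
pose q s := p (x + s * y) - p' x * (s * y) - b * (s * y) ^+ 2 / 2.
pose q' s := (p' (x + s * y) - p' x - b * (s * y)) * y.
have [s|s s01] := @rMVT R q q' 0 1 ler01.
  move=> s01; apply/rder_is_derive; rewrite /q /q'.
  have sy : `|x + s * y - x| < d0.
    rewrite (_ : _ - _ = s * y); last by ring.
    rewrite normrM ger0_norm; [|lra]; have := normr_ge0 y; nra.
  have /rder_is_derive D := H1 _ sy.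
  have D1 : is_derive s 1 (fun s : R => x + s * y) y.
    apply: is_derive_eq; rewrite /GRing.scale /=; ring.
  have D2 : is_derive s 1 (fun s : R => s * y) y.
    apply: is_derive_eq; rewrite /GRing.scale /=; ring.
  have D3 := @is_derive1_comp R p _ s _ _ D D1.
  by apply: is_derive_eq; rewrite /GRing.scale /=; field.
have q0 : q 0 = p x by rewrite /q mul0r addr0; ring.
have q1 : q 1 = p (x + y) - p' x * y - b * y ^+ 2 / 2 by rewrite /q mul1r.
rewrite subr0 mulr1 q0 q1 => E.
rewrite (_ : _ - _ - _ - _ = p (x + y) - p' x * y - b * y ^+ 2 / 2 - p x); last by ring.
rewrite E /q' normrM.
have sy : `|s * y| <= `|y|.
  rewrite normrM ger0_norm; [|lra]; have := normr_ge0 y; nra.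
apply: (@le_trans _ _ ((e * `|s * y|) * `|y|)).
  by rewrite ler_wpM2r // dP //; apply: le_lt_trans sy _.
rewrite -[y ^+ 2]real_normK ?num_real // expr2 mulrA ler_wpM2r // ler_wpM2l // ltW //.
Qed.

Lemma exp2_ln (x : R) : 0 < x -> exp2 (@ln R) x x^-1 (- x ^- 2).
Proof.
move=> x0; apply: (@exp2_der (@ln R) (fun y => y^-1) x _ x x0).
- move=> y yx; apply/rder_is_derive; apply: is_derive1_ln.
  by move: yx; rewrite ltr_norml => /andP[]; lra.
- apply/rder_is_derive.
  have x1 : x != 0 by rewrite gt_eqF.
  have D := is_derive_id x (1 : R); have := @is_deriveV R _ x 1 1 x1 D.
  by rewrite /GRing.scale /= mulr1.
Qed.

End Jets.

Section Potential.
Variable R : realType.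
Local Notation C := (Cplx R).
Local Notation re := (@complex.Re R).
Local Notation im := (@complex.Im R).
Implicit Types (u G : C -> R) (a z h w : C) (al be : C) (ka : R).
Implicit Types F D : C -> C.

Definition rcont u z := forall e : R, 0 < e -> exists2 d : R, 0 < d &
  forall w, md (w - z) < d -> `|u w - u z| < e.

Lemma rcontP u z : rcont u z <-> {for z, continuous u}.
Proof.
split=> [H|H].
- move=> N /nbhs_ballP [e /= e0 eN]; have [d d0 dP] := H e e0.
  suff : nbhs z [set w | N (u w)] by [].
  apply/nbhs_md; exists d => // w wd; apply: eN.
  by rewrite /ball /= distrC; apply: dP.
- move=> e e0; have /H : nbhs (u z) (ball (u z) e) by apply/nbhs_ballP; exists e.
  move=> /nbhs_md [d d0 dP]; exists d => // w /dP.
  by rewrite /= /ball /= distrC.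
Qed.

Lemma rcontM u1 u2 z : rcont u1 z -> rcont u2 z -> rcont (fun w => u1 w * u2 w) z.
Proof. by move=> /rcontP ? /rcontP ?; apply/rcontP; apply: continuousM. Qed.

Lemma rcont_comp u (p : R -> R) z : rcont u z -> {for u z, continuous p} ->
  rcont (fun w => p (u w)) z.
Proof. by move=> /rcontP ? ?; apply/rcontP; apply: continuous_comp. Qed.

Lemma rcont_md F z : ccont_at F z -> rcont (fun w => md (F w)) z.
Proof.
move=> H e e0; have [d d0 dP] := H e e0; exists d => // w /dP.
by apply: le_lt_trans; exact: md_dist.
Qed.

Lemma rcont_md2 F z : ccont_at F z -> rcont (fun w => md (F w) ^+ 2) z.
Proof.
move=> /rcont_md H; rewrite (_ : (fun _ => _) = fun w => md (F w) * md (F w)).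
  exact: rcontM.
by apply/funext => w; rewrite expr2.
Qed.

Lemma ball_max (u : C -> R) a r : 0 <= r ->
  (forall z, md (z - a) <= r -> rcont u z) ->
  exists2 c, md (c - a) <= r & forall z, md (z - a) <= r -> u z <= u c.
Proof.
move=> r0 H; apply: (@compact_max R [set z | md (z - a) <= r] u); last 1 first.
  by move=> z /H cz e e0; have [d d0 dP] := cz e e0; exists d => // w _; apply: dP.
  by exists a; rewrite /= subrr md0.
exact: compact_cball.
Qed.

Lemma cder_lip F F' z h (M : R) : (forall t : R, 0 <= t <= 1 -> cder F (z + cr t * h) (F' (z + cr t * h))) ->
  (forall t : R, 0 <= t <= 1 -> md (F' (z + cr t * h)) <= M) -> md (F (z + h) - F z) <= M * md h.
Proof.
move=> H le; have P : prim (fun t => F' (z + cr t * h) * h) (fun t => F (z + cr t * h)).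
  by move=> t t01; apply: pder_cder; apply: H.
have := prim_md_le P (M := M * md h); rewrite cr1 cr0 mul1r mul0r addr0; apply => t t01.
by rewrite mdM ler_wpM2r ?md_ge0 // le.
Qed.

(** After subtraction of the quadratic polynomial the derivative [q'] is [o(w - z)], and the mean
    value inequality [cder_lip] integrates this. *)
Lemma taylor2 F F' z (c : C) : (forall w, cder F w (F' w)) -> cder F' z c ->
  forall e : R, 0 < e -> exists2 d : R, 0 < d & forall h, md h < d ->
    md (F (z + h) - F z - F' z * h - c / 2 * h ^+ 2) <= e * md h ^+ 2.
Proof.
move=> H1 H2 e e0; have [d d0 dP] := H2 e e0; exists d => // h hd.
pose q w := F w - F' z * w - c / 2 * (w - z) ^+ 2.
pose q' w := F' w - F' z - c * (w - z).
have Dq w : cder q w (q' w).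
  have Dz := cderB (cder_id w) (cder_cst z w).
  have := cderB (cderB (H1 w) (cderM (cder_cst (F' z) w) (cder_id w)))
     (cderM (cder_cst (c / 2) w) (cderM Dz Dz)).
  suff -> : q' w = F' w - (0 * w + F' z * 1) - (0 * ((w - z) * (w - z)) +
     c / 2 * ((1 - 0) * (w - z) + (w - z) * (1 - 0))) by apply: cder_ext => x; rewrite /q expr2.
  by rewrite /q'; field.
have := @cder_lip q q' z h (e * md h) (fun t _ => Dq _) _.
rewrite -mulrA -expr2 (_ : q (z + h) - q z = F (z + h) - F z - F' z * h - c / 2 * h ^+ 2).
  apply=> t /andP[t0 t1]; rewrite /q' (_ : _ - z = cr t * h); last by ring.
  have th : md (cr t * h) <= md h.
    by rewrite mdM md_cr ger0_norm //; have := md_ge0 h; nra.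
  apply: le_trans (dP _ (le_lt_trans th hd)) _.
  by rewrite ler_pM2l.
by rewrite /q; ring.
Qed.

Lemma jet_eq u z al be ka al' be' ka' : jet u z al be ka -> al = al' -> be = be' -> ka = ka' ->
  jet u z al' be' ka'.
Proof. by move=> H <- <- <-. Qed.

Lemma jet_cst (c : R) z : jet (fun _ => c) z 0 0 0.
Proof.
move=> e e0; exists 1 => // h _; rewrite !mul0r /= subrr addr0 addr0 subr0 normr0.
by apply: mulr_ge0; [exact: ltW|exact: sqr_ge0].
Qed.

Lemma jetZ (k : R) u z al be ka : jet u z al be ka ->
  jet (fun w => k * u w) z (cr k * al) (cr k * be) (k * ka).
Proof.
move=> H e e0; have k0 := normr_ge0 k.
have [e1 e10 E1] := small_mul k0 e0; have [d d0 dP] := H _ e10.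
exists d => // h /dP; set x := u _ - _ - _ => xP.
rewrite (_ : k * u (z + h) - k * u z - _ = k * x).
  rewrite normrM; apply: (@le_trans _ _ (`|k| * (e1 * md h ^+ 2))); first by rewrite ler_wpM2l.
  by rewrite mulrA ler_wpM2r // exprn_ge0 // md_ge0.
have R1 (X Y : C) : re (cr k * X * Y) = k * re (X * Y) by rewrite !reimE /=; ring.
by rewrite !R1 /x; ring.
Qed.

Lemma sqr_mdD (x y : C) : md (x + y) ^+ 2 = md x ^+ 2 + 2 * re (cj x * y) + md y ^+ 2.
Proof. by rewrite !sqr_md !reimE /=; ring. Qed.

(** The square [|F' h|^2] of the linear term is what feeds [ka], so the Laplacian of [|F|^2] is
    [4 |F'|^2]; the second derivative enters [be] alone. *)
Lemma jet_sqnorm F F' z (c : C) : (forall w, cder F w (F' w)) -> cder F' z c ->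
  jet (fun w => md (F w) ^+ 2) z (2 * cj (F z) * F' z) (cj (F z) * c) (md (F' z) ^+ 2).
Proof.
move=> H1 H2 e e0.
have A0 := md_ge0 (F z); have p0 := md_ge0 (F' z); have c0 := md_ge0 (c / 2).
have [e1 e10 E1] := small_mul (mulr_ge0 (ler0n R 2) A0) (divr_gt0 e0 (ltr0Sn R 1)).
have m0 : 0 < Num.min 1 e1 by rewrite lt_min ltr01.
have [d1 d10 D1] := taylor2 H1 H2 m0.
set K := md (c / 2) + 1; have K0 : 0 <= K by rewrite /K; lra.
have B0 : 0 <= 2 * md (F' z) * K + K ^+ 2 by rewrite addr_ge0 ?sqr_ge0 // !mulr_ge0.
have [d2 d20 D2] := small_mul B0 (divr_gt0 e0 (ltr0Sn R 1)).
have [d d0 [dd1 dd2 dd3]] := min3 d10 d20 ltr01.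
exists d => // h hd; have h0 := md_ge0 h.
have := D1 h (lt_le_trans hd dd1); set E := _ - _ - _ - _ => EP.
have hh : 0 <= md h ^+ 2 by rewrite sqr_ge0.
have EP1 : md E <= md h ^+ 2.
  by apply: le_trans EP _; rewrite ler_piMl // ge_min lexx.
have EP2 : md E <= e1 * md h ^+ 2.
  by apply: le_trans EP _; rewrite ler_wpM2r // ge_min lexx orbT.
set Y := c / 2 * h ^+ 2 + E.
have YP : md Y <= K * md h ^+ 2.
  by apply: le_trans (ler_mdD _ _) _; rewrite mdM mdX /K mulrDl mul1r lerD2l.
have -> : F (z + h) = F z + (F' z * h + Y) by rewrite /Y /E; ring.
rewrite sqr_mdD [md (F' z * h + Y) ^+ 2]sqr_mdD.
have -> : re (cj (F z) * (F' z * h + Y)) = re (cj (F z) * F' z * h) +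
    re (cj (F z) * c * h ^+ 2) / 2 + re (cj (F z) * E).
  have alg (x1 x2 x3 x4 : C) : re (x1 * (x2 * h + (c / 2 * x4 + x3))) =
      re (x1 * x2 * h) + re (x1 * c * x4) / 2 + re (x1 * x3).
    have -> : x1 * (x2 * h + (c / 2 * x4 + x3)) =
        x1 * x2 * h + cr (1 / 2) * (x1 * c * x4) + x1 * x3.
      by rewrite crM cr1 crV (_ : cr 2 = 2) ?crD ?cr1 //; field.
    by rewrite !reD [re (cr _ * _)]reM /=; ring.
  exact: alg.
have -> : re (2 * cj (F z) * F' z * h) = 2 * re (cj (F z) * F' z * h).
  by rewrite -!mulrA [re (2 * _)]reM /=; ring.
rewrite (_ : md (F' z * h) ^+ 2 = md (F' z) ^+ 2 * md h ^+ 2); last by rewrite mdM exprMn.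
rewrite (_ : _ - _ - _ = 2 * re (cj (F z) * E) + (2 * re (cj (F' z * h) * Y) + md Y ^+ 2)); last first.
  by field.
have b1 : `|re (cj (F z) * E)| <= md (F z) * md E by rewrite -(md_cj (F z)) -mdM ler_re_md.
have b2 : `|re (cj (F' z * h) * Y)| <= md (F' z) * md h * md Y.
  by rewrite -mdM -(md_cj (F' z * h)) -mdM ler_re_md.
have c1 : md (F z) * md E <= md (F z) * (e1 * md h ^+ 2) by rewrite ler_wpM2l.
have c2 : md (F' z) * md h * md Y <= md (F' z) * md h * (K * md h ^+ 2).
  by rewrite ler_wpM2l // mulr_ge0.
have Y0 := md_ge0 Y.
have c3 : md Y ^+ 2 <= K ^+ 2 * md h * md h ^+ 2.
  apply: (@le_trans _ _ ((K * md h ^+ 2) ^+ 2)); first by rewrite ler_pXn2r ?nnegrE ?mulr_ge0.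
  rewrite exprMn -mulrA ler_wpM2l ?sqr_ge0 // -[_ ^+ 2 ^+ 2]/(_ * _) ler_wpM2r //.
  by rewrite expr2 ler_piMr //; lra.
apply: le_trans (ler_normD _ _) _.
have n1 := ler_normD (2 * re (cj (F' z * h) * Y)) (md Y ^+ 2).
rewrite [`|md Y ^+ 2|]ger0_norm ?sqr_ge0 // in n1.
rewrite !normrM in n1 *; rewrite !(ger0_norm (ler0n R 2)) in n1 *.
have f1 : (2 * md (F z) * e1) * md h ^+ 2 <= e / 2 * md h ^+ 2 by rewrite ler_wpM2r.
have f2 : ((2 * md (F' z) * K + K ^+ 2) * md h) * md h ^+ 2 <= e / 2 * md h ^+ 2.
  by rewrite ler_wpM2r //; apply: le_trans D2; rewrite ler_wpM2l //; lra.
move: b1 b2 c1 c2 c3 n1 f1 f2; clear; move: (md h ^+ 2) => h2; lra.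
Qed.

End Potential.

(** * Maximum principles and the Ahlfors-Schwarz lemma *)

Section Ahlfors.
Variable R : realType.
Local Notation C := (Cplx R).
Local Notation re := (@complex.Re R).
Local Notation im := (@complex.Im R).
Implicit Types (u G : C -> R) (a z h w : C) (al be : C) (ka : R).
Implicit Types F D : C -> C.

Definition cent F := forall w, exists l, cder F w l.

Definition dv F w : C := xget 0 [set l | cder F w l].

Lemma dvP F : cent F -> forall w, cder F w (dv F w).
Proof. by move=> eF w; rewrite /dv; case: xgetP => [y _ //|H]; case: (eF w) => l /H. Qed.

Lemma cent_dv F : cent F -> cent (dv F).
Proof. by move=> eF; exact: second_der (dvP eF). Qed.

Lemma jet_rcont u z al be ka : jet u z al be ka -> rcont u z.
Proof.
move=> /(_ 1 ltr01) [d d0 dP] e e0.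
set K := md al + md be + `|ka| + 1.
have K0 : 0 <= K.
  by have := md_ge0 al; have := md_ge0 be; have := normr_ge0 ka; rewrite /K; lra.
have [d1 d10 D1] := small_mul K0 (divr_gt0 e0 (ltr0Sn R 1)).
have [d2 d20 [h1 h2 h3]] := min3 d0 d10 ltr01.
exists d2 => // w wd; have := dP (w - z) (lt_le_trans wd h1).
rewrite (_ : z + (w - z) = w); last by ring.
move: (w - z) wd => h hd; have h0 := md_ge0 h.
have hh : md h ^+ 2 <= md h by rewrite expr2 ler_piMr //; lra.
have b1 := ler_re_md (al * h); have b2 := ler_re_md (be * h ^+ 2).
rewrite mdM in b1; rewrite mdM mdX in b2.
have b3 : md be * md h ^+ 2 <= md be * md h by rewrite ler_wpM2l // md_ge0.
have b4 : `|ka * md h ^+ 2| <= `|ka| * md h.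
  by rewrite normrM ler_wpM2l // ger0_norm // sqr_ge0.
have b5 : K * md h <= K * d1 by rewrite ler_wpM2l //; lra.
have b6 : K * md h = md al * md h + md be * md h + `|ka| * md h + md h by rewrite /K; ring.
set X := re (al * h) in b1 *; set Y := re _ in b2 *; set Z := ka * _ in b4 *.
set W := u w - u z; rewrite mul1r => b7.
have := ler_normD (W - (X + Y + Z)) (X + Y + Z); rewrite subrK.
have := ler_normD (X + Y) Z; have := ler_normD X Y; lra.
Qed.

(** The logarithm of [|F|^2] is harmonic off the zeros: in [jet_comp] the contributions
    [|F'|^2 / |F|^2] of the first and of the second derivative of [ln] cancel. *)
Lemma jet_ln F z : cent F -> F z != 0 ->
  exists be, jet (fun w => ln (md (F w) ^+ 2)) z (2 * dv F z / F z) be 0.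
Proof.
move=> eF F0; have [c Hc] := cent_dv eF z.
have m0 : 0 < md (F z) by rewrite md_gt0.
have m1 : md (F z) != 0 by rewrite gt_eqF.
have X0 : 0 < md (F z) ^+ 2 by rewrite exprn_gt0.
have J := jet_comp (jet_sqnorm (dvP eF) Hc) (exp2_ln X0).
eexists; apply: (jet_eq J); last 1 first.
- rewrite [md (_ * _)]mdM [md (2 * _)]mdM md_cj md_nat !exprMn.
  by field.
- by rewrite inv_cj; ring.
- by reflexivity.
Qed.

Lemma jet_sqdist a z : jet (fun w => md (w - a) ^+ 2) z (2 * cj (z - a)) 0 1.
Proof.
have D w : cder (fun w => w - a) w 1.
  by rewrite -[1]subr0; apply: cderB; [exact: cder_id|exact: cder_cst].
apply: (jet_eq (jet_sqnorm D (cder_cst 1 z))); rewrite ?mulr1 ?mulr0 //.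
by rewrite md1 expr1n.
Qed.

Lemma interior_nbhd a r c : md (c - a) < r -> forall h, md h < r - md (c - a) -> md (c + h - a) < r.
Proof.
move=> ca h hd; have := ler_mdD (c - a) h; rewrite (_ : c - a + h = c + h - a); last by ring.
lra.
Qed.

(** Adding [e |w - a|^2] to [|F|^2] makes [ka] at least [e > 0], which [jet_max] forbids at an
    interior maximum. *)
Lemma max_principle F a r (M : R) : cent F -> 0 < r -> 0 <= M ->
  (forall z, md (z - a) = r -> md (F z) <= M) ->
  forall z, md (z - a) <= r -> md (F z) <= M.
Proof.
move=> eF r0 M0 H b br; rewrite leNgt; apply/negP => Fb.
have FM : 0 < md (F b) ^+ 2 - M ^+ 2.
  by rewrite subr_gt0 ltr_pXn2r // nnegrE // md_ge0.
(* The perturbation is at most [e r^2], half the gap, too little to move the maximum to the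
   boundary. *)
pose e := (md (F b) ^+ 2 - M ^+ 2) / (2 * r ^+ 2).
have rr : 0 < r ^+ 2 by rewrite exprn_gt0.
have e0 : 0 < e by rewrite divr_gt0 // mulr_gt0.
have er : e * r ^+ 2 = (md (F b) ^+ 2 - M ^+ 2) / 2 by rewrite /e; field; rewrite gt_eqF.
pose u w := md (F w) ^+ 2 + e * md (w - a) ^+ 2.
have J z : exists al be, jet u z al be (md (dv F z) ^+ 2 + e * 1).
  have [c Hc] := cent_dv eF z; eexists; eexists.
  exact: jetD (jet_sqnorm (dvP eF) Hc) (jetZ e (jet_sqdist a z)).
have [|c cr mx] := @ball_max R u a r (ltW r0).
  by move=> z _; have [al [be /jet_rcont]] := J z.
have cr' : md (c - a) < r.
  rewrite lt_neqAle cr andbT; apply/eqP => ce.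
  have := mx b br; rewrite /u ce er => h1.
  have h2 : md (F c) ^+ 2 <= M ^+ 2 by rewrite ler_pXn2r ?nnegrE ?md_ge0 // H.
  have h3 : 0 <= e * md (b - a) ^+ 2 by rewrite mulr_ge0 ?sqr_ge0 // ltW.
  by move: h1 h2 h3 FM; clear; move: (md (F c) ^+ 2) (md (F b) ^+ 2) (M ^+ 2) => x y t; lra.
have d0 : 0 < r - md (c - a) by rewrite subr_gt0.
have [al [be Jc]] := J c.
have := jet_max d0 Jc (fun h hd => mx _ (ltW (interior_nbhd cr' hd))).
have := sqr_ge0 (md (dv F c)); lra.
Qed.

(** The argument of [max_principle] for [- ln |F|^2], which is harmonic as [F] has no zeros in the
    disc. *)
Lemma min_principle F a r (m : R) : cent F -> 0 < r -> 0 < m ->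
  (forall z, md (z - a) <= r -> F z != 0) ->
  (forall z, md (z - a) = r -> m <= md (F z)) -> m <= md (F a).
Proof.
move=> eF r0 m0 nz H; rewrite leNgt; apply/negP => Fa.
have aa : md (a - a) <= r by rewrite subrr md0 ltW.
have sq z : md (z - a) <= r -> 0 < md (F z) ^+ 2 by move=> /nz; rewrite -md_gt0; apply: exprn_gt0.
have mm : 0 < m ^+ 2 by rewrite exprn_gt0.
have L : 0 < ln (m ^+ 2) - ln (md (F a) ^+ 2).
  rewrite subr_gt0 ltr_ln ?posrE ?sq // ltr_pXn2r ?nnegrE ?md_ge0 //.
  exact: ltW.
pose e := (ln (m ^+ 2) - ln (md (F a) ^+ 2)) / (2 * r ^+ 2).
have rr : 0 < r ^+ 2 by rewrite exprn_gt0.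
have e0 : 0 < e by rewrite divr_gt0 // mulr_gt0.
have er : e * r ^+ 2 = (ln (m ^+ 2) - ln (md (F a) ^+ 2)) / 2 by rewrite /e; field; rewrite gt_eqF.
pose u w := (-1) * ln (md (F w) ^+ 2) + e * md (w - a) ^+ 2.
have J z : md (z - a) <= r -> exists al be, jet u z al be ((-1) * 0 + e * 1).
  move=> /nz z0; have [be' J] := jet_ln eF z0; eexists; eexists.
  exact: jetD (jetZ (-1) J) (jetZ e (jet_sqdist a z)).
have [|c cr mx] := @ball_max R u a r (ltW r0).
  by move=> z /J [al [be /jet_rcont]].
have cr' : md (c - a) < r.
  rewrite lt_neqAle cr andbT; apply/eqP => ce.
  have := mx a aa; rewrite /u ce er subrr md0 expr0n /= mulr0 addr0 => h1.
  have h2 : ln (m ^+ 2) <= ln (md (F c) ^+ 2).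
    by rewrite ler_ln ?posrE ?sq // ler_pXn2r ?nnegrE ?md_ge0 ?H // ltW.
  by move: h1 h2 L; clear; move: (ln _) (ln _) (ln _) => x y t; lra.
have d0 : 0 < r - md (c - a) by rewrite subr_gt0.
have [al [be Jc]] := J c cr.
have := jet_max d0 Jc (fun h hd => mx _ (ltW (interior_nbhd cr' hd))); lra.
Qed.

(* For [D = F'] and [G = 2 log (lambda o F)], the jet condition says that the metric
   [lambda(w) |dw|] pulled back by [F] has curvature at most [-2 k]. The maximum of
   [(r^2 - |z - z0|^2)^2 |D|^2 e^G] is interior, and there the Laplacian of its
   logarithm is nonpositive. *)
Theorem ahlfors D G z0 (r k : R) : cent D -> 0 < r -> 0 < k ->
  (forall w, md (w - z0) <= r -> rcont G w) ->
  (forall w, md (w - z0) < r -> D w != 0 ->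
     exists al be ka, jet G w al be ka /\ k * (md (D w) ^+ 2 * expR (G w)) <= ka) ->
  md (D z0) ^+ 2 * expR (G z0) <= 2 / (k * r ^+ 2).
Proof.
move=> eD r0 k0 cG H.
have rr : 0 < r ^+ 2 by rewrite exprn_gt0.
(* Up to a factor, the reciprocal of the hyperbolic density of the disc; it vanishes on the
   boundary, which forces the maximum of [P] inside. *)
pose q w := r ^+ 2 + (-1) * md (w - z0) ^+ 2.
pose S w := md (D w) ^+ 2 * expR (G w).
pose P w := (q w * q w) * S w.
have qJ w : jet q w (0 + cr (-1) * (2 * cj (w - z0))) (0 + cr (-1) * 0) (0 + (-1) * 1).
  exact: jetD (jet_cst (r ^+ 2) w) (jetZ (-1) (jet_sqdist z0 w)).
have [|c cler mx] := @ball_max R P z0 r (ltW r0).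
  move=> w /cG Gw; apply: rcontM; first by apply: rcontM; exact: jet_rcont (qJ w).
  apply: rcontM; first by apply: rcont_md2; have [l /cder_ccont] := eD w.
  by apply: rcont_comp Gw _; exact: continuous_expR.
have S0 w : 0 <= S w by rewrite mulr_ge0 ?sqr_ge0 ?expR_ge0.
have z0r : md (z0 - z0) <= r by rewrite subrr md0 ltW.
have qz0 : q z0 = r ^+ 2 by rewrite /q subrr md0 expr0n /= mulr0 addr0.
have := mx z0 z0r; rewrite -/(S z0) {1}/P qz0 => Pc.
have [S00|Sz] := eqVneq (S z0) 0.
  by rewrite S00; apply: divr_ge0 => //; apply: mulr_ge0; apply: ltW.
have {}Sz : 0 < S z0 by rewrite lt_def Sz S0.
have Pc0 : 0 < P c by apply: lt_le_trans Pc; apply: mulr_gt0 => //; apply: mulr_gt0.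
have qc0 : q c != 0 by apply/eqP => q0; move: Pc0; rewrite /P q0 !mul0r ltxx.
have Sc0 : S c != 0 by apply/eqP => q0; move: Pc0; rewrite /P q0 mulr0 ltxx.
have qpos w : md (w - z0) < r -> 0 < q w.
  move=> wr; rewrite /q mulN1r subr_gt0 ltr_pXn2r // nnegrE ?md_ge0 //; exact: ltW.
have cr' : md (c - z0) < r.
  rewrite lt_neqAle cler andbT; apply/eqP => ce; move/eqP: qc0; apply.
  by rewrite /q ce; ring.
have Dc : D c != 0.
  by apply: contra_neq Sc0 => Dc; rewrite /S Dc md0 expr0n /= mul0r.
have [al [be [ka [JG kaP]]]] := H c cr' Dc.
have [be1 JD] := jet_ln eD Dc.
have JQ := jet_comp (qJ c) (exp2_ln (qpos c cr')).
pose v w := 2 * ln (q w) + (ln (md (D w) ^+ 2) + G w).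
have Jv := jetD (jetZ 2 JQ) (jetD JD JG).
have [l /cder_ccont cD] := eD c.
have mDc : 0 < md (D c) by rewrite md_gt0.
have [d1 d10 D1] := cD _ mDc.
have d20 : 0 < r - md (c - z0) by rewrite subr_gt0.
have vE w : md (w - z0) < r -> D w != 0 -> v w = ln (P w).
  move=> wr Dw; have qw := qpos w wr; have Dw2 : 0 < md (D w) ^+ 2 by rewrite exprn_gt0 // md_gt0.
  have eG := expR_gt0 (G w).
  have e1 : ln (P w) = ln (q w * q w) + ln (S w) by apply: lnM; rewrite posrE; apply: mulr_gt0.
  have e2 : ln (q w * q w) = ln (q w) + ln (q w) by apply: lnM; rewrite posrE.
  have e3 : ln (S w) = ln (md (D w) ^+ 2) + ln (expR (G w)) by apply: lnM; rewrite posrE.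
  by rewrite e1 e2 e3 expRK /v; ring.
have m0 : 0 < Num.min d1 (r - md (c - z0)) by rewrite lt_min d10.
(* The share of [2 ln q] in [ka] is [-2/q - 2 |c - z0|^2 / q^2], which is [-2 r^2 / q^2] since
   [|c - z0|^2 = r^2 - q]. *)
have := jet_max m0 Jv _; set X := (X in X <= 0); have XE : X = - (2 * r ^+ 2 / (q c) ^+ 2) + ka.
  rewrite /X !add0r mulr1 [md (cr (-1) * _)]mdM md_cr normrN normr1 mul1r mdM md_cj md_nat.
  have E : md (c - z0) ^+ 2 = r ^+ 2 - q c by rewrite /q; ring.
  rewrite exprMn E; field; exact: qc0.
rewrite {}XE => Hmx.
have {}Hmx : ka <= 2 * r ^+ 2 / q c ^+ 2.
  suff : - (2 * r ^+ 2 / q c ^+ 2) + ka <= 0 by lra.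
  apply: Hmx => h; rewrite lt_min => /andP[h1 h2].
  have Dh : D (c + h) != 0.
    apply/eqP => Dh; have := D1 (c + h); rewrite Dh sub0r mdN ltxx.
    by rewrite (_ : c + h - c = h) ?h1 => [/(_ isT)|] //; ring.
  have ch := interior_nbhd cr' h2.
  change (v (c + h) <= v c); rewrite !vE // ler_ln ?posrE ?mx ?ltW //.
  rewrite /P /S; have := qpos _ ch => qh.
  by rewrite !mulr_gt0 ?expR_gt0 ?exprn_gt0 ?md_gt0.
have {}kaP : k * S c <= 2 * r ^+ 2 / q c ^+ 2 := le_trans kaP Hmx.
have q2 : 0 < q c ^+ 2 by rewrite exprn_gt0 // qpos.
rewrite ler_pdivlMr // -mulrA in kaP.
have PE : P c = S c * q c ^+ 2 by rewrite /P; ring.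
rewrite ler_pdivlMr ?mulr_gt0 //.
have : k * (r ^+ 2 * r ^+ 2 * S z0) <= 2 * r ^+ 2.
  by apply: le_trans kaP; rewrite ler_wpM2l ?(ltW k0) // -PE.
rewrite (_ : k * _ = r ^+ 2 * (S z0 * (k * r ^+ 2))); last by ring.
by rewrite [2 * _]mulrC ler_pM2l.
Qed.

(** The derivative of [u] along the segment is [re (al h)], so [|al|] is the length of the gradient
    and the real mean value theorem applies. *)
Lemma jet_lip u z h (L : R) : 
  (forall t : R, 0 <= t <= 1 -> exists al be ka, jet u (z + cr t * h) al be ka /\ md al <= L) ->
  `|u (z + h) - u z| <= L * md h.
Proof.
move=> H; have h0 := md_ge0 h.
have D (t : R) : exists al, 0 <= t <= 1 -> rder (fun t => u (z + cr t * h)) t (re (al * h)) /\ md al <= L.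
  have [t01|nt] := boolP (0 <= t <= 1); last by exists 0.
  have [al [be [ka [J aL]]]] := H t t01; exists al => _; split=> // e e0.
  have [d d0 dP] := J 1 ltr01.
  set K := (md be + `|ka| + 1) * md h ^+ 2.
  have K0 : 0 <= K.
    by rewrite mulr_ge0 ?sqr_ge0 //; have := md_ge0 be; have := normr_ge0 ka; lra.
  have [d1 d10 D1] := small_mul K0 e0; have [d2 d20 D2] := small_mul h0 (divr_gt0 d0 (ltr0Sn R 1)).
  have [d3 d30 [e1 e2 _]] := min3 d10 d20 ltr01.
  exists d3 => // s s3; have s0 := normr_ge0 s.
  have sh : md (cr s * h) = `|s| * md h by rewrite mdM md_cr.
  have : md (cr s * h) < d.
    rewrite sh mulrC; have : md h * `|s| <= md h * d2 by rewrite ler_wpM2l //; lra.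
    lra.
  move=> /dP; rewrite (_ : z + cr t * h + cr s * h = z + cr (t + s) * h); last first.
    by rewrite crD; ring.
  rewrite (_ : re (al * (cr s * h)) = re (al * h) * s); last by rewrite !reimE /=; ring.
  set W := u _ - u _; set Y := re (be * _); rewrite sh exprMn mul1r => p.
  have y1 : `|Y| <= md be * (`|s| ^+ 2 * md h ^+ 2).
    by apply: le_trans (ler_re_md _) _; rewrite mdM mdX sh exprMn.
  set Z := ka * _ in p *.
  have z1 : `|Z| <= `|ka| * (`|s| ^+ 2 * md h ^+ 2).
    by rewrite normrM ler_wpM2l // ger0_norm // mulr_ge0 ?sqr_ge0.
  have tri1 := ler_normD (W - (re (al * h) * s + Y + Z)) (Y + Z).
  have tri2 := ler_normD Y Z.
  have k1 : K * `|s| * `|s| <= e * `|s|.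
    rewrite ler_wpM2r //; apply: le_trans D1; rewrite ler_wpM2l //; lra.
  have k2 : K * `|s| * `|s| = (md be + `|ka| + 1) * (`|s| ^+ 2 * md h ^+ 2) by rewrite /K; ring.
  rewrite (_ : W - _ = W - (re (al * h) * s + Y + Z) + (Y + Z)); last by ring.
  by move: p y1 z1 tri1 tri2 k1 k2; clear; move: (`|s| ^+ 2 * _) => ss; lra.
have /choice [al Hal] := D.
have [t t01|c c01] := @rMVT R (fun t => u (z + cr t * h)) (fun t => re (al t * h)) 0 1 ler01.
  by have [] := Hal t t01.
rewrite cr1 cr0 mul1r mul0r addr0 subr0 mulr1 => ->.
apply: le_trans (ler_re_md _) _; rewrite mdM ler_wpM2r //.
by have [] := Hal c c01.
Qed.

End Ahlfors.

(** * Normal families omitting two values *)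

Section Marty.
Variable R : realType.
Local Notation C := (Cplx R).
Local Notation re := (@complex.Re R).
Local Notation im := (@complex.Im R).
Implicit Types (a z h w : C) (al be : C) (ka : R).
Implicit Types F : C -> C.

(** The larger variable dominates: [1 + T <= 1 + S <= 3 S], and 81 is [3^4]. *)
Lemma two_values_aux (T S : R) : 0 < T -> T <= S -> 1 / 2 <= S ->
  (1 + T) * (1 + S) / 81 <= S ^+ 4 / (1 + T) ^+ 2.
Proof.
move=> T0 TS S1; have S3 : 1 + S <= 3 * S by lra.
rewrite ler_pdivlMr; last by rewrite exprn_gt0 //; lra.
have a1 : (1 + T) ^+ 3 <= (1 + S) ^+ 3 by rewrite ler_pXn2r ?nnegrE //; lra.
have a2 : (1 + S) ^+ 4 <= (3 * S) ^+ 4 by rewrite ler_pXn2r ?nnegrE //; lra.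
have a3 : (1 + S) * (1 + T) ^+ 3 <= (1 + S) * (1 + S) ^+ 3.
  by rewrite ler_wpM2l //; lra.
rewrite -exprS in a3.
rewrite (_ : (1 + T) * (1 + S) / 81 * (1 + T) ^+ 2 = (1 + S) * (1 + T) ^+ 3 / 81); last by field.
rewrite ler_pdivrMr //; apply: le_trans a3 (le_trans a2 _).
by rewrite le_eqVlt; apply/orP; left; apply/eqP; ring.
Qed.

(** What negative curvature of the metric below amounts to, with [T = |w|^(2/5)] and
    [S = |w - 1|^(2/5)]. *)
Lemma two_values (T S : R) : 0 < T -> 0 < S -> 1 / 2 <= T \/ 1 / 2 <= S ->
  (1 + T) * (1 + S) / 81 <= S ^+ 4 / (1 + T) ^+ 2 + T ^+ 4 / (1 + S) ^+ 2.
Proof.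
move=> T0 S0 H.
have p1 : 0 <= S ^+ 4 / (1 + T) ^+ 2 by rewrite divr_ge0 // exprn_ge0 //; lra.
have p2 : 0 <= T ^+ 4 / (1 + S) ^+ 2 by rewrite divr_ge0 // exprn_ge0 //; lra.
have [TS|ST] := leP T S.
  have := two_values_aux T0 TS; case: H => ? /(_ _) h.
    have /h : 1 / 2 <= S by lra.
    by lra.
  by have := h ltac:(done); lra.
have := two_values_aux S0 (ltW ST); rewrite [(1 + S) * _]mulrC.
case: H => ? h; first by have := h ltac:(done); lra.
have /h : 1 / 2 <= T by lra.
by lra.
Qed.

(* [exp (phi (log |w|^2) + phi (log |w - 1|^2)) |dw|^2] is a metric on C minus {0, 1},
   of curvature bounded above by a negative constant (a variant of Robinson's). *)
Definition phi (x : R) := ln (1 + expR (x / 5)) - 4 / 5 * x.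
Definition phi1 (x : R) := 1 / 5 * expR (x / 5) / (1 + expR (x / 5)) - 4 / 5.
Definition phi2 (x : R) := 1 / 25 * expR (x / 5) / (1 + expR (x / 5)) ^+ 2.

Lemma der_expR5 (x : R) : is_derive x 1 (fun x => 1 + expR (x / 5)) (expR (x / 5) / 5).
Proof.
have D1 : is_derive x 1 (fun x : R => x / 5) (1 / 5).
  by apply: is_derive_eq; rewrite /GRing.scale /=; ring.
have D2 := @is_derive1_comp R (@expR R) _ x _ _ (is_derive_expR _) D1.
by apply: is_derive_eq; rewrite /GRing.scale /=; ring.
Qed.

Lemma exp2_phi (x : R) : exp2 phi x (phi1 x) (phi2 x).
Proof.
apply: (@exp2_der R phi phi1 x (phi2 x) 1 ltr01).
- move=> y _; apply/rder_is_derive; rewrite /phi /phi1.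
  have E0 := expR_gt0 (y / 5); have E1 : 0 < 1 + expR (y / 5) by lra.
  have D2 := @is_derive1_comp R (@ln R) _ y _ _ (is_derive1_ln E1) (der_expR5 y).
  apply: is_derive_eq; rewrite /GRing.scale /=; field.
  by rewrite gt_eqF.
- apply/rder_is_derive; rewrite /phi1 /phi2.
  have E0 := expR_gt0 (x / 5); have E1 : 1 + expR (x / 5) != 0 by rewrite gt_eqF //; lra.
  have D1 := der_expR5 x.
  have D2 := @is_deriveV R _ x _ 1 E1 D1.
  have -> : (fun x => 1 / 5 * expR (x / 5) / (1 + expR (x / 5)) - 4 / 5) =
      (fun x : R => - (1 / 5) * (1 + expR (x / 5))^-1 - 3 / 5).
    apply/funext => y; field; have := expR_gt0 (y / 5) => ?; rewrite gt_eqF //; lra.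
  by apply: is_derive_eq; rewrite /GRing.scale /=; field.
Qed.

Lemma centB F (c : C) : cent F -> cent (fun w => F w - c).
Proof. by move=> eF w; have [l H] := eF w; exists (l - 0); apply: cderB H (cder_cst _ _). Qed.

Lemma centM F (c : C) : cent F -> cent (fun w => c * F w).
Proof. by move=> eF w; have [l H] := eF w; eexists; apply: cderM (cder_cst _ _) H. Qed.

Lemma dvE F w l : cder F w l -> dv F w = l.
Proof. by move=> H; rewrite /dv; case: xgetP => [y _ /cder_unique|/(_ l)//]; apply. Qed.

Lemma dvB F (c : C) w : cent F -> dv (fun w => F w - c) w = dv F w.
Proof. by move=> eF; rewrite -[RHS]subr0; apply: dvE; apply: cderB (dvP eF w) (cder_cst _ _). Qed.

Lemma dvM F (c : C) w : cent F -> dv (fun w => c * F w) w = c * dv F w.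
Proof.
move=> eF; rewrite -[RHS]add0r -[X in X + _](mul0r (F w)); apply: dvE.
exact: cderM (cder_cst _ _) (dvP eF w).
Qed.

Lemma root5 (X : R) : 0 < X -> expR (ln X / 5) ^+ 5 = X.
Proof. by move=> X0; rewrite -expRM_natl -[5%:R * _](_ : ln X = _) ?lnK ?posrE //; field. Qed.

(** If both roots were below 1/2, then [|w|] and [|w - 1|] would be below 1/2 as well, but they add
    up to at least 1. *)
Lemma fifth_root_large (t s : R) (w : C) : 0 < t -> 0 < s ->
  t ^+ 5 = md w ^+ 2 -> s ^+ 5 = md (w - 1) ^+ 2 -> 1 / 2 <= t \/ 1 / 2 <= s.
Proof.
move=> t0 s0 tw sw.
have f x m : 0 < x -> 0 <= m -> x ^+ 5 = m ^+ 2 -> x < 1 / 2 -> m < 1 / 2 :> R.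
  move=> x0 m0 E x1; have x2 : x ^+ 5 <= x ^+ 2 by rewrite ler_wiXn2l //; lra.
  have x3 : x ^+ 2 < 1 / 4 by rewrite expr2; nra.
  by have := le_lt_trans x2 x3; rewrite E expr2; nra.
have [h|h] := leP (1 / 2) t; first by left.
have [h'|h'] := leP (1 / 2) s; first by right.
have := f _ _ t0 (md_ge0 _) tw h; have := f _ _ s0 (md_ge0 _) sw h'.
have := ler_mdD w (- (w - 1)).
by rewrite mdN (_ : w - (w - 1) = 1) ?md1; [lra|ring].
Qed.

(** [ahlfors] bounds [|F'|] in the metric of the doubly punctured plane, and this metric is bounded
    below by a multiple of the spherical one. *)
Lemma marty01 F z (r : R) : cent F -> 0 < r ->
  (forall w, md (w - z) <= r -> F w != 0 /\ F w != 1) ->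
  md (dv F z) ^+ 2 <= 16900 / r ^+ 2 * (1 + md (F z) ^+ 2) ^+ 2.
Proof.
move=> eF r0 om.
have rr : 0 < r ^+ 2 by rewrite exprn_gt0.
pose G w := phi (ln (md (F w) ^+ 2)) + phi (ln (md (F w - 1) ^+ 2)).
have eF1 := centB 1 eF.
pose T w := expR (ln (md (F w) ^+ 2) / 5); pose S w := expR (ln (md (F w - 1) ^+ 2) / 5).
have T0 w : 0 < T w by apply: expR_gt0.
have S0 w : 0 < S w by apply: expR_gt0.
have X0 w : md (w - z) <= r -> 0 < md (F w) ^+ 2 /\ 0 < md (F w - 1) ^+ 2.
  by move=> /om [f0 f1]; rewrite !exprn_gt0 // md_gt0 // subr_eq0.
have TX w : md (w - z) <= r -> T w ^+ 5 = md (F w) ^+ 2 by move=> /X0 [? _]; apply: root5.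
have SY w : md (w - z) <= r -> S w ^+ 5 = md (F w - 1) ^+ 2 by move=> /X0 [_ ?]; apply: root5.
have J w : md (w - z) <= r -> exists al be, jet G w al be
    (md (dv F w) ^+ 2 * (1 / 25 * (T w / (1 + T w) ^+ 2 / T w ^+ 5 + S w / (1 + S w) ^+ 2 / S w ^+ 5))).
  move=> wr; have [f0 f1] := om w wr; have f10 : F w - 1 != 0 by rewrite subr_eq0.
  have [b1 J1] := jet_ln eF f0; have [b2 J2] := jet_ln eF1 f10.
  have J1' := jet_comp J1 (exp2_phi _); have J2' := jet_comp J2 (exp2_phi _).
  eexists; eexists; apply: (jet_eq (jetD J1' J2') erefl erefl).
  rewrite (TX w wr) (SY w wr) dvB // !mulr0 !add0r /phi2 -/(T w) -/(S w).
  have m1 : md (F w) != 0 by rewrite md_eq0.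
  have m2 : md (F w - 1) != 0 by rewrite md_eq0.
  rewrite !mdM !mdV !md_nat; field; rewrite m1 m2 /=.
  by rewrite !gt_eqF //; have := T0 w; have := S0 w; lra.
have eG w : expR (G w) = (1 + T w) * (1 + S w) / (T w ^+ 4 * S w ^+ 4).
  rewrite /G /phi expRD !expRD -/(T w) -/(S w).
  have p1 := T0 w; have p2 := S0 w.
  rewrite !lnK ?posrE; [|by lra|by lra].
  have q x : expR (- (4 / 5 * x)) = (expR (x / 5) ^+ 4)^-1.
    by rewrite -expRM_natl -expRN; congr expR; field.
  by rewrite !q -/(T w) -/(S w); field; rewrite !gt_eqF.
(* 2025 = 25 * 81: the 25 comes from [phi2], the 81 from [two_values]. *)
have k0 : 0 < (1 / 2025 : R) by lra.
have c1 w : md (w - z) <= r -> rcont G w.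
  by move=> wr; have [al [be /jet_rcont]] := J w wr.
have c2 w : md (w - z) < r -> dv F w != 0 -> exists al be ka, jet G w al be ka /\
    1 / 2025 * (md (dv F w) ^+ 2 * expR (G w)) <= ka.
  move=> /ltW wr _.
  have [al [be JG]] := J w wr; exists al, be; eexists; split; first exact: JG.
  rewrite eG; have p1 := T0 w; have p2 := S0 w.
  have TS : 1 / 2 <= T w \/ 1 / 2 <= S w.
    exact: fifth_root_large p1 p2 (TX w wr) (SY w wr).
  have := two_values p1 p2 TS.
  move: (T w) (S w) p1 p2 => t s p1 p2 tv.
  rewrite mulrCA ler_wpM2l ?sqr_ge0 //.
  have ts0 : 0 < 1 / 25 / (t ^+ 4 * s ^+ 4) by rewrite !divr_gt0 // mulr_gt0 // exprn_gt0.
  rewrite (_ : 1 / 25 * _ = (1 / 25 / (t ^+ 4 * s ^+ 4)) * (s ^+ 4 / (1 + t) ^+ 2 + t ^+ 4 / (1 + s) ^+ 2)).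
    rewrite (_ : 1 / 2025 * _ = (1 / 25 / (t ^+ 4 * s ^+ 4)) * ((1 + t) * (1 + s) / 81)).
      by rewrite ler_pM2l.
    by field; rewrite !gt_eqF.
  by field; rewrite !gt_eqF //; lra.
have := @ahlfors R (dv F) G z r (1 / 2025) (cent_dv eF) r0 k0 c1 c2.
have zr : md (z - z) <= r by rewrite subrr md0 ltW.
rewrite eG; have p1 := T0 z; have p2 := S0 z; have TXz := TX z zr; have SYz := SY z zr.
have Yb : md (F z - 1) ^+ 2 <= 2 * md (F z) ^+ 2 + 2.
  have := ler_mdD (F z) (- 1); rewrite mdN md1 => h.
  have h0 := md_ge0 (F z - 1); have := sqr_ge0 (md (F z) - 1).
  have : md (F z - 1) ^+ 2 <= (md (F z) + 1) ^+ 2 by rewrite ler_pXn2r // nnegrE //; lra.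
  rewrite !expr2; lra.
(* Removes the fifth roots: [T^4 / (1 + T) <= 1 + |F|^2], and likewise for [S]. *)
have f x : 0 < x -> x ^+ 4 <= (1 + x) * (1 + x ^+ 5) :> R.
  move=> x0; have [x1|x1] := leP x 1.
    have : x ^+ 4 <= 1 by rewrite exprn_ile1 // ltW.
    have x5 : 0 < x ^+ 5 by rewrite exprn_gt0.
    nra.
  have : x ^+ 4 <= x ^+ 5 by rewrite ler_eXn2l // ltW.
  have x5 : 0 < x ^+ 5 by rewrite exprn_gt0.
  nra.
have := f _ p1; have := f _ p2; rewrite TXz SYz.
move: (T z) (S z) p1 p2 (md (F z) ^+ 2) (md (F z - 1) ^+ 2) (sqr_ge0 (md (F z)))
  (sqr_ge0 (md (F z - 1))) (md (dv F z) ^+ 2) (sqr_ge0 (md (dv F z))) Yb.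
move=> t s t0 s0 X Y X1 Y1 D D0 YX sY tX H.
have ts0 : 0 < t ^+ 4 * s ^+ 4 by rewrite mulr_gt0 // exprn_gt0.
have ts1 : 0 < (1 + t) * (1 + s) by rewrite mulr_gt0 //; clear -t0 s0; lra.
have {}H : D * ((1 + t) * (1 + s)) <= 4050 / r ^+ 2 * (t ^+ 4 * s ^+ 4).
  rewrite -ler_pdivrMr //; apply: le_trans (le_trans _ H) _.
    by rewrite [D * (_ / _)]mulrA lexx.
  by rewrite le_eqVlt; apply/orP; left; apply/eqP; field; rewrite gt_eqF.
have rp : 0 < 4050 / r ^+ 2 by apply: divr_gt0; [rewrite ltr0n|].
(* 4050 is [2 * 2025]. From [1 + Y <= 3 + 2 X] the factor 3 would suffice; 338/81 makes the product
   the square of 130. *)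
have -> : 16900 / r ^+ 2 = 338 / 81 * (4050 / r ^+ 2) by field; rewrite gt_eqF.
move: (4050 / r ^+ 2) rp H => K rp H.
have : D * ((1 + t) * (1 + s)) <= (K * ((1 + X) * (1 + Y))) * ((1 + t) * (1 + s)).
  apply: le_trans H _; rewrite -[X in _ <= X]mulrA ler_pM2l //.
  rewrite (_ : (1 + X) * (1 + Y) * ((1 + t) * (1 + s)) =
    ((1 + t) * (1 + X)) * ((1 + s) * (1 + Y))); last by ring.
  by rewrite ler_pM // exprn_ge0 // ltW.
rewrite ler_pM2r // => /le_trans; apply.
rewrite (_ : 338 / 81 * K * _ = K * ((1 + X) * (338 / 81 * (1 + X)))); last by ring.
rewrite ler_pM2l // ler_wpM2l //; clear -X1 YX; lra.
Qed.

(** The affine map taking [a], [b] to 0, 1 reduces this to [marty01]. [K] is chosen before [a] and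
    [b], so different members of a family may omit different pairs. *)
Lemma marty (r B d : R) : 0 < r -> 0 < B -> 0 < d -> exists2 K : R, 0 < K &
  forall F (a b z : C), cent F -> md a <= B -> md b <= B -> d <= md (a - b) ->
    (forall w, md (w - z) <= r -> F w != a /\ F w != b) ->
    md (dv F z) <= K * (1 + md (F z) ^+ 2).
Proof.
move=> r0 B0 d0; pose K1 := 1 + 2 * B ^+ 2 / d ^+ 2 + 2 / d ^+ 2.
have d2 : 0 < d ^+ 2 by rewrite exprn_gt0.
have k1 : 0 < 2 / d ^+ 2 by rewrite divr_gt0.
have k2 : 0 < 2 * B ^+ 2 / d ^+ 2 by rewrite divr_gt0 // mulr_gt0 // exprn_gt0.
have K10 : 0 < K1 by rewrite /K1; lra.
exists (2 * B * (130 / r) * K1).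
  by rewrite !mulr_gt0 // invr_gt0.
move=> F a b z eF aB bB ab om.
have ab0 : b - a != 0 by rewrite -md_gt0 mdB; apply: lt_le_trans ab.
pose E w := (b - a)^-1 * (F w - a).
have eE : cent E := centM _ (centB a eF).
have omE w : md (w - z) <= r -> E w != 0 /\ E w != 1.
  move=> /om [Fa Fb]; split; first by rewrite mulf_neq0 ?invr_eq0 // subr_eq0.
  apply: contra_neq Fb => E1; have : (b - a) * E w = b - a by rewrite E1 mulr1.
  by rewrite /E mulVKf // => /(congr1 (fun x => x + a)); rewrite !subrK.
have := marty01 eE r0 omE; rewrite /E dvM ?dvB //; last exact: centB.
have dba : d <= md (b - a) by rewrite mdB.
have m0 : 0 < md (b - a) by rewrite md_gt0.
have Eb : 1 + md ((b - a)^-1 * (F z - a)) ^+ 2 <= K1 * (1 + md (F z) ^+ 2).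
  rewrite mdM mdV exprMn.
  have h1 : md (F z - a) ^+ 2 <= 2 * (md (F z) ^+ 2 + B ^+ 2).
    have h := ler_mdD (F z) (- a); rewrite mdN in h.
    have h' : md (F z - a) ^+ 2 <= (md (F z) + B) ^+ 2.
      by rewrite ler_pXn2r ?nnegrE ?md_ge0 ?addr_ge0 ?md_ge0 ?(ltW B0) //; lra.
    by have := sqr_ge0 (md (F z) - B); move: h'; rewrite !expr2; lra.
  have h2 : (md (b - a))^-1 ^+ 2 <= d ^- 2.
    by rewrite -exprVn ler_pXn2r ?nnegrE ?invr_ge0 ?md_ge0 ?(ltW d0) // lef_pV2.
  have h3 : (md (b - a))^-1 ^+ 2 * md (F z - a) ^+ 2 <= d ^- 2 * (2 * (md (F z) ^+ 2 + B ^+ 2)).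
    by rewrite ler_pM // sqr_ge0.
  have X0 := sqr_ge0 (md (F z)).
  rewrite (_ : K1 * _ = 1 + md (F z) ^+ 2 + d ^- 2 * (2 * (md (F z) ^+ 2 + B ^+ 2)) +
    2 / d ^+ 2 + 2 * B ^+ 2 / d ^+ 2 * md (F z) ^+ 2); last first.
    by rewrite /K1; field; rewrite gt_eqF.
  have := mulr_ge0 (ltW k2) X0; lra.
rewrite mdM mdV => H.
have H2 : ((md (b - a))^-1 * md (dv F z)) <= 130 / r * (K1 * (1 + md (F z) ^+ 2)).
  have p1 : 0 <= (md (b - a))^-1 * md (dv F z) by rewrite mulr_ge0 ?invr_ge0 ?md_ge0.
  have p2 : 0 <= K1 * (1 + md (F z) ^+ 2).
    by apply: mulr_ge0; [exact: ltW | exact: addr_ge0 ler01 (sqr_ge0 _)].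
  have p3 : 0 <= 130 / r by apply: divr_ge0; [rewrite ler0n|exact: ltW].
  have p4 : 0 <= 130 / r * (K1 * (1 + md (F z) ^+ 2)) by apply: mulr_ge0.
  rewrite -(@ler_pXn2r _ 2) // ?nnegrE //.
  apply: le_trans H _; rewrite exprMn.
  have -> : (130 / r) ^+ 2 = 16900 / r ^+ 2 by field; rewrite gt_eqF.
  apply: ler_wpM2l; first by apply: divr_ge0; [rewrite ler0n|rewrite sqr_ge0].
  have p5 : 0 <= 1 + md ((b - a)^-1 * (F z - a)) ^+ 2.
    by have := sqr_ge0 (md ((b - a)^-1 * (F z - a))); lra.
  by rewrite ler_pXn2r ?nnegrE.
have b2 : md (b - a) <= 2 * B.
  by apply: le_trans (ler_mdD _ _) _; rewrite mdN; clear -aB bB; lra.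
have H3 : md (dv F z) <= 130 / r * (K1 * (1 + md (F z) ^+ 2)) * md (b - a).
  by rewrite -ler_pdivrMr //; apply: le_trans H2; rewrite [_ / md (b - a)]mulrC lexx.
apply: le_trans H3 _.
have p : 0 <= 130 / r * (K1 * (1 + md (F z) ^+ 2)).
  apply: mulr_ge0; first by apply: divr_ge0; [rewrite ler0n|exact: ltW].
  by apply: mulr_ge0; [exact: ltW | exact: addr_ge0 ler01 (sqr_ge0 _)].
apply: (@le_trans _ _ (130 / r * (K1 * (1 + md (F z) ^+ 2)) * (2 * B))).
  by rewrite ler_wpM2l.
by rewrite le_eqVlt; apply/orP; left; apply/eqP; ring.
Qed.

End Marty.

(** * Consequences of a bound on the spherical derivative *)

Section Harnack.
Variable R : realType.
Local Notation C := (Cplx R).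
Local Notation re := (@complex.Re R).
Local Notation im := (@complex.Im R).
Implicit Types (a z h w : C) (al be : C) (ka : R).
Implicit Types F : C -> C.

(** A bound for the spherical derivative, up to normalisation. *)
Definition marty_on F (K : R) z (r : R) :=
  forall w, md (w - z) <= r -> md (dv F w) <= K * (1 + md (F w) ^+ 2).

Lemma exp2_inv1 (x : R) : 0 <= x ->
  exp2 (fun y => (1 + y)^-1) x (- (1 + x) ^- 2) (2 / (1 + x) ^+ 3).
Proof.
move=> x0; have ne (y : R) : `|y - x| < 1 -> 1 + y != 0.
  by rewrite ltr_norml => /andP[h1 h2]; rewrite gt_eqF //; lra.
have D (y : R) : is_derive y 1 (fun y : R => 1 + y) 1.
  by apply: is_derive_eq; rewrite ?/GRing.scale /=; ring.
apply: (@exp2_der R _ (fun y => - (1 + y) ^- 2) x _ 1 ltr01).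
  move=> y /ne y0; apply/rder_is_derive.
  have := @is_deriveV R _ y _ 1 y0 (D y); rewrite /GRing.scale /= mulr1 //.
apply/rder_is_derive; have x1 : 1 + x != 0 by rewrite gt_eqF //; lra.
have x2 : (1 + x) ^+ 2 != 0 by rewrite expf_eq0.
have D2 : is_derive x 1 (fun y : R => (1 + y) ^+ 2) (2 * (1 + x)).
  by apply: is_derive_eq; rewrite /GRing.scale /=; ring.
have D3 := @is_deriveV R _ x _ 1 x2 D2.
by apply: is_derive_eq; rewrite /GRing.scale /=; field.
Qed.

(** On the Riemann sphere [1 / (1 + |w|^2)] is a smooth height. Its gradient along [F] is at most
    [2 |F| |F'| / (1 + |F|^2)^2], hence at most [K], because [2 |F| <= 1 + |F|^2]. *)
Lemma marty_psi F K z h : cent F -> marty_on F K z (md h) ->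
  `|(1 + md (F (z + h)) ^+ 2)^-1 - (1 + md (F z) ^+ 2)^-1| <= K * md h.
Proof.
move=> eF mF; apply: (@jet_lip R (fun w => (1 + md (F w) ^+ 2)^-1)) => t t01.
set w := z + cr t * h; have [c Hc] := cent_dv eF w.
have J := jet_comp (jet_sqnorm (dvP eF) Hc) (exp2_inv1 (sqr_ge0 (md (F w)))).
eexists; eexists; eexists; split; first exact: J.
rewrite mdM md_cr normrN mdM [md (2 * _)]mdM md_cj md_nat.
set X := md (F w); have X0 : 0 <= X := md_ge0 _.
have X1 : 0 < 1 + X ^+ 2 by have := sqr_ge0 X; lra.
have Y2 : 0 < (1 + X ^+ 2) ^+ 2 by rewrite exprn_gt0.
have i0 : 0 <= (1 + X ^+ 2) ^- 2 by rewrite invr_ge0 ltW.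
rewrite ger0_norm // mulrC ler_pdivrMr //.
have {}mF : md (dv F w) <= K * (1 + X ^+ 2).
  apply: mF; rewrite (_ : w - z = cr t * h); last by rewrite /w; ring.
  by rewrite mdM md_cr ger0_norm; [have := md_ge0 h; nra|lra].
have X2 : 2 * X <= 1 + X ^+ 2 by have := sqr_ge0 (X - 1); rewrite !expr2; lra.
rewrite [(1 + X ^+ 2) ^+ 2]expr2 mulrA [K * _ * _]mulrC.
by rewrite ler_pM // ?mulr_ge0 // md_ge0.
Qed.

(** At [x = log |w|^2] this is the logarithm of the squared density of [|dw| / (|w| log |w|^2)]. *)
Definition lam (x : R) := - x - 2 * ln x.

Lemma exp2_lam (x : R) : 0 < x -> exp2 lam x (- 1 - 2 / x) (2 / x ^+ 2).
Proof.
move=> x0; apply: (@exp2_der R lam (fun x => - 1 - 2 / x) x _ x x0).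
  move=> y yx; have y0 : 0 < y by move: yx; rewrite ltr_norml => /andP[]; lra.
  apply/rder_is_derive; have D := is_derive1_ln y0.
  by apply: is_derive_eq; rewrite /GRing.scale /=; ring.
apply/rder_is_derive; have x1 : x != 0 by rewrite gt_eqF.
have D := @is_deriveV R _ x _ 1 x1 (is_derive_id x (1 : R)).
by apply: is_derive_eq; rewrite /GRing.scale /=; field.
Qed.

(* The complete metric [|dw| / (|w| log |w|)] on the exterior of the unit disc. *)
Lemma log_metric F z (r : R) : cent F -> 0 < r ->
  (forall w, md (w - z) <= r -> 1 < md (F w) ^+ 2) ->
  md (dv F z) <= md (F z) * ln (md (F z) ^+ 2) / r.
Proof.
move=> eF r0 big.
have nz w : md (w - z) <= r -> F w != 0.
  by move=> /big h; apply: contraTneq h => ->; rewrite md0 expr0n /= -leNgt ler01.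
pose u w := ln (md (F w) ^+ 2).
have u0 w : md (w - z) <= r -> 0 < u w by move=> /big; apply: ln_gt0.
have J w : md (w - z) <= r -> exists al be, jet (fun w => lam (u w)) w al be
    (2 * (md (dv F w) ^+ 2 / (md (F w) ^+ 2 * u w ^+ 2))).
  move=> wr; have [be J1] := jet_ln eF (nz w wr).
  have J2 := jet_comp J1 (exp2_lam (u0 w wr)).
  eexists; eexists; apply: (jet_eq J2 erefl erefl).
  have m1 : md (F w) != 0 by rewrite md_eq0 nz.
  rewrite !mdM mdV md_nat -/(u w); field; rewrite m1 /=.
  by rewrite gt_eqF ?u0.
have eG w : md (w - z) <= r -> expR (lam (u w)) = (md (F w) ^+ 2 * u w ^+ 2)^-1.
  move=> wr; have uw := u0 w wr; rewrite /lam expRD !expRN.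
  rewrite (_ : 2 * ln (u w) = ln (u w) + ln (u w)); last by ring.
  rewrite expRD lnK ?posrE // {1}/u lnK ?posrE ?invfM ?expr2 //.
  by apply: lt_trans (big w wr).
have c1 w : md (w - z) <= r -> rcont (fun w => lam (u w)) w.
  by move=> wr; have [al [be /jet_rcont]] := J w wr.
have c2 w : md (w - z) < r -> dv F w != 0 -> exists al be ka,
    jet (fun w => lam (u w)) w al be ka /\ 2 * (md (dv F w) ^+ 2 * expR (lam (u w))) <= ka.
  move=> /ltW wr _; have [al [be JG]] := J w wr; exists al, be; eexists; split; first exact: JG.
  by rewrite eG.
have := ahlfors (cent_dv eF) r0 (ltr0Sn R 1) c1 c2.
have zr : md (z - z) <= r by rewrite subrr md0 ltW.
have m1 : 0 < md (F z) by rewrite md_gt0 nz.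
have uz := u0 z zr.
rewrite eG // -exprMn ler_pdivrMr ?exprn_gt0 ?mulr_gt0 //.
rewrite -/(u z) (_ : 2 / (2 * r ^+ 2) * _ = (md (F z) * u z / r) ^+ 2).
  rewrite ler_pXn2r ?nnegrE ?md_ge0 //.
  by apply: divr_ge0; [apply: mulr_ge0; apply: ltW | apply: ltW].
by field; rewrite gt_eqF.
Qed.

(* The point is that [rho] does not depend on [M]: [loglog |F|^2] is Lipschitz
   wherever [|F|] is large. *)
Lemma harnack (K r : R) : 0 < K -> 0 < r -> exists rho : R, 0 < rho <= r /\
  forall M : R, exists M', forall F z, cent F -> marty_on F K z r -> M' <= md (F z) ->
    forall w, md (w - z) <= rho -> M <= md (F w).
Proof.
move=> K0 r0.
have [e e0 eP] := small_mul (ltW K0) (ltr01 : 0 < (1 : R)).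
(* Then [K r1 <= 1/8]: by [marty_psi] the height [1 / (1 + |F|^2)], at most 1/8 at [z], stays at
   most 1/4 on the disc, that is [|F|^2 >= 3]. *)
pose r1 := Num.min r (e / 8).
have r10 : 0 < r1 by rewrite lt_min r0 divr_gt0.
have r1r : r1 <= r by rewrite ge_min lexx.
have r1e : r1 <= e / 8 by rewrite ge_min lexx orbT.
exists (r1 / 2); split; first by apply/andP; split; lra.
move=> M; pose M1 := `|M| + 2.
have M10 : 2 <= M1 by rewrite /M1; have := normr_ge0 M; lra.
(* On the disc of radius [r1 / 2], [loglog |F|^2] falls by at most [(4 / r1) (r1 / 2) = 2], so
   [log |F|^2] loses at most a factor [exp 2], compensated here in advance. *)
pose M2 := expR (expR 2 * ln (M1 ^+ 2)).
exists (M2 + 3) => F z eF mF big.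
have M20 : 0 < M2 by apply: expR_gt0.
have Fz : 7 <= md (F z) ^+ 2 by rewrite expr2; nra.
have out w : md (w - z) <= r1 -> 3 <= md (F w) ^+ 2.
  move=> wr; have := @marty_psi F K z (w - z) eF _.
  rewrite (_ : z + (w - z) = w); last by ring.
  move=> H; have {}H : `|(1 + md (F w) ^+ 2)^-1 - (1 + md (F z) ^+ 2)^-1| <= K * md (w - z).
    by apply: H => x xr; apply: mF; lra.
  have h1 : K * md (w - z) <= 1 / 8.
    have : K * md (w - z) <= K * (e / 8) by rewrite ler_wpM2l ?(ltW K0) //; lra.
    lra.
  have h2 : (1 + md (F z) ^+ 2)^-1 <= 1 / 8.
    by rewrite mul1r lef_pV2 ?posrE; lra.
  have h3 : (1 + md (F w) ^+ 2)^-1 <= 4^-1.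
    by move: H; rewrite ler_norml => /andP[_]; lra.
  have p : 0 < 1 + md (F w) ^+ 2 by have := sqr_ge0 (md (F w)); lra.
  by move: h3; rewrite lef_pV2 ?posrE //; lra.
have out1 w : md (w - z) <= r1 -> 0 < ln (md (F w) ^+ 2).
  by move=> /out h; apply: ln_gt0; lra.
(* The gradient [2 |F'| / (|F| log |F|^2)] is at most [4 / r1], by [log_metric] on discs of radius
   [r1 / 2]. *)
have L w : md (w - z) <= r1 / 2 -> `|ln (ln (md (F w) ^+ 2)) - ln (ln (md (F z) ^+ 2))| <= 4 / r1 * md (w - z).
  move=> wr; rewrite -[in F w](_ : z + (w - z) = w); last by ring.
  apply: (@jet_lip R (fun w => ln (ln (md (F w) ^+ 2)))) => t t01.
  set x := z + cr t * (w - z).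
  have xz : md (x - z) <= r1 / 2.
    rewrite (_ : x - z = cr t * (w - z)); last by rewrite /x; ring.
    by rewrite mdM md_cr ger0_norm; [have := md_ge0 (w - z); nra|lra].
  have xz1 : md (x - z) <= r1 by lra.
  have x0 : F x != 0.
    by have := out x xz1; apply: contraTneq => ->; rewrite md0 expr0n /= -ltNge; lra.
  have [be J1] := jet_ln eF x0.
  have J2 := jet_comp J1 (exp2_ln (out1 x xz1)).
  eexists; eexists; eexists; split; first exact: J2.
  have ux := out1 x xz1; have m0 : 0 < md (F x) by rewrite md_gt0.
  have r20 : 0 < r1 / 2 by lra.
  have := @log_metric F x (r1 / 2) eF r20.
  move=> H; have {}H : md (dv F x) <= md (F x) * ln (md (F x) ^+ 2) / (r1 / 2).
    apply: H => y yx; have yz : md (y - z) <= r1 by have := md_tri y x z; lra.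
    by have := out y yz; lra.
  rewrite mdM md_cr !mdM mdV md_nat ger0_norm ?invr_ge0 ?(ltW ux) //.
  rewrite mulrC ler_pdivrMr // ler_pdivrMr //.
  rewrite (_ : 4 / r1 * _ * _ = 2 * (md (F x) * ln (md (F x) ^+ 2) / (r1 / 2))).
    by rewrite ler_pM2l.
  by field; rewrite gt_eqF.
move=> w wr; have wr1 : md (w - z) <= r1 by lra.
have zr1 : md (z - z) <= r1 by rewrite subrr md0 ltW.
have := L w wr; set A := ln (ln (md (F w) ^+ 2)); set B := ln (ln (md (F z) ^+ 2)).
have : 4 / r1 * md (w - z) <= 2.
  rewrite mulrAC ler_pdivrMr //; lra.
rewrite ler_norml => h1 /andP[h2 _].
have AB : B - 2 <= A by lra.
have uw := out1 w wr1; have uz := out1 z zr1.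
have e1 : expR (-2) * ln (md (F z) ^+ 2) <= ln (md (F w) ^+ 2).
  rewrite -[X in _ * X]lnK ?posrE // -[X in _ <= X]lnK ?posrE // -expRD ler_expR -/A -/B; lra.
have e2 : expR 2 * ln (M1 ^+ 2) <= ln (md (F z) ^+ 2).
  rewrite -[X in X <= _]expRK ler_ln ?posrE ?expR_gt0 ?exprn_gt0 //; last first.
    by apply: lt_le_trans big; lra.
  by rewrite -/M2 expr2; nra.
have e3 : ln (M1 ^+ 2) <= ln (md (F w) ^+ 2).
  apply: le_trans e1; rewrite -[X in X <= _](_ : expR (-2) * (expR 2 * ln (M1 ^+ 2)) = _).
    by rewrite ler_wpM2l // expR_ge0.
  by rewrite mulrA -expRD (_ : -2 + 2 = 0) ?expR0 ?mul1r //; ring.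
have : M1 <= md (F w).
  have M1p : 0 < M1 by lra.
  have wp : 0 < md (F w) ^+ 2 by have := out w wr1; lra.
  have M2p : 0 < M1 ^+ 2 by rewrite exprn_gt0.
  move: e3; rewrite ler_ln ?posrE // => h; rewrite -(@ler_pXn2r _ 2) ?nnegrE ?md_ge0 //.
  exact: ltW.
by apply: le_trans; rewrite /M1; have := ler_norm M; lra.
Qed.

(** The contrapositive of [harnack] with centre [w]: a huge value at [w] would force a large one at
    [z]. Halving [r] keeps the disc about [w] inside the one about [z]. *)
Lemma harnack_bound (K r : R) : 0 < K -> 0 < r -> exists rho : R, 0 < rho <= r /\
  forall M : R, exists M', forall F z, cent F -> marty_on F K z r -> md (F z) <= M ->
    forall w, md (w - z) <= rho -> md (F w) <= M'.
Proof.
move=> K0 r0; have r20 : 0 < r / 2 by lra.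
have [rho [/andP[rho0 rhor] H]] := harnack K0 r20.
exists rho; split; first by apply/andP; split; lra.
move=> M; have [M' HM] := H (M + 1); exists M' => F z eF mF Fz w wz.
rewrite leNgt; apply/negP => /ltW big.
have mw : marty_on F K w (r / 2).
  by move=> x xw; apply: mF; have := md_tri x w z; lra.
have := HM F w eF mw big z; rewrite mdB => /(_ wz); lra.
Qed.

End Harnack.

(** * Subsequences as infinite index sets, and a criterion for normality *)

Definition infset (S : nat -> Prop) := forall N : nat, exists n, (N <= n)%N /\ S n.

Lemma infset_enum S : infset S -> exists psi : nat -> nat,
  (forall i, (psi i < psi i.+1)%N) /\ forall i, S (psi i).
Proof.
move=> iS; have /choice [nx Hn] := iS.
pose psi := fix psi i := if i is j.+1 then nx (psi j).+1 else nx 0%N.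
by exists psi; split=> [i|[|i]] /=; [have [] := Hn (psi i).+1|have [] := Hn 0%N|
  have [] := Hn (psi i).+1].
Qed.

Lemma infset_color (T : finType) (c : nat -> T) S : infset S ->
  exists t, infset (fun n => S n /\ c n = t).
Proof.
move=> iS; apply: contrapT => H.
have /choice [b Hb] : forall t, exists N, forall n, (N <= n)%N -> ~ (S n /\ c n = t).
  move=> t; apply: contrapT => H1; apply: H; exists t => N; apply: contrapT => H2.
  by apply: H1; exists N => n Nn H3; apply: H2; exists n.
have [n [bn Sn]] := iS (\max_t b t)%N.
by apply: (Hb (c n) n) => //; apply: leq_trans bn; apply: leq_bigmax.
Qed.

(** Repeated thinning yields nested infinite sets [T j]; the diagonal picks [phi i] in [T i], so
    from index [j] on it runs inside [T j]. *)
Lemma diag_extract (S : nat -> Prop) (P : nat -> nat -> nat -> Prop) : infset S ->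
  (forall j S, infset S -> exists S' : nat -> Prop, [/\ infset S', (forall n, S' n -> S n) &
     forall k l, S' k -> S' l -> P j k l]) ->
  exists phi : nat -> nat, [/\ (forall i, (phi i < phi i.+1)%N), (forall i, S (phi i)) &
    forall j k l, (j <= k)%N -> (j <= l)%N -> P j (phi k) (phi l)].
Proof.
move=> iS step.
have /choice [F HF] : forall p : nat * (nat -> Prop), exists S' : nat -> Prop,
    infset p.2 -> [/\ infset S', (forall n, S' n -> p.2 n) & forall k l, S' k -> S' l -> P p.1 k l].
  move=> [j S0]; have [i0|n0] := pselect (infset S0); last by exists S0.
  by have [S' H] := step j S0 i0; exists S'.
pose T := fix T j := if j is i.+1 then F (i.+1, T i) else F (0%N, S).
have iT j : infset (T j).
  elim: j => [|j IH]; first by have [] := HF (0%N, S) iS.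
  by have [] := HF (j.+1, T j) IH.
have TP j k l : T j k -> T j l -> P j k l.
  case: j => [|j]; first by have [_ _] := HF (0%N, S) iS; apply.
  by have [_ _] := HF (j.+1, T j) (iT j); apply.
have sub i j n : (i <= j)%N -> T j n -> T i n.
  elim: j => [|j IH]; first by rewrite leqn0 => /eqP ->.
  rewrite leq_eqVlt => /predU1P[-> //|ij] Tn; apply: IH => //.
  by have [_ h _] := HF (j.+1, T j) (iT j); apply: h.
have T0S n : T 0%N n -> S n by have [_ h _] := HF (0%N, S) iS; apply: h.
have /choice [nx Hn] : forall p : nat * nat, exists n, (p.1 <= n)%N /\ T p.2 n.
  by move=> [N j]; apply: (iT j N).
pose phi := fix phi i := if i is j.+1 then nx ((phi j).+1, j.+1) else nx (0, 0)%N.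
have Tphi i : T i (phi i).
  by case: i => [|i] /=; [have [_] := Hn (0, 0)%N|have [_] := Hn ((phi i).+1, i.+1)].
exists phi; split=> [i|i|j k l jk jl].
- by have [] := Hn ((phi i).+1, i.+1).
- by apply: T0S; apply: sub (Tphi i).
- by apply: TP; apply: sub (Tphi _).
Qed.

Section Normal.
Variable R : realType.
Local Notation C := (Cplx R).
Implicit Types (a z w : C).
Implicit Types F : C -> C.

Lemma ball_net a (r e : R) : 0 < e -> exists s : seq C,
  forall w, md (w - a) <= r -> exists2 c, c \in s & md (w - c) < e.
Proof.
move=> e0; have := @compact_cball R a r; rewrite compact_cover => /(_ C setT
  (fun c => [set w | md (w - c) < e])) [].
- by move=> c _; apply: open_disc.
- by move=> w _; exists w => //=; rewrite subrr md0.
move=> D' _ H; exists (finmap.enum_fset D') => w /H [c /= cD wc].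
by exists c.
Qed.

(* Arzela-Ascoli by pigeonhole on the values, up to [e], on a finite net. *)
Lemma equilip_extract (G : nat -> C -> C) a (r L M : R) (S : nat -> Prop) : 0 < L ->
  infset S ->
  (forall k, S k -> forall w, md (w - a) < r -> md (G k w) <= M) ->
  (forall k, S k -> forall w x, md (w - a) < r -> md (x - a) < r ->
     md (G k w - G k x) <= L * md (w - x)) ->
  exists phi : nat -> nat, (forall i, (phi i < phi i.+1)%N) /\
    exists g : C -> C, forall e : R, 0 < e -> exists N : nat, forall k, (N <= k)%N ->
      forall w, md (w - a) < r -> md (G (phi k) w - g w) < e.
Proof.
move=> L0 iS bG lG.
pose P (j k l : nat) := S k -> S l -> forall w, md (w - a) < r -> md (G k w - G l w) <= j.+1%:R^-1.
have [|phi [ph1 ph2 ph3]] := @diag_extract S P iS.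
  move=> j S0 iS0.
  (* Between [G k w] and [G l w] lie four steps of size [e]: two along the Lipschitz bound, where
     [2 d L = e], and two to a common net point of the values. *)
  pose e : R := (4 * j.+1%:R)^-1; have e0 : 0 < e by rewrite invr_gt0 mulr_gt0.
  pose d := e / (2 * L); have d0 : 0 < d by rewrite divr_gt0 // mulr_gt0.
  have [s1 H1] := @ball_net a r d d0; have [s2 H2] := @ball_net 0 M e e0.
  (* A centre of [s1] need not lie in the disc: pick a point of the disc near it. *)
  have /choice [p Hp] : forall c : C, exists x, (exists2 w, md (w - a) < r & md (w - c) < d) ->
      md (x - a) < r /\ md (x - c) < d.
    move=> c; have [[w w1 w2]|n] := pselect (exists2 w, md (w - a) < r & md (w - c) < d).
      by exists w.
    by exists 0.
  have /choice [v Hv] : forall y : C, exists c, md y <= M -> c \in s2 /\ md (y - c) < e.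
    move=> y; have [yM|n] := pselect (md y <= M); last by exists 0.
    by have [|c cs yc] := H2 y; [rewrite subr0|exists c].
  (* The colour of [k] records, for each point of the net in the disc, the net point next to its
     value; only finitely many colours exist. *)
  pose col k : {ffun 'I_(size s1) -> 'I_(size s2).+1} :=
    [ffun i : 'I_(size s1) => inord (index (v (G k (p s1`_i))) s2)].
  have [t it] := infset_color col iS0.
  exists (fun n => S0 n /\ col n = t); split=> //; first by move=> n [].
  move=> k l [_ kt] [_ lt] Sk Sl w wr.
  have [c cs wc] := H1 w (ltW wr).
  have [pr pc] : md (p c - a) < r /\ md (p c - c) < d by apply: Hp; exists w.
  have ic : (index c s1 < size s1)%N by rewrite index_mem.
  have := congr1 (fun q : {ffun 'I_(size s1) -> 'I_(size s2).+1} => q (Ordinal ic)) (etrans kt (esym lt)).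
  rewrite !ffunE /= nth_index // => /(congr1 (@nat_of_ord _)).
  have [vk1 vk2] := Hv _ (bG k Sk _ pr); have [vl1 vl2] := Hv _ (bG l Sl _ pr).
  rewrite !inordK ?ltnS ?index_size // => E.
  have {}E : v (G k (p c)) = v (G l (p c)).
    by rewrite -(nth_index 0 vk1) E nth_index.
  have wp : md (w - p c) < 2 * d.
    by have := md_tri w c (p c); rewrite (mdB c); lra.
  have Lw : L * md (w - p c) <= e.
    have : L * md (w - p c) <= L * (2 * d) by rewrite ler_wpM2l ?(ltW L0) // ltW.
    by rewrite (_ : L * (2 * d) = e) //; rewrite /d; field; rewrite gt_eqF.
  have lk := lG k Sk _ _ wr pr; have ll := lG l Sl _ _ wr pr.
  have t1 := md_tri (G k w) (G k (p c)) (G l w).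
  have t2 := md_tri (G k (p c)) (G l (p c)) (G l w).
  have t3 := md_tri (G k (p c)) (v (G k (p c))) (G l (p c)).
  have t4 : md (v (G k (p c)) - G l (p c)) < e by rewrite E mdB.
  have t5 : md (G l (p c) - G l w) <= L * md (w - p c) by rewrite mdB.
  have <- : 4 * e = j.+1%:R^-1 by rewrite /e invfM mulrA divff ?mul1r.
  by clear -lk Lw t1 t2 t3 t4 t5 vk2; lra.
exists phi; split=> //.
have /choice [g Hg] : forall w, exists y, md (w - a) < r -> forall j k, (j <= k)%N ->
    md (G (phi k) w - y) <= j.+1%:R^-1.
  move=> w; have [wr|nw] := pselect (md (w - a) < r); last by exists 0.
  have [|y _ Hy] := @compact_seq R _ (fun k => G (phi k) w) (@compact_cball R 0 M).
    by move=> k /=; rewrite subr0; apply: bG (ph2 k) _ wr.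
  exists y => _ j k jk; apply/ler_addgt0Pr => e e0.
  have [n jn /= ny] := Hy e j e0.
  have h3 : md (G (phi k) w - G (phi n) w) <= j.+1%:R^-1 := ph3 j k n jk jn (ph2 k) (ph2 n) w wr.
  have h4 := md_tri (G (phi k) w) (G (phi n) w) y.
  apply: le_trans h4 _; exact: lerD h3 (ltW ny).
exists g => e e0; have [N HN] : exists N : nat, N.+1%:R^-1 < e.
  exists (Num.bound e^-1); rewrite -[X in _ < X]invrK ltf_pV2 ?posrE ?invr_gt0 //.
  apply: lt_trans (archi_boundP _) _; first by rewrite invr_ge0 ltW.
  by rewrite ltr_nat.
by exists N => k Nk w wr; apply: le_lt_trans (Hg w wr N k Nk) HN.
Qed.

(** If the values at the centre stay bounded along a subsequence, [harnack_bound] makes that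
    subsequence bounded and equi-Lipschitz; otherwise they tend to infinity, and [harnack] makes
    this uniform. [rho] precedes [G], as one neighbourhood must serve all subsequences of a
    family. *)
Lemma normal_crit (K r : R) : 0 < K -> 0 < r -> exists2 rho : R, 0 < rho &
  forall (G : nat -> C -> C) z, (forall k, cent (G k)) -> (forall k, marty_on (G k) K z r) ->
  exists phi : nat -> nat, (forall i, (phi i < phi i.+1)%N) /\
    ((exists g, loc_unif_cvg (fun k => G (phi k)) g [set w | md (w - z) < rho]) \/
     loc_unif_to_infty (fun k => G (phi k)) [set w | md (w - z) < rho]).
Proof.
move=> K0 r0; have [r1 [/andP[r10 r1r] H1]] := harnack K0 r0.
have [r2 [/andP[r20 r2r] H2]] := harnack_bound K0 r0.
have [rho rho0 [rh1 rh2 _]] := min3 r10 r20 ltr01.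
exists rho => // G z eG mG.
have [[M iM]|nM] := pselect (exists M : R, infset (fun k => md (G k z) <= M)).
  have [M' HM] := H2 M.
  have bG k : md (G k z) <= M -> forall w, md (w - z) < rho -> md (G k w) <= M'.
    by move=> kM w wr; apply: (HM _ _ (eG k) (mG k) kM); lra.
  have L0 : 0 < K * (1 + M' ^+ 2) by rewrite mulr_gt0 //; have := sqr_ge0 M'; lra.
  have [] := @equilip_extract G z rho _ M' _ L0 iM bG.
    move=> k kM w x wr xr; have := @cder_lip R (G k) (dv (G k)) x (w - x) (K * (1 + M' ^+ 2)).
    rewrite (_ : x + (w - x) = w); last by ring.
    apply=> [t _|t t01]; first exact: dvP.
    have yr : md (x + cr t * (w - x) - z) < rho.
      rewrite (_ : _ - z = cr (1 - t) * (x - z) + cr t * (w - z)); last first.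
        by rewrite crD crN cr1; ring.
      apply: le_lt_trans (ler_mdD _ _) _; rewrite !mdM !md_cr !ger0_norm; [|lra|lra].
      pose m := Num.max (md (w - z)) (md (x - z)).
      have mr : m < rho by rewrite gt_max wr.
      have wm : md (w - z) <= m by rewrite le_max lexx.
      have xm : md (x - z) <= m by rewrite le_max lexx orbT.
      clearbody m; apply: le_lt_trans mr; nra.
    apply: le_trans (mG k _ _) _; first by lra.
    rewrite ler_pM2l // lerD2l ler_pXn2r ?nnegrE ?md_ge0 ?bG //.
    by apply: le_trans (md_ge0 _) (bG k kM _ yr).
  move=> phi [ph1 [g Hg]]; exists phi; split=> //; left; exists g => A _ AU e e0.
  have [N HN] := Hg e e0; exists N => k Nk w Aw; rewrite norm_md cr_lt; apply: HN => //.
  exact: AU.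
exists id; split=> //; right => A _ AU M.
have [M' HM] := H1 (M + 1).
have [N HN] : exists N : nat, forall k, (N <= k)%N -> M' <= md (G k z).
  apply: contrapT => H; apply: nM; exists M' => N; apply: contrapT => H3.
  apply: H; exists N => k Nk; rewrite leNgt; apply/negP => /ltW kM.
  by apply: H3; exists k.
exists N => k Nk w /AU /= wr; rewrite norm_md cr_lt.
have := HM (G k) z (eG k) (mG k) (HN k Nk) w; have h : md (w - z) <= r1 by lra.
by move=> /(_ h); lra.
Qed.

End Normal.

(** * The Fatou and Julia sets of an entire function *)

Section OpenMapping.
Variable R : realType.
Local Notation C := (Cplx R).
Implicit Types (a z w : C).
Implicit Types F H : C -> C.

Lemma cent_ccont F : cent F -> forall w, ccont_at F w.
Proof. by move=> eF w; have [l /cder_ccont] := eF w. Qed.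

Lemma cent_bound F a (r : R) : cent F -> exists M : R, forall w, md (w - a) <= r -> md (F w) <= M.
Proof.
move=> eF; have [r0|r0] := leP 0 r.
  have [|c _ mx] := @ball_max R (fun w => md (F w)) a r r0.
    by move=> w _; apply: rcont_md; apply: cent_ccont.
  by exists (md (F c)).
by exists 0 => w wr; have := md_ge0 (w - a); lra.
Qed.

(** The singularity of the quotient is removable: by Taylor's formula, [H] has at [a] half the
    second derivative of [F] as its derivative. *)
Lemma zero_factor F a : cent F -> F a = 0 -> exists2 H, cent H & forall w, F w = (w - a) * H w.
Proof.
move=> eF Fa; pose H w := if w == a then dv F a else F w / (w - a).
have HE w : F w = (w - a) * H w.
  rewrite /H; have [->|wa] := eqVneq w a; first by rewrite subrr mul0r.
  by rewrite mulrC divfK // subr_eq0.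
exists H => // w; have [->|wa] := eqVneq w a; last first.
  have wa0 : w - a != 0 by rewrite subr_eq0.
  have d0 : 0 < md (w - a) by rewrite md_gt0.
  have [l Hl] := eF w.
  have D := cderM Hl (cder_comp (cderB (cder_id w) (cder_cst a w)) (cder_inv wa0)).
  eexists; apply: (cder_near d0) D => x xw.
  by rewrite /H ifN //; apply: contraTneq xw => ->; rewrite mdB ltxx.
have [c Hc] := cent_dv eF a; exists (c / 2) => e e0.
have [d d0 dP] := taylor2 (dvP eF) Hc e0; exists d => // h hd.
have [->|h0] := eqVneq h 0; first by rewrite addr0 subrr mulr0 subr0 md0 mulr0.
have mh : 0 < md h by rewrite md_gt0.
have := dP h hd; rewrite Fa subr0 [F (a + h)]HE (_ : a + h - a = h); last by ring.
have Ha : H a = dv F a by rewrite /H eqxx.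
rewrite -Ha (_ : h * H (a + h) - _ - _ = h * (H (a + h) - H a - c / 2 * h)); last by ring.
by rewrite mdM expr2 mulrCA ler_pM2l.
Qed.

(* If every quotient of [F] by a power of [w - a] vanished at [a], the maximum
   principle would bound [F] by [M 2^-k] for all [k]. *)
Lemma zero_order F a : cent F -> (exists b, F b != 0) ->
  exists k H, [/\ cent H, H a != 0 & forall w, F w = (w - a) ^+ k * H w].
Proof.
move=> eF [b Fb]; apply: contrapT => nex.
have fac k : exists2 H, cent H & forall w, F w = (w - a) ^+ k * H w.
  elim: k => [|k [H eH HE]]; first by exists F => // w; rewrite mul1r.
  have [Ha|Ha] := eqVneq (H a) 0.
    have [H' eH' HE'] := zero_factor eH Ha; exists H' => // w.
    by rewrite HE HE' exprSr mulrA.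
  by exfalso; apply: nex; exists k, H.
have ba : b != a.
  apply: contra_neq Fb => ->; have [H _ ->] := fac 1%N.
  by rewrite subrr expr1 mul0r.
have ba0 : 0 < md (b - a) by rewrite md_gt0 subr_eq0.
(* On the circle of twice the distance [H] is at most [M / r^k]; back at [b], the ratio of the radii
   gives [2^-k]. *)
pose r := 2 * md (b - a); have r0 : 0 < r by rewrite mulr_gt0.
have [M HM] := cent_bound a r eF.
have M0 : 0 <= M by apply: le_trans (md_ge0 _) (HM a _); rewrite subrr md0 ltW.
have mF : 0 < md (F b) / (M + 1) by rewrite divr_gt0 ?md_gt0 //; lra.
have [k hk] := halves_lt mF; have [H eH HE] := fac k.
have rk : 0 < r ^+ k by rewrite exprn_gt0.
have Hb : md (H b) <= M / r ^+ k.
  apply: (@max_principle R H a r (M / r ^+ k)) => //.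
  - by rewrite divr_ge0 // ltW.
  - move=> w wr; rewrite ler_pdivlMr // mulrC -wr -mdX -mdM -HE; apply: HM; rewrite wr; exact: lexx.
  - by rewrite /r; lra.
have : md (F b) <= M * 2^-1 ^+ k.
  rewrite HE mdM mdX; apply: (@le_trans _ _ (md (b - a) ^+ k * (M / r ^+ k))).
    by rewrite ler_wpM2l ?exprn_ge0 ?md_ge0.
  rewrite /r exprMn exprVn le_eqVlt; apply/orP; left; apply/eqP.
  have x0 : md (b - a) ^+ k != 0 by rewrite expf_neq0 // gt_eqF.
  have y0 : (2 : R) ^+ k != 0 by rewrite expf_neq0 // pnatr_eq0.
  move: (md (b - a) ^+ k) (2 ^+ k) x0 y0 => x y x0 y0.
  by field; rewrite x0 y0.
move: hk; rewrite ltr_pdivlMr; last by lra.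
have : 0 < 2^-1 ^+ k :> R by rewrite exprn_gt0.
by move: (2^-1 ^+ k) => x; lra.
Qed.

(** By [zero_order], [|F w - F a|] is at least [|w - a|^k |H a| / 2] near [a]. *)
Lemma circle_sep F a : cent F -> (exists b, F b != F a) ->
  exists2 r0 : R, 0 < r0 & forall r, 0 < r < r0 -> exists2 m : R, 0 < m &
    forall w, md (w - a) = r -> m <= md (F w - F a).
Proof.
move=> eF [b Fb].
have [|k [H [eH Ha HE]]] := zero_order a (centB (F a) eF).
  by exists b; rewrite subr_eq0.
have h0 : 0 < md (H a) / 2 by rewrite divr_gt0 // md_gt0.
have [d d0 dP] := cent_ccont eH a h0.
exists d => // r /andP[r0 rd]; exists (r ^+ k * (md (H a) / 2)).
  by rewrite mulr_gt0 // exprn_gt0.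
move=> w wr; rewrite HE mdM mdX wr ler_pM2l ?exprn_gt0 //.
have := dP w; rewrite wr => /(_ rd); have := ler_mdB (H a) (H w).
by rewrite (mdB (H a)); lra.
Qed.

(** If [q] close to [F a] were omitted on a small disc, the minimum principle would carry the lower
    bound [m / 2] of [|F - q|] from the circle to the centre. *)
Lemma open_mapping F a (r : R) : cent F -> (exists b, F b != F a) -> 0 < r ->
  exists2 d : R, 0 < d & forall q, md (q - F a) < d -> exists2 w, md (w - a) <= r & F w = q.
Proof.
move=> eF nc r0; have [r1 r10 H] := circle_sep eF nc.
have r1' : 0 < r1 / 2 by lra.
have [s s0 [s1 s2 _]] := min3 r0 r1' ltr01.
have [|m m0 mP] := H s; first by apply/andP; split; lra.
exists (m / 2); first by lra.
move=> q qa; apply: contrapT => om.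
have : m / 2 <= md (F a - q).
  apply: (@min_principle R (fun w => F w - q) a s (m / 2)) => //; first exact: centB.
  - by lra.
  - move=> w ws; rewrite subr_eq0; apply/eqP => E; apply: om; exists w => //; lra.
  - move=> w /mP ms; have := md_tri (F w) q (F a); lra.
by rewrite mdB; lra.
Qed.

End OpenMapping.

Section FatouInvariance.
Variable R : realType.
Local Notation C := (Cplx R).
Implicit Types (a z w : C).
Variable f : C -> C.
Hypothesis ef : cent f.
Hypothesis nc : forall a, exists b, f b != f a.

Lemma cent_iter n : cent (iter n f).
Proof.
elim: n => [|n IH] w; first by exists 1; apply: cder_id.
have [l Hl] := IH w; have [m Hm] := ef (iter n f w).
by exists (m * l); apply: cder_comp Hl Hm.
Qed.

Lemma cent_continuous (F : C -> C) : cent F -> continuous F.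
Proof. by move=> eF; apply: continuous_ccont; apply: cent_ccont. Qed.

(** Values of iterates at [v] are values of the next iterates at a preimage [p v], chosen in one
    compact disc by the open mapping theorem. The limit [g (p v)] depends on this choice, but
    locally uniform convergence asks no regularity of it. *)
Lemma Fatou_image z : Fatou f z -> Fatou f (f z).
Proof.
move=> [U [oU Uz nU]].
have /open_md/(_ z Uz) [r1 r10 rU] := oU.
have r20 : 0 < r1 / 2 by lra.
have [d d0 dP] := open_mapping ef (nc z) r20.
exists [set w | md (w - f z) < d]; split; first exact: open_disc.
  by rewrite /= subrr md0.
move=> s; have [phi [ph H]] := nU (fun k => (s k).+1); exists phi; split=> //.
have /choice [p Hp] : forall v, exists w, md (v - f z) < d -> md (w - z) <= r1 / 2 /\ f w = v.
  move=> v; have [vd|nv] := pselect (md (v - f z) < d); last by exists 0.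
  by have [w wr wv] := dP v vd; exists w.
pose B : set C := [set w | md (w - z) <= r1 / 2].
have cB : compact B := @compact_cball R z _.
have BU : B `<=` U by move=> w wB; apply: rU; apply: le_lt_trans wB _; lra.
case: H => [[g Hg]|Hinf]; [left|right].
- exists (fun v => g (p v)) => A _ AV e e0; have [N HN] := Hg B cB BU e e0.
  exists N => k Nk v Av; have [pB pv] := Hp v (AV v Av).
  by have := HN k Nk (p v) pB; rewrite iterSr pv.
- move=> A _ AV M; have [N HN] := Hinf B cB BU M.
  exists N => k Nk v Av; have [pB pv] := Hp v (AV v Av).
  by have := HN k Nk (p v) pB; rewrite iterSr pv.
Qed.

(** Iterates at [w] are iterates at [f w] with one step less. Time 0 has no predecessor: if it
    recurs, a subsequence is constantly the identity; otherwise it is discarded by a shift. *)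
Lemma Fatou_preimage z : Fatou f (f z) -> Fatou f z.
Proof.
move=> [U [oU Uz nU]]; have cf := cent_continuous ef.
exists (f @^-1` U); split=> //; first by apply: open_comp => // w _; apply: cf.
move=> s; have [i0|n0] := pselect (infset (fun k => s k = 0%N)).
  have [phi [ph1 ph2]] := infset_enum i0; exists phi; split=> //; left; exists id.
  move=> A _ _ e e0; exists 0%N => k _ w _.
  by rewrite ph2 /= subrr normr0 cr_gt0.
have [N0 HN0] : exists N0, forall k, (N0 <= k)%N -> s k != 0%N.
  apply: contrapT => H; apply: n0 => N; apply: contrapT => H1; apply: H; exists N => k Nk.
  by apply/eqP => sk; apply: H1; exists k.
have [phi [ph H]] := nU (fun k => (s (k + N0)%N).-1).
exists (fun k => (phi k + N0)%N); split; first by move=> k; rewrite ltn_add2r.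
have E k w : iter (s (phi k + N0)%N) f w = iter (s (phi k + N0)%N).-1 f (f w).
  by rewrite -iterSr prednK // lt0n; apply: HN0; rewrite leq_addl.
have img A : compact A -> A `<=` f @^-1` U -> compact (f @` A) /\ f @` A `<=` U.
  move=> cA AU; split; last by move=> _ [w Aw <-]; exact: AU.
  by apply: continuous_compact => //; apply: continuous_subspaceT.
case: H => [[g Hg]|Hinf]; [left|right].
- exists (fun w => g (f w)) => A cA AU e e0; have [cfA fAU] := img A cA AU.
  have [N HN] := Hg _ cfA fAU e e0; exists N => k Nk w Aw.
  by rewrite E; apply: HN => //; exists w.
- move=> A cA AU M; have [cfA fAU] := img A cA AU.
  have [N HN] := Hinf _ cfA fAU M; exists N => k Nk w Aw.
  by rewrite E; apply: HN => //; exists w.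
Qed.

Lemma Julia_preimage z : Julia f (f z) -> Julia f z.
Proof. by move=> H Fz; apply: H; apply: Fatou_image. Qed.

Lemma Julia_image z : Julia f z -> Julia f (f z).
Proof. by move=> H Fz; apply: H; apply: Fatou_preimage. Qed.

Lemma Julia_preimage_iter n z : Julia f (iter n f z) -> Julia f z.
Proof. by elim: n => //= n IH /Julia_preimage /IH. Qed.

Lemma closed_Julia : closed (Julia f).
Proof.
rewrite /Julia closedC; apply/open_md => z [U [oU Uz nU]].
have /open_md/(_ z Uz) [d d0 dU] := oU.
by exists d => // w /dU Uw; exists U.
Qed.

(* The times [s] depend only on the size and the distance of the two sets. *)
Lemma Julia_cover z (r B d : R) : Julia f z -> 0 < r -> 0 < B -> 0 < d ->
  exists s : nat -> nat, forall D1 D2 : set C,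
    (forall w, D1 w -> md w <= B) -> (forall w, D2 w -> md w <= B) ->
    (forall v w, D1 v -> D2 w -> d <= md (v - w)) ->
    exists N : nat, forall k, (N <= k)%N ->
      D1 `<=` iter (s k) f @` [set w | md (w - z) <= r] \/
      D2 `<=` iter (s k) f @` [set w | md (w - z) <= r].
Proof.
move=> Jz r0 B0 d0; have r20 : 0 < r / 2 by lra.
have [K K0 HK] := marty r20 B0 d0.
have [rho rho0 HN] := normal_crit K0 r20.
(* A sequence of iterates no subsequence of which is normal on the disc of radius [rho]; it exists
   as [z] is not in the Fatou set. *)
have [s Hs] : exists s : nat -> nat, forall phi : nat -> nat,
    (forall i, (phi i < phi i.+1)%N) ->
    ~ ((exists g, loc_unif_cvg (fun k => iter (s (phi k)) f) g [set w | md (w - z) < rho]) \/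
       loc_unif_to_infty (fun k => iter (s (phi k)) f) [set w | md (w - z) < rho]).
  apply: contrapT => H; apply: Jz; exists [set w | md (w - z) < rho].
  split; [exact: open_disc|by rewrite /= subrr md0|].
  move=> s; apply: contrapT => H1; apply: H; exists s => phi ph H2.
  by apply: H1; exists phi.
exists s => D1 D2 D1B D2B D12; apply: contrapT => nN.
(* The times at which both sets are missed. Were there infinitely many, [marty] and [normal_crit]
   would extract a forbidden subsequence. *)
pose S k := exists a b, [/\ D1 a, D2 b & forall w, md (w - z) <= r ->
  iter (s k) f w != a /\ iter (s k) f w != b].
have iS : infset S.
  move=> N; apply: contrapT => H; apply: nN; exists N => k Nk.
  apply: contrapT => /not_orP [n1 n2]; apply: H; exists k; split=> //.
  have [a Da na] : exists2 a, D1 a & ~ (iter (s k) f @` [set w | md (w - z) <= r]) a.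
    by apply: contrapT => H; apply: n1 => a Da; apply: contrapT => na; apply: H; exists a.
  have [b Db nb] : exists2 b, D2 b & ~ (iter (s k) f @` [set w | md (w - z) <= r]) b.
    by apply: contrapT => H; apply: n2 => b Db; apply: contrapT => nb; apply: H; exists b.
  exists a, b; split=> // w wr; split; apply/eqP => E.
    by apply: na; exists w.
  by apply: nb; exists w.
have [psi [ps1 ps2]] := infset_enum iS.
have [||phi [ph H]] := HN (fun i => iter (s (psi i)) f) z.
- by move=> i; apply: cent_iter.
- move=> i w wr; have [a [b [Da Db om]]] := ps2 i.
  apply: (HK _ a b) => //; [exact: cent_iter|exact: D1B|exact: D2B|exact: D12|].
  by move=> x xw; apply: om; have := md_tri x w z; lra.
have psm i j : (i < j)%N -> (psi i < psi j)%N.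
  elim: j => // j IH; rewrite ltnS leq_eqVlt => /predU1P[->//|/IH ij].
  exact: ltn_trans ij (ps1 j).
by apply: (Hs (fun i => psi (phi i))) H => i; apply: psm.
Qed.

End FatouInvariance.

(** * Points of bounded orbit are not isolated in the Julia set *)

Section NotIsolated.
Variable R : realType.
Local Notation C := (Cplx R).
Local Notation re := (@complex.Re R).
Implicit Types (a z w : C).
Variable f : C -> C.
Hypothesis ef : cent f.
Hypothesis nc : forall a, exists b, f b != f a.

Lemma Fatou_image_iter n z : Fatou f z -> Fatou f (iter n f z).
Proof. by move=> Fz; elim: n => //= n IH; apply: Fatou_image. Qed.

(* A bounded family omits two common values. *)
Lemma bounded_Fatou a (r M : R) : 0 < r ->
  (forall n w, md (w - a) <= r -> md (iter n f w) <= M) -> Fatou f a.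
Proof.
move=> r0 H; have M0 : 0 <= M by apply: le_trans (md_ge0 _) (H 0%N a _); rewrite subrr md0 ltW.
have r20 : 0 < r / 2 by lra.
have B0 : 0 < M + 2 by lra.
have [K K0 HK] := marty r20 B0 ltr01.
have [rho rho0 HN] := normal_crit K0 r20.
exists [set w | md (w - a) < rho]; split; [exact: open_disc|by rewrite /= subrr md0|].
move=> s; apply: (HN (fun k => iter (s k) f) a) => [k|k w wr]; first exact: cent_iter.
apply: (HK _ (cr (M + 1)) (cr (M + 2))); first exact: cent_iter.
- by rewrite md_cr ger0_norm; lra.
- by rewrite md_cr ger0_norm; lra.
- by rewrite -crN -crD md_cr (_ : _ - _ = -1) ?normrN ?normr1 //; ring.
move=> x xw; have xr : md (x - a) <= r by have := md_tri x w a; lra.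
have := H (s k) x xr; split; apply/eqP => E.
  by move: (H (s k) x xr); rewrite E md_cr ger0_norm; lra.
by move: (H (s k) x xr); rewrite E md_cr ger0_norm; lra.
Qed.

(** A chord of the circle seen under at most a right angle stays at distance at least [c / sqrt 2]
    from the centre. *)
Lemma annulus_segment (y z : C) (c t : R) : 0 <= t <= 1 -> md y = c -> md z = c ->
  0 <= re (z * cj y) ->
  c ^+ 2 / 2 <= md (y + cr t * (z - y)) ^+ 2 /\ md (y + cr t * (z - y)) <= c.
Proof.
move=> t01 yc zc p; split.
  have -> : md (y + cr t * (z - y)) ^+ 2 =
      (1 - t) ^+ 2 * md y ^+ 2 + t ^+ 2 * md z ^+ 2 + 2 * t * (1 - t) * re (z * cj y).
    by rewrite !sqr_md !reimE /=; ring.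
  rewrite yc zc; have : 0 <= 2 * t * (1 - t) * re (z * cj y).
    by rewrite mulr_ge0 //; nra.
  have : 0 <= c ^+ 2 * ((1 - 2 * t) ^+ 2 / 2).
    by apply: mulr_ge0; [exact: sqr_ge0|apply: divr_ge0 => //; exact: sqr_ge0].
  rewrite !expr2; lra.
have -> : y + cr t * (z - y) = cr (1 - t) * y + cr t * z by rewrite crD crN cr1; ring.
apply: le_trans (ler_mdD _ _) _; rewrite !mdM !md_cr yc zc !ger0_norm; lra.
Qed.

(** If [a] were isolated, the iterates would omit [a] and [b] on a punctured disc. The bounded orbit
    of [a] and the minimum principle give each iterate a moderate value somewhere on a circle about
    [a]; Harnack chains spread it over the circle, the maximum principle over the disc, and [a]
    would be a Fatou point. *)
Lemma Julia_not_isolated a b (r : R) : Julia f a -> Julia f b -> b != a -> Kset f a -> 0 < r ->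
  exists c, [/\ Julia f c, c != a & md (c - a) < r].
Proof.
move=> Ja Jb ba [MK HMK] r0; apply: contrapT => iso.
have HMK' n : md (iter n f a) <= MK by have := HMK n; rewrite norm_md cr_le.
have inF w : 0 < md (w - a) -> md (w - a) < r -> Fatou f w.
  move=> w0 wr; apply: contrapT => Jw; apply: iso; exists w; split=> //.
  by rewrite -subr_eq0 -md_gt0.
have om n w : 0 < md (w - a) -> md (w - a) < r -> iter n f w != a /\ iter n f w != b.
  move=> w0 wr; have Fw := Fatou_image_iter n (inF w w0 wr).
  by split; apply/eqP => E; rewrite E in Fw.
pose c := r / 2; have c0 : 0 < c by rewrite /c; lra.
have c40 : 0 < c / 4 by lra.
pose B := md a + md b + 1.
have B0 : 0 < B by rewrite /B; have := md_ge0 a; have := md_ge0 b; lra.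
have aB : md a <= B by rewrite /B; have := md_ge0 b; lra.
have bB : md b <= B by rewrite /B; have := md_ge0 a; lra.
have dab : 0 < md (a - b) by rewrite md_gt0 subr_eq0 eq_sym.
have [K K0 HK] := marty c40 B0 dab.
have [rho [/andP[rho0 rhoc] HB]] := harnack_bound K0 c40.
(* The annulus in which chords stay. Discs of total radius [c/4 + c/4] about its points remain in
   the punctured disc: the distance to [a] exceeds [3c/5], as [(3/5)^2 < 1/2], and [r = 2c]. *)
pose good p := c ^+ 2 / 2 <= md (p - a) ^+ 2 /\ md (p - a) <= c.
have mgood n p : good p -> marty_on (iter n f) K p (c / 4).
  move=> [p1 p2] w wp; apply: (HK _ a b) => //; first exact: cent_iter.
  move=> x xw; have xp : md (x - p) <= c / 2 by have := md_tri x w p; lra.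
  have p3 : c * (3 / 5) < md (p - a).
    rewrite ltNge; apply/negP => h; have : md (p - a) ^+ 2 <= (c * (3 / 5)) ^+ 2.
      by rewrite ler_pXn2r ?nnegrE ?md_ge0 //; lra.
    have c2 : 0 < c ^+ 2 by rewrite exprn_gt0.
    by move: c2 p1; rewrite !expr2; lra.
  apply: om; first by have := md_tri p x a; rewrite (mdB p x); lra.
  by have := md_tri x p a; rewrite /c in p2 xp *; lra.
(* Each step of length at most [rho] replaces the bound through [harnack_bound]; the result depends
   on [m] and [M], not on the iterate or the path. *)
have chain (m : nat) M : exists M', forall n (p : nat -> C), (forall j, (j <= m)%N -> good (p j)) ->
    (forall j, (j < m)%N -> md (p j.+1 - p j) <= rho) -> md (iter n f (p 0%N)) <= M ->
    md (iter n f (p m)) <= M'.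
  elim: m => [|m [M1 IH]]; first by exists M.
  have [M' H'] := HB M1; exists M' => n p gp st p0.
  apply: (H' _ (p m)); [exact: cent_iter| |apply: IH => // j jm|].
  - by apply: mgood; apply: gp.
  - by apply: gp; apply: leqW.
  - by apply: st; apply: ltn_trans jm _.
  - by apply: st.
have [m mP] : exists m : nat, 2 * c < m.+1%:R * rho.
  exists (Num.bound (2 * c / rho)); rewrite -ltr_pdivrMr //.
  apply: lt_trans (archi_boundP _) _; first by apply: divr_ge0; lra.
  by rewrite ltr_nat.
have seg M : exists M', forall n y z, md (y - a) = c -> md (z - a) = c ->
    0 <= re ((z - a) * cj (y - a)) -> md (iter n f y) <= M -> md (iter n f z) <= M'.
  have [M' HM] := chain m.+1 M; exists M' => n y z yc zc p yM.
  have m0 : 0 < m.+1%:R :> R by rewrite ltr0n.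
  pose p' j : C := y + cr (j%:R / m.+1%:R) * (z - y).
  have pz : p' m.+1 = z by rewrite /p' divff ?gt_eqF // cr1; ring.
  rewrite -pz; apply: HM => [j jm|j jm|].
  - have := @annulus_segment (y - a) (z - a) c (j%:R / m.+1%:R).
    rewrite (_ : y - a + cr (j%:R / m.+1%:R) * (z - a - (y - a)) = p' j - a); last first.
      by rewrite /p'; ring.
    apply=> //; apply/andP; split; first by apply: divr_ge0; rewrite ler0n.
    by rewrite ler_pdivrMr // mul1r ler_nat.
  - rewrite /p' (_ : _ - _ = cr (1 / m.+1%:R) * (z - y)); last first.
      by rewrite -natr1 mulrDl crD; ring.
    rewrite mdM md_cr ger0_norm; last by apply: divr_ge0; rewrite ?ler0n.
    rewrite mul1r mulrC ler_pdivrMr //.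
    have := md_tri z a y; rewrite (mdB a y) mulrC; lra.
  - by rewrite /p' mul0r cr0 mul0r addr0.
(* A point [z] more than a right angle away from [y] is within a right angle of its antipode [v],
   which is reached through the quarter turn [x]. *)
have circ M : exists M', forall n y z, md (y - a) = c -> md (z - a) = c ->
    md (iter n f y) <= M -> md (iter n f z) <= M'.
  have [M1 H1] := seg M; have [M2 H2] := seg M1; have [M3 H3] := seg M2.
  exists (Num.max M1 M3) => n y z yc zc yM; rewrite le_max.
  have [p|p] := leP 0 (re ((z - a) * cj (y - a))); first by rewrite (H1 n y z).
  pose i : C := Complex 0 1; pose x := a + i * (y - a); pose v := a - (y - a).
  have mi : md i = 1 by rewrite md.unlock /= expr0n expr1n /= add0r sqrtr1.
  have xa : x - a = i * (y - a) by rewrite /x; ring.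
  have va : v - a = - (y - a) by rewrite /v; ring.
  have xc : md (x - a) = c by rewrite xa mdM mi mul1r.
  have vc : md (v - a) = c by rewrite va mdN.
  apply/orP; right; apply: (H3 n v z) => //.
    have reJ (X Y : C) : re (X * cj (- Y)) = - re (X * cj Y) by rewrite !reimE /= ?reimE; ring.
    by rewrite va reJ oppr_ge0 ltW.
  apply: (H2 n x v) => //.
    have reI (Y : C) : re (- Y * cj (Complex 0 1 * Y)) = 0 by rewrite !reimE /= ?reimE /=; ring.
    by rewrite va xa reI.
  apply: (H1 n y x) => //.
  have reI (Y : C) : re (Complex 0 1 * Y * cj Y) = 0 by rewrite !reimE /= ?reimE /=; ring.
  by rewrite xa reI.
have [M1 HM1] := circ (MK + 2 * B + 1).
have M10 : 0 <= Num.max 0 M1 by rewrite le_max lexx.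
apply: (Ja); apply: (@bounded_Fatou a c (Num.max 0 M1) c0) => n.
(* The minimum principle needs [f^n - q] without zeros on the whole disc, so [q] must also differ
   from the value at the centre; one of [a], [b] does. *)
have [q [qab qa]] : exists q, (q = a \/ q = b) /\ iter n f a != q.
  have [E|ne] := eqVneq (iter n f a) a; last by exists a; split; [left|].
  by exists b; split; [right|rewrite E eq_sym].
have qB : md q <= B by case: qab => ->.
have omq w : md (w - a) <= c -> iter n f w != q.
  move=> wc; have [->//|wa] := eqVneq w a.
  have [||h1 h2] := om n w; first by rewrite md_gt0 subr_eq0.
    by rewrite /c in wc; lra.
  by case: qab => ->.
(* Otherwise the minimum principle would give [|f^n a - q| + 1 <= |f^n a - q|]. *)
have [y yc yq] : exists2 y, md (y - a) = c & md (iter n f y - q) < md (iter n f a - q) + 1.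
  apply: contrapT => H; have p0 : 0 < md (iter n f a - q) + 1 by have := md_ge0 (iter n f a - q); lra.
  have : md (iter n f a - q) + 1 <= md (iter n f a - q); last by lra.
  apply: (@min_principle R (fun w => iter n f w - q) a c _ (centB q (cent_iter ef n)) c0 p0).
    by move=> w wc; rewrite subr_eq0; apply: omq.
  by move=> w wc; rewrite leNgt; apply/negP => h; apply: H; exists w.
have yM : md (iter n f y) <= MK + 2 * B + 1.
  have := ler_mdD (iter n f y - q) q; rewrite subrK.
  have := ler_mdD (iter n f a) (- q); rewrite mdN; have := HMK' n; lra.
apply: (max_principle (cent_iter ef n) c0 M10) => w wc.
by rewrite le_max (HM1 n y w yc wc yM) orbT.
Qed.

End NotIsolated.

(** * Itineraries *)

(** Cantor's diagonal: under injectivity [d] is true at [g d] exactly if it is false there. *)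
Lemma cantor_bool (g : (nat -> bool) -> nat) : ~ injective g.
Proof.
move=> gI; pose d n := `[< forall s, g s = n -> s n = false >].
case E : (d (g d)); first by have := asboolW E d erefl; rewrite E.
have : d (g d) by apply/asboolP => s /gI ->.
by rewrite E.
Qed.

Section Itineraries.
Variable R : realType.
Local Notation C := (Cplx R).
Implicit Types (a z w : C).
Variable f : C -> C.
Hypothesis ef : cent f.
Hypothesis nc : forall a, exists b, f b != f a.

(* A finite Markov system: from each disc [X], at the time [n X], the image covers
   one disc on each of the two sides. *)
Variables (X : finType) (c : X -> C) (rad : X -> R) (n : X -> nat) (nx : X -> bool -> X).
Let disc x : set C := [set w | md (w - c x) <= rad x].
Hypothesis rad0 : forall x, 0 < rad x.
Hypothesis Jc : forall x, Julia f (c x).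
Hypothesis n0 : forall x, (0 < n x)%N.
Hypothesis cover : forall x b, disc (nx x b) `<=` iter (n x) f @` disc x.

Fixpoint st (x : X) (s : nat -> bool) k : X :=
  if k is k'.+1 then st (nx x (s 0%N)) (fun i => s i.+1) k' else x.

Fixpoint tm (x : X) (s : nat -> bool) k : nat :=
  if k is k'.+1 then (tm (nx x (s 0%N)) (fun i => s i.+1) k' + n x)%N else 0%N.

Lemma st_tm_eq x s s' k : (forall i, (i < k)%N -> s i = s' i) ->
  st x s k = st x s' k /\ tm x s k = tm x s' k.
Proof.
elim: k x s s' => // k IH x s s' E /=; rewrite (E 0%N) //.
by have [|-> ->] := IH (nx x (s' 0%N)) (fun i => s i.+1) (fun i => s' i.+1);
  first by move=> i ik; apply: E.
Qed.

(** [st] and [tm] recurse at the front of the itinerary, which suits pulling points back. Comparing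
    itineraries needs the recursion at the end, where entry [s k] determines the passage to state
    [k.+1]. *)
Lemma stS x s k : st x s k.+1 = nx (st x s k) (s k).
Proof. by elim: k x s => // k IH x s; rewrite -[LHS]/(st _ _ k.+1) IH. Qed.

Lemma tmS x s k : tm x s k.+1 = (n (st x s k) + tm x s k)%N.
Proof.
elim: k x s => [|k IH] x s; first by rewrite /= add0n addn0.
by rewrite -[LHS]/(tm _ _ k.+1 + n x)%N IH /= addnA.
Qed.

(** Pulled back step by step from the centre of the last disc; preimages of Julia points are Julia
    points. *)
Lemma finite_itinerary m x s : exists z, Julia f z /\
  forall k, (k <= m)%N -> disc (st x s k) (iter (tm x s k) f z).
Proof.
elim: m x s => [|m IH] x s.
  exists (c x); split=> // k; rewrite leqn0 => /eqP -> /=.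
  by rewrite /disc /= subrr md0 ltW.
have [z' [Jz' H']] := IH (nx x (s 0%N)) (fun i => s i.+1).
have /cover [z dz zz'] : disc (nx x (s 0%N)) z' by apply: (H' 0%N).
exists z; split; first by apply: (Julia_preimage_iter ef nc (n := n x)); rewrite zz'.
case=> [|k] km //=; rewrite iterD zz'; exact: H'.
Qed.

(** A cluster point of the finite solutions: the discs and the Julia set are closed and the iterates
    continuous. *)
Lemma itinerary x s : exists z, Julia f z /\
  forall k, disc (st x s k) (iter (tm x s k) f z).
Proof.
have /choice [z Hz] := fun m => finite_itinerary m x s.
have [|y _ Hy] := compact_seq (@compact_cball R (c x) (rad x)) (x := z).
  by move=> m; have [_ /(_ 0%N)] := Hz m; apply.
exists y; split.
  have := closed_Julia (f := f); apply => N /nbhs_md [d d0 dP].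
  have [m _ zy] := Hy d 0%N d0; exists (z m); split; first by have [] := Hz m.
  exact: dP.
move=> k; rewrite /disc /= leNgt; apply/negP => H.
have e0 : 0 < md (iter (tm x s k) f y - c (st x s k)) - rad (st x s k) by rewrite subr_gt0.
have [d d0 dP] := cent_ccont (cent_iter ef (tm x s k)) y e0.
have [m km zy] := Hy d k d0; have := dP _ zy.
have [_ /(_ k km)] := Hz m; rewrite /disc /= => h1 h2.
have := md_tri (iter (tm x s k) f y) (iter (tm x s k) f (z m)) (c (st x s k)).
by rewrite (mdB (iter _ _ y) (iter _ _ (z m))); lra.
Qed.

(** Between two visits at most [n x] steps are made from a disc [x], so finitely many compact images
    contain the orbit. [n x > 0] lets the induction on the time progress. *)
Lemma itinerary_bounded : exists M : R, forall x s z,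
  (forall k, disc (st x s k) (iter (tm x s k) f z)) -> forall m, md (iter m f z) <= M.
Proof.
have /choice [B HB] : forall p : X * nat, exists M : R, forall w, disc p.1 w -> md (iter p.2 f w) <= M.
  by move=> [x m]; apply: cent_bound; apply: cent_iter.
pose M := \sum_(x : X) \sum_(j < (n x).+1) `|B (x, j : nat)|.
have HM x j w : (j <= n x)%N -> disc x w -> md (iter j f w) <= M.
  move=> jn wx; apply: le_trans (HB (x, j) w wx) _; apply: le_trans (ler_norm _) _.
  rewrite /M (bigD1 x) //= (bigD1 (Ordinal (n := (n x).+1) (m := j) jn)) //= -addrA lerDl.
  by rewrite addr_ge0 ?sumr_ge0 // => i _; rewrite sumr_ge0.
exists M => x s z H m; elim/ltn_ind: m x s z H => m IH x s z H.
have [mn|nm] := leqP m (n x); first exact: HM mn (H 0%N).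
rewrite -(subnK (ltnW nm)) iterD.
apply: (IH _ _ (nx x (s 0%N)) (fun i => s i.+1)); first by rewrite ltn_subrL n0 (leq_trans _ nm).
by move=> k; have := H k.+1; rewrite /= iterD.
Qed.

End Itineraries.

(** * From a separation to uncountably many components *)

Section Uncountable.
Variable R : realType.
Local Notation C := (Cplx R).
Implicit Types (a z w : C).
Variable f : C -> C.
Hypothesis ef : cent f.
Hypothesis nc : forall a, exists b, f b != f a.

(** Near [a] there are no points of [B], and non-isolation supplies [a2] there. An eighth of
    [|a2 - a|] as radius keeps the two discs apart and in that neighbourhood; a third of [|a - b|]
    later keeps the sides apart. *)
Lemma side_discs (A B E : set C) a b : separated A B -> E `<=` A `|` B -> A a ->
  Julia f a -> Julia f b -> b != a -> Kset f a ->
  exists a2 (r : R), [/\ 0 < r, Julia f a2, 4 * r < md (a2 - a), md (a2 - a) <= md (a - b) / 3 &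
   forall w, md (w - a) <= r \/ md (w - a2) <= r -> E w -> A w].
Proof.
move=> sAB EAB Aa Ja Jb ba Ka.
have [d d0 dP] : exists2 d : R, 0 < d & forall w, md (w - a) < d -> ~ B w.
  have nB : ~ closure B a by move=> cB; case: sAB => _ H; have : (A `&` closure B) a by []; rewrite H.
  apply: contrapT => H; apply: nB => N /nbhs_md [d d0 dP].
  apply: contrapT => H1; apply: H; exists d => // w wd Bw; apply: H1; exists w; split=> //.
  exact: dP.
have ab0 : 0 < md (a - b) by rewrite md_gt0 subr_eq0 eq_sym.
pose e := Num.min (d / 2) (md (a - b) / 3).
have e0 : 0 < e by rewrite lt_min !divr_gt0.
have ed : e <= d / 2 by rewrite ge_min lexx.
have eb : e <= md (a - b) / 3 by rewrite ge_min lexx orbT.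
have [a2 [Ja2 a2a a2e]] := Julia_not_isolated ef nc Ja Jb ba Ka e0.
have a20 : 0 < md (a2 - a) by rewrite md_gt0 subr_eq0.
exists a2, (md (a2 - a) / 8); split=> //; [lra|lra|lra|].
move=> w wr Ew; have wd : md (w - a) < d.
  by case: wr => wr; [lra|have := md_tri w a2 a; lra].
by case: (EAB w Ew) => // Bw; exfalso; apply: dP Bw.
Qed.

(** Itineraries inject into the components meeting [N]: at the first difference of two itineraries,
    one iterate sends their points to different sides, while it sends a component into a connected
    subset of [E]. *)
Lemma uncountable_components (E A B : set C) a b : Kset f `&` Julia f `<=` E ->
  (forall z, E z -> E (f z)) -> E = A `|` B -> separated A B ->
  A a -> B b -> Julia f a -> Julia f b -> Kset f a -> Kset f b ->
  uncountably_many_components_near E (Julia f).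
Proof.
move=> KJE fE EAB sAB Aa Bb Ja Jb Ka Kb w Jw N /nbhs_md [rN rN0 HN].
have dAB := separated_disjoint sAB.
have ba : b != a.
  by apply/eqP => ba; have : (A `&` B) b; [split=> //; rewrite ba|rewrite dAB].
have EAB1 : E `<=` A `|` B by rewrite EAB.
have EAB2 : E `<=` B `|` A by rewrite EAB setUC.
have [a2 [ra [ra0 Ja2 a2a a2b HA]]] := side_discs sAB EAB1 Aa Ja Jb ba Ka.
have sBA : separated B A by rewrite separatedC.
have ab : a != b by rewrite eq_sym.
have [b2 [rb [rb0 Jb2 b2b b2a HB]]] := side_discs sBA EAB2 Bb Jb Ja ab Kb.
(* [None] is the starting disc in [N]; in [Some (t, h)] the side is [t], and [h] tells its two discs
   apart. *)
pose ctr (x : option (bool * bool)) : C := match x with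
  | None => w | Some (true, false) => a | Some (true, true) => a2
  | Some (false, false) => b | Some (false, true) => b2 end.
pose r0 := Num.min (rN / 2) (Num.min ra rb).
have r00 : 0 < r0 by rewrite !lt_min ra0 rb0 divr_gt0.
have r0N : r0 <= rN / 2 by rewrite ge_min lexx.
have r0a : r0 <= ra by rewrite !ge_min lexx orbT.
have r0b : r0 <= rb by rewrite !ge_min lexx !orbT.
have r0N' : r0 < rN by lra.
clearbody r0.
have Jctr x : Julia f (ctr x) by case: x => [[[] []]|].
pose disc x : set C := [set v | md (v - ctr x) <= r0].
pose side (t : bool) := if t then A else B.
have discside t h v : disc (Some (t, h)) v -> E v -> side t v.
  by rewrite /disc /=; case: t h => [] [] /= vd; [apply: HA; right|apply: HA; left
    |apply: HB; right|apply: HB; left]; apply: le_trans vd _.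
pose M := md a + md a2 + md b + md b2 + r0.
have M0 : 0 < M by rewrite /M; have := md_ge0 a; have := md_ge0 a2; have := md_ge0 b;
  have := md_ge0 b2; lra.
have discM t h v : disc (Some (t, h)) v -> md v <= M.
  have ctrM : md (ctr (Some (t, h))) + r0 <= M.
    by rewrite /M; have := md_ge0 a; have := md_ge0 a2; have := md_ge0 b;
      have := md_ge0 b2; case: t h => [] [] /=; lra.
  by rewrite /disc /= => vd; have := ler_mdB v (ctr (Some (t, h))); lra.
have dsep t v v' : disc (Some (t, false)) v -> disc (Some (t, true)) v' -> r0 <= md (v - v').
  have cc : 4 * r0 < md (ctr (Some (t, true)) - ctr (Some (t, false))).
    by case: t => /=; lra.
  rewrite /disc /= => h1 h2.
  have t1 := md_tri (ctr (Some (t, true))) v' (ctr (Some (t, false))).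
  have t2 := md_tri v' v (ctr (Some (t, false))).
  by rewrite (mdB _ v') in t1; rewrite (mdB v' v) in t2; lra.
have far h h' : 2 * r0 < md (ctr (Some (true, h)) - ctr (Some (false, h'))).
  have t1 := md_tri a a2 b; have t2 := md_tri a b2 b; have t3 := md_tri a2 b2 b.
  have e1 := mdB a a2; have e2 := mdB b a.
  by case: h h' => [] [] /=; lra.
(* [Julia_cover] fixes the sequence of times before the sets, so one late term serves both pairs of
   discs. *)
have /choice [q Hq] : forall x, exists q : nat * (bool -> bool),
    forall t, disc (Some (t, q.2 t)) `<=` iter q.1 f @` disc x.
  move=> x; have [s Hs] := Julia_cover ef (Jctr x) r00 M0 r00.
  have [N1 H1] := Hs _ _ (@discM true false) (@discM true true) (@dsep true).
  have [N2 H2] := Hs _ _ (@discM false false) (@discM false true) (@dsep false).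
  have k1 := H1 (maxn N1 N2) (leq_maxl _ _); have k2 := H2 (maxn N1 N2) (leq_maxr _ _).
  have [h1 P1] : exists h, disc (Some (true, h)) `<=` iter (s (maxn N1 N2)) f @` disc x.
    by case: k1 => k1; [exists false|exists true].
  have [h2 P2] : exists h, disc (Some (false, h)) `<=` iter (s (maxn N1 N2)) f @` disc x.
    by case: k2 => k2; [exists false|exists true].
  by exists (s (maxn N1 N2), fun t => if t then h1 else h2); case.
pose n x := (q x).1; pose nx x t : option (bool * bool) := Some (t, (q x).2 t).
(* At time 0 the disc [x] itself would contain centres from both sides, which are more than [2 r0]
   apart. *)
have n0 x : (0 < n x)%N.
  rewrite lt0n; apply/eqP => nx0.
  have inx t : disc x (ctr (Some (t, (q x).2 t))).
    have := Hq x t (ctr (Some (t, (q x).2 t))); rewrite -/(n x) nx0 => H.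
    have [|v vx <-//] := H; by rewrite /disc /= subrr md0 ltW.
  have := far ((q x).2 true) ((q x).2 false); have := inx true; have := inx false.
  rewrite /disc /= => h1 h2; rewrite ltNge => /negP; apply.
  have := md_tri (ctr (Some (true, (q x).2 true))) (ctr x) (ctr (Some (false, (q x).2 false))).
  by rewrite (mdB (ctr x)); lra.
have cov x t : disc (nx x t) `<=` iter (n x) f @` disc x by exact: Hq.
have rad0 (x : option (bool * bool)) : 0 < (fun _ => r0) x by [].
have /choice [z Hz] := fun s => itinerary ef nc rad0 Jctr cov None s.
have [M1 HM1] := @itinerary_bounded R f ef _ ctr (fun _ => r0) n nx n0.
have Ez s : E (z s).
  apply: KJE; split; last by have [] := Hz s.
  by exists M1 => m; rewrite norm_md cr_le; apply: (HM1 None s); have [] := Hz s.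
have Eit s m : E (iter m f (z s)) by elim: m => //= m /fE.
have Nz s : N (z s).
  by apply: HN; have [_ /(_ 0%N)] := Hz s; move=> h; exact: le_lt_trans h r0N'.
have sidez s k : side (s k) (iter (tm n nx None s k.+1) f (z s)).
  have [_ /(_ k.+1)] := Hz s; rewrite stS => h; apply: discside (Eit _ _); exact: h.
pose comp s := connected_component E (z s).
have cm s : components_meeting E N (comp s).
  by exists (z s) => //; split=> //; exists (z s); split=> //; apply: connected_component_refl.
(* At the least [k] with [s k] different from [s' k], the prefixes agree, hence so do the times [tm]
   at [k.+1]. *)
have compI s s' : comp s = comp s' -> s = s'.
  move=> cE; apply: contrapT => ss'.
  have exk : exists k, s k != s' k.
    apply: contrapT => H; apply: ss'; apply/funext => k; apply/eqP/negPn/negP => sk.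
    by apply: H; exists k.
  case: (ex_minnP exk) => k sk kmin.
  have pre i : (i < k)%N -> s i = s' i.
    by move=> ik; apply/eqP/negPn/negP => /kmin; rewrite leqNgt ik.
  have [stE tmE] := st_tm_eq n nx None pre.
  have tE : tm n nx None s k.+1 = tm n nx None s' k.+1 by rewrite !tmS stE tmE.
  have h1 := sidez s k; have h2 := sidez s' k; rewrite -tE in h2.
  set T := tm _ _ _ _ _ in h1 h2.
  have zc : comp s (z s) by apply: connected_component_refl.
  have zc' : comp s (z s') by rewrite cE; apply: connected_component_refl.
  have cc : connected (iter T f @` comp s).
    apply: connected_continuous_connected; first exact: component_connected.
    by apply: continuous_subspaceT; apply: cent_continuous; apply: cent_iter.
  have sub : iter T f @` comp s `<=` A `|` B.
    move=> _ [v vc <-]; rewrite -EAB.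
    have : E v by apply: connected_component_sub vc.
    by elim: (T) => //= m IH Ev; apply: fE; apply: IH.
  have i1 : (iter T f @` comp s) (iter T f (z s)) by exists (z s).
  have i2 : (iter T f @` comp s) (iter T f (z s')) by exists (z s').
  have AB v : A v -> B v -> False by move=> Av Bv; have : (A `&` B) v by []; rewrite dAB.
  case: (connected_subset sAB sub cc) => side1.
    have a1 := side1 _ i1; have a2' := side1 _ i2.
    by move: sk h1 h2; case: (s k) (s' k) => [] [] //= _ h1 h2; [exact: AB a2' h2|exact: AB a1 h1].
  have a1 := side1 _ i1; have a2' := side1 _ i2.
  by move: sk h1 h2; case: (s k) (s' k) => [] [] //= _ h1 h2; [exact: AB h1 a1|exact: AB h2 a2'].
move=> /countable_injP [g gI].
apply: (@cantor_bool (fun s => g (comp s))) => s s' /gI gss; apply: compI; apply: gss;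
  exact: mem_set.
Qed.

End Uncountable.

(** * Strongly polynomial-like functions *)

Section PolynomialLike.
Variable R : realType.
Local Notation C := (Cplx R).
Local Notation re := (@complex.Re R).
Implicit Types (a z w : C).
Variable f : C -> C.
Hypothesis ef : cent f.

Lemma bounded_set_md (V : set C) : bounded_set V -> exists M : R, forall z, V z -> md z <= M.
Proof.
move=> [M [Mr H]]; exists (re M + 1) => z Vz.
have Mlt : M < cr (re M + 1).
  rewrite ltcE /=; apply/andP; split; last by rewrite ltrDl ltr01.
  by move: Mr; case: (M) => x y; rewrite complex_real /= => /eqP ->.
by have := H _ Mlt z Vz; rewrite /= norm_md cr_le.
Qed.

Lemma compact_exhaust (Vs : nat -> set C) (A : set C) : (forall n, open (Vs n)) ->
  (forall n, Vs n `<=` Vs n.+1) -> \bigcup_n Vs n = setT -> compact A -> exists n, A `<=` Vs n.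
Proof.
move=> oV mV cV cA; apply: contrapT => H.
have mono m n : (m <= n)%N -> Vs m `<=` Vs n.
  elim: n => [|n IH]; first by rewrite leqn0 => /eqP ->.
  by rewrite leq_eqVlt => /predU1P[->//|/IH mn] z /mn /mV.
have /choice [x Hx] : forall n, exists x, A x /\ ~ Vs n x.
  move=> n; apply: contrapT => H1; apply: H; exists n => z Az; apply: contrapT => nV.
  by apply: H1; exists z.
have [|z _ Hz] := compact_seq cA (x := x); first by move=> n; have [] := Hx n.
have [m _ Vz] : (\bigcup_n Vs n) z by rewrite cV.
have /open_md/(_ z Vz) [d d0 dP] := oV m.
have [n mn /dP Vx] := Hz d m d0.
by have [_] := Hx n; apply; apply: mono mn _ Vx.
Qed.

(** Suppose points [w j] tending to [z] leave [V] at times [s j]. Normality gives a limit [g] along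
    a subsequence, infinity being excluded by the orbit of [z] in [L]. Then [g z] lies in [L], hence
    in the open set [V], and so do late values at [w j]. *)
Lemma Fatou_stable_nbhd (V L : set C) z : open V -> compact L -> L `<=` V ->
  (forall w, V w -> V (f w) -> L w) -> Fatou f z -> (forall k, L (iter k f z)) ->
  exists2 d : R, 0 < d & forall w, md (w - z) < d -> forall k, L (iter k f w).
Proof.
move=> oV cL LV VL [U [oU Uz nU]] Lz; apply: contrapT => H.
(* A point outside [L] at time [k] is outside [V] at time [k] or [k.+1], which turns leaving [L]
   into leaving [V]. *)
have /choice [w Hw] : forall j : nat, exists w, md (w - z) < j.+1%:R^-1 /\ exists k, ~ V (iter k f w).
  move=> j; apply: contrapT => H1; apply: H; exists j.+1%:R^-1; first by rewrite invr_gt0.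
  move=> w wz k; apply: contrapT => nL; apply: H1; exists w; split=> //.
  have [Vk|nV] := pselect (V (iter k f w)); last by exists k.
  by exists k.+1 => Vk1; apply: nL; apply: VL.
have /choice [s Hs] : forall j, exists k, ~ V (iter k f (w j)) by move=> j; have [_] := Hw j.
have [phi [ph cvg]] := nU s.
have phi_ge k : (k <= phi k)%N by elim: k => // k IH; apply: leq_ltn_trans IH (ph k).
have /open_md/(_ z Uz) [r r0 rU] := oU.
pose A : set C := [set w | md (w - z) <= r / 2].
have cA : compact A := @compact_cball R z _.
have Az : A z by rewrite /A /= subrr md0; lra.
have AU : A `<=` U by move=> x xA; apply: rU; apply: le_lt_trans xA _; lra.
have [M HM] := compact_bound cL.
case: cvg => [[g Hg]|/(_ A cA AU M) [N HN]]; last first.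
  by have := HN N (leqnn _) z Az; rewrite norm_md cr_lt ltNge HM.
have gu e : 0 < e -> exists N, forall k, (N <= k)%N -> forall x, A x -> md (iter (s (phi k)) f x - g x) < e.
  by move=> /(Hg A cA AU) [N HN]; exists N => k Nk x /(HN k Nk); rewrite norm_md cr_lt.
have Vg : V (g z).
  have [|y Ly Hy] := compact_seq cL (x := fun k => iter (s (phi k)) f z); first by move=> k; exact: Lz.
  suff -> : g z = y by exact: LV.
  apply/eqP; rewrite -subr_eq0 -md_eq0 eq_le md_ge0 andbT; apply/ler_addgt0Pr => e e0.
  have e20 : 0 < e / 2 by lra.
  have [N HN] := gu _ e20; have [n Nn /= ny] := Hy _ N e20.
  have := HN n Nn z Az; have := md_tri (g z) (iter (s (phi n)) f z) y.
  by rewrite (mdB (g z) (iter _ _ _)); lra.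
have /open_md/(_ _ Vg) [d d0 dV] := oV.
have d40 : 0 < d / 4 by lra.
(* The fixed iterate at [phi N] stands in for continuity of [g]: four distances below [d / 4] lead
   from the late value at [w] to [g z]. *)
have [N HN] := gu _ d40.
have [d1 d10 D1] := cent_ccont (cent_iter ef (s (phi N))) z d40.
have m0 : 0 < Num.min d1 (r / 2) by rewrite lt_min d10; lra.
have [m mP] : exists m : nat, m.+1%:R^-1 < Num.min d1 (r / 2).
  exists (Num.bound (Num.min d1 (r / 2))^-1); rewrite -[X in _ < X]invrK ltf_pV2 ?posrE ?invr_gt0 //.
  apply: lt_trans (archi_boundP _) _; first by rewrite invr_ge0 ltW.
  by rewrite ltr_nat.
pose k := maxn N m; have Nk : (N <= k)%N := leq_maxl _ _.
have [wz _] := Hw (phi k).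
have {}wz : md (w (phi k) - z) < Num.min d1 (r / 2).
  apply: lt_trans wz (le_lt_trans _ mP); rewrite lef_pV2 ?posrE ?ltr0n // ler_nat ltnS.
  exact: leq_trans (leq_maxr _ _) (phi_ge _).
move: wz; rewrite lt_min => /andP[w1 w2].
have Aw : A (w (phi k)) := ltW w2.
apply: (Hs (phi k)); apply: dV.
move: (w (phi k)) Aw w1 => x Ax x1.
have t1 := HN k Nk x Ax; have t2 := HN N (leqnn _) x Ax; have t3 := HN N (leqnn _) z Az.
have t4 := D1 x x1; rewrite mdB in t2.
have u1 := md_tri (iter (s (phi k)) f x) (g x) (g z).
have u2 := md_tri (g x) (iter (s (phi N)) f x) (g z).
have u3 := md_tri (iter (s (phi N)) f x) (iter (s (phi N)) f z) (g z).
lra.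
Qed.

(* Otherwise the points of [A] whose orbit stays in a suitable [V_n] form a nonempty set
   which is compact, by properness of [f : V_n -> W_n], and open, by normality. *)
Lemma clopen_meets_Julia (A B : set C) : strongly_polynomial_like f ->
  Kset f = A `|` B -> separated A B -> A !=set0 -> A `&` Julia f !=set0.
Proof.
move=> [_ [Vs [Ws [mV _ cV _ pl]]]] KE sAB [b Ab]; apply: contrapT => nJ.
have AF z : A z -> Fatou f z by move=> Az; apply: contrapT => Jz; apply: nJ; exists z.
have oV n : open (Vs n) by have [[[_ [[]]]]] := pl n.
have [M HM] : Kset f b by rewrite KE; left.
have [n Hn] := compact_exhaust oV mV cV (@compact_cball R 0 M).
have [[[bV _ _] _] VW _ prop _] := pl n; set V := Vs n in Hn bV VW prop.
have oVn : open V := oV n.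
have [M1 HM1] := bounded_set_md bV.
have ccV : compact (closure V).
  apply: (@subclosed_compact C _ [set z | md (z - 0) <= M1] (@closed_closure _ _) (@compact_cball R 0 M1)).
  rewrite [X in _ `<=` X](closure_id _).1; last exact: closed_cball.
  by apply: closure_subset => z /HM1; rewrite /= subr0.
(* Properness makes [L] compact, since the closure of [V] is a compact subset of the target; an
   orbit staying in [V] stays in [L]. *)
have cL := prop _ ccV VW; set L := V `&` f @^-1` closure V in cL.
have LV : L `<=` V by move=> z [].
have VL w : V w -> V (f w) -> L w by move=> Vw Vfw; split=> //; apply: subset_closure.
pose K1 := [set z | forall k, L (iter k f z)].
have [M2 HM2] := compact_bound cL.
have K1K : K1 `<=` Kset f.
  by move=> z K1z; exists M2 => k; rewrite norm_md cr_le; apply: HM2.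
have closL : closed L by apply: compact_closed => //; exact: norm_hausdorff.
have clK1 : closed K1.
  move=> z cz k; apply: closL => N NN.
  have : nbhs z (iter k f @^-1` N) by apply: (cent_continuous (cent_iter ef k)).
  by move=> /cz [w [K1w Nw]]; exists (iter k f w); split.
pose S := A `&` K1.
have Sb : S b.
  have inV k : V (iter k f b) by apply: Hn => /=; rewrite subr0; have := HM k; rewrite norm_md cr_le.
  by split=> // k; apply: VL; [exact: inV|exact: (inV k.+1)].
have clS : closed S.
  move=> z cz; have K1z : K1 z by apply: clK1; apply: closure_subset cz => w [].
  split=> //; have : Kset f z by apply: K1K.
  rewrite KE => -[//|Bz]; exfalso; case: sAB => cAB _.
  have : (closure A `&` B) z by split=> //; apply: closure_subset cz => w [].
  by rewrite cAB.
have oS z : S z -> exists2 d : R, 0 < d & forall w, md (w - z) < d -> S w.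
  move=> [Az K1z]; have [d d0 dP] := Fatou_stable_nbhd oVn cL LV VL (AF z Az) K1z.
  have [d1 d10 D1] : exists2 d : R, 0 < d & forall w, md (w - z) < d -> ~ B w.
    have nB : ~ closure B z by move=> cB; case: sAB => _ H; have : (A `&` closure B) z by []; rewrite H.
    apply: contrapT => H; apply: nB => N /nbhs_md [e e0 eP].
    apply: contrapT => H1; apply: H; exists e => // w wd Bw; apply: H1; exists w; split=> //.
    exact: eP.
  exists (Num.min d d1); first by rewrite lt_min d0.
  move=> w; rewrite lt_min => /andP[wd wd1]; have K1w : K1 w by apply: dP.
  split=> //; have : Kset f w by apply: K1K.
  by rewrite KE => -[//|Bw]; have := D1 w wd1.
have cS : compact S by apply: (subclosed_compact clS cL) => z [_ /(_ 0%N)].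
(* A nonempty compact set cannot be open: a point of maximal real part could be moved to the
   right. *)
have [||c Sc mx] := @compact_max R S re _ cS.
- by exists b.
- move=> z _ e e0; exists e => // w _; apply: le_lt_trans.
  by rewrite (_ : re w - re z = re (w - z)) ?ler_re_md // !reimE.
have [d d0 dP] := oS c Sc.
have /mx : S (c + cr (d / 2)).
  by apply: dP; rewrite (_ : _ - c = cr (d / 2)); [rewrite md_cr ger0_norm; lra|ring].
by rewrite !reimE /=; lra.
Qed.

End PolynomialLike.

Unset Implicit Arguments.

Theorem theorem1p3 (R : realType) (f : Cplx R -> Cplx R) :
  transcendental_entire f ->
  (connected (Kset f `&` Julia f) \/
   uncountably_many_components_near (Kset f `&` Julia f) (Julia f)) /\
  (strongly_polynomial_like f ->
   connected (Kset f) \/ uncountably_many_components_near (Kset f) (Julia f)).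
Proof.
move=> [entf nonpoly].
have ef : cent f by move=> z; apply/derivable_cder; apply: entf.
have nc a : exists b, f b != f a.
  apply: contrapT => H; apply: nonpoly; exists (f a)%:P%R => z; rewrite hornerC.
  by apply/eqP/negPn/negP => fz; apply: H; exists z.
have Kf z : Kset f z -> Kset f (f z).
  by move=> [M HM]; exists M => n; rewrite -iterSr.
split=> [|spl].
- have [cn|/connectedPn [S [S0 SE sS]]] := pselect (connected (Kset f `&` Julia f)); [by left|right].
  have [[a Sa] [b Sb]] := (S0 false, S0 true).
  have [[Ka Ja] [Kb Jb]] : (Kset f `&` Julia f) a /\ (Kset f `&` Julia f) b.
    by rewrite SE; split; [left|right].
  apply: (uncountable_components ef nc _ _ SE sS Sa Sb) => // z [Kz Jz].
  by split; [apply: Kf|apply: Julia_image].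
- have [cn|/connectedPn [S [S0 SE sS]]] := pselect (connected (Kset f)); [by left|right].
  (* In (a) both pieces consist of Julia points; here a Julia point of each piece has to be
     supplied. *)
  have [a [Sa Ja]] := clopen_meets_Julia ef spl SE sS (S0 false).
  have SE' : Kset f = S true `|` S false by rewrite setUC.
  have sS' : separated (S true) (S false) by rewrite separatedC.
  have [b [Sb Jb]] := clopen_meets_Julia ef spl SE' sS' (S0 true).
  have [Ka Kb] : Kset f a /\ Kset f b by rewrite SE; split; [left|right].
  by apply: (uncountable_components ef nc _ Kf SE sS Sa Sb) => // z [].
Qed.
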